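(* Let $N\ge 1$ be an integer, let $\alpha\ge 0$ be real, and let $\Theta^\alpha(x,y,n)$ ($x,y\in S^N$, $n\ge 1$ an integer) be the kernel of the Riesz means of order $\alpha$ of the spectral expansions of the Laplace-Beltrami operator on $S^N$. Write $\gamma=\gamma(x,y)$ for the spherical distance between $x$ and $y$. Then: 1) if $\left|\frac{\pi}{2}-\gamma\right|<\frac{n}{n+1}\cdot\frac{\pi}{2}$, then $$\Theta^\alpha(x,y,n)=O(1)\left(\frac{n^{(N-1)/2-\alpha}}{(\sin\gamma)^{(N-1)/2}(\sin(\gamma/2))^{1+\alpha}}+\frac{n^{(N-3)/2-\alpha}}{(\sin\gamma)^{(N+1)/2}(\sin(\gamma/2))^{1+\alpha}}+\frac{n^{-1}}{\left(\frac{\sin\gamma}{2}\right)^{1+N}}\right);$$ 2) if $0\le\gamma\le\pi$, then $\Theta^\alpha(x,y,n)=O(1)\,n^{N}$; 3) if $0<\gamma_0\le\gamma\le\pi$, then $\Theta^\alpha(x,y,n)=O(1)\,n^{N-\alpha}$. Here $O(1)$ denotes a quantity bounded in absolute value by a constant independent of $n\ge 1$ and of the points $x,y$ satisfying the stated condition (the constant may depend on $N$ and $\alpha$, and in 3) also on $\gamma_0$).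
   Context: $S^N$ is the unit sphere in $\mathbb{R}^{N+1}$ with surface measure $d\sigma$, and $\gamma(x,y)\in[0,\pi]$ is the spherical (geodesic) distance, i.e. the angle, between $x,y\in S^N$. Let $\Delta_S$ be the Laplace-Beltrami operator on $S^N$. The distinct eigenvalues of $-\Delta_S$ are $\lambda_k=k(k+N-1)$, $k=0,1,2,\dots$; let $H_k$ be the eigenspace for $\lambda_k$ (the spherical harmonics of degree $k$), $a_k=\dim H_k$, and let $Y_1^{(k)},\dots,Y_{a_k}^{(k)}$ be a real orthonormal basis of $H_k$ in $L_2(S^N,d\sigma)$. The zonal harmonic of order $k$ (the reproducing kernel of $H_k$) is $$Z_k(x,y)=\sum_{j=1}^{a_k}Y_j^{(k)}(x)Y_j^{(k)}(y).$$ The kernel of the Riesz means of order $\alpha$ is $$\Theta^\alpha(x,y,n)=\sum_{k=0}^{n}\left(1-\frac{\lambda_k}{\lambda_n}\right)^{\alpha}Z_k(x,y),$$ with the convention $0^0=1$ when $\alpha=0$. *)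

(* Defs.v *)
From HB Require Import structures.
From mathcomp Require Import all_boot all_order all_algebra.
From mathcomp Require Import all_classical all_reals all_analysis.
From mathcomp Require Import measurable_realfun.

Set Implicit Arguments.
Unset Strict Implicit.
Unset Printing Implicit Defensive.

Import Order.TTheory GRing.Theory Num.Theory.
Import numFieldNormedType.Exports.

Local Open Scope classical_set_scope.
Local Open Scope ring_scope.

Definition row_display : measure_display -> measure_display.
Proof. exact. Qed.

(* The product (= Borel) sigma-algebra on R^n, generated by the coordinates. *)
Section row_measurable.
Context {R : realType} (n : nat).

Definition row_coord (i : 'I_n) (x : 'rV[R]_n) : R := x 0 i.

Let row_set0 : g_sigma_preimage row_coord set0.
Proof. exact: sigma_algebra0. Qed.

Let row_setC A : g_sigma_preimage row_coord A ->
  g_sigma_preimage row_coord (~` A).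
Proof. exact: sigma_algebraC. Qed.

Let row_bigcup (F : (set 'rV[R]_n)^nat) :
  (forall i, g_sigma_preimage row_coord (F i)) ->
  g_sigma_preimage row_coord (\bigcup_i (F i)).
Proof. exact: sigma_algebra_bigcup. Qed.

HB.instance Definition _ :=
  @isMeasurable.Build (row_display default_measure_display)
    'rV[R]_n (g_sigma_preimage row_coord) row_set0 row_setC row_bigcup.

End row_measurable.

Section row_measurable_theory.
Context {R : realType}.

Lemma measurable_row_coord n (i : 'I_n) :
  measurable_fun [set: 'rV[R]_n] (row_coord i).
Proof.
move=> _ Y mY; rewrite setTI; apply: sub_sigma_algebra => /=.
rewrite -bigcup_seq/=; exists i => /=; first by rewrite mem_index_enum.
by exists Y => //; rewrite setTI.
Qed.

Lemma measurable_fun_rowP d (T : measurableType d) n (f : T -> 'rV[R]_n) :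
  (forall i, measurable_fun [set: T] (fun t => f t 0 i)) ->
  measurable_fun [set: T] f.
Proof.
move=> mf _ A mA; rewrite setTI.
suff : <<s \big[setU/set0]_(i < n)
    preimage_set_system setT (@row_coord R n i) measurable >>
    `<=` [set B | measurable (f @^-1` B)] by exact.
apply: smallest_sub.
  split => [|B mB|F mF] /=.
  - by rewrite preimage_set0.
  - by rewrite setTD -preimage_setC; exact: measurableC.
  - by rewrite preimage_bigcup; exact: bigcupT_measurable.
rewrite -bigcup_seq => B [i _ [C mC <-]] /=.
by rewrite setTI -[X in measurable X]setTI; exact: mf.
Qed.

End row_measurable_theory.

Lemma sigma_finite_product_measure d1 d2 (T1 : measurableType d1)
    (T2 : measurableType d2) (R : realType)
    (m1 : {sigma_finite_measure set T1 -> \bar R})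
    (m2 : {sigma_finite_measure set T2 -> \bar R}) :
  sigma_finite setT (m1 \x m2)%E.
Proof.
have /sigma_finiteP[F [TF ndF Foo]] := sigma_finiteT m1.
have /sigma_finiteP[G [TG ndG Goo]] := sigma_finiteT m2.
exists (fun n => F n `*` G n).
  rewrite -setXTT TF TG predeqE => -[x y]; split.
    move=> [/= [i _ Fix] [k _ Gky]]; exists (maxn i k) => //; split.
    - by move: x Fix; exact/subsetPset/ndF/leq_maxl.
    - by move: y Gky; exact/subsetPset/ndG/leq_maxr.
  by move=> [i _ []/= ? ?]; split; exists i.
move=> k; have [? ?] := Foo k; have [? ?] := Goo k.
split; first exact: measurableX.
by rewrite product_measure1E// lte_mul_pinfty// ge0_fin_numE.
Qed.

Section lebesgue_row.
Context {R : realType}.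

Definition row_cons n (p : measurableTypeR R * 'rV[R]_n) : 'rV[R]_n.+1 :=
  row_mx (p.1 : R)%:M p.2.

Definition row_uncons n (x : 'rV[R]_n.+1) : measurableTypeR R * 'rV[R]_n :=
  (x 0 0, @rsubmx R 1 1 n x).

Lemma row_uncons_coord n (x : 'rV[R]_n.+1) i :
  (row_uncons x).2 0 i = x 0 (lift ord0 i).
Proof. by rewrite mxE; congr (x _ _); apply/val_inj. Qed.

Lemma row_consK n : cancel (@row_cons n) (@row_uncons n).
Proof.
move=> [a v]; rewrite /row_uncons /row_cons /=; congr pair.
  by rewrite mxE; case: splitP => // j _; rewrite ord1 mxE eqxx.
by rewrite row_mxKr.
Qed.

Lemma row_unconsK n : cancel (@row_uncons n) (@row_cons n).
Proof.
move=> x; apply/rowP => i; rewrite mxE; case: splitP => j ij.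
  by rewrite ord1 mxE eqxx /=; congr (x _ _); apply/val_inj; rewrite /= [RHS]ij ord1.
by rewrite row_uncons_coord; congr (x _ _); apply/val_inj; exact: esym ij.
Qed.

Lemma measurable_row_cons n : measurable_fun setT (@row_cons n).
Proof.
apply: measurable_fun_rowP => i; case: (unliftP ord0 i) => [j ->|->].
  rewrite (_ : (fun _ => _) = row_coord j \o snd).
    by apply: measurableT_comp => //; exact: measurable_row_coord.
  by apply/funext => p; rewrite -row_uncons_coord row_consK.
rewrite (_ : (fun _ => _) = fst)//.
by apply/funext => p; rewrite -[in RHS](row_consK p).
Qed.

HB.instance Definition _ n := isMeasurableFun.Build _ _ _ _
  (@row_cons n) (@measurable_row_cons n).

Lemma measurable_row_uncons n : measurable_fun setT (@row_uncons n).
Proof.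
apply/measurable_fun_pairP; split.
  exact: (measurable_row_coord ord0).
apply: measurable_fun_rowP => i.
rewrite (_ : (fun _ => _) = row_coord (lift ord0 i)).
  exact: measurable_row_coord.
by apply/funext => x; exact: row_uncons_coord.
Qed.

Section step.
Variables (n : nat) (m : {sigma_finite_measure set 'rV[R]_n -> \bar R}).

Definition lebesgue_row_step : set 'rV[R]_n.+1 -> \bar R :=
  pushforward (lebesgue_measure \x m)%E (@row_cons n).

Let step0 : lebesgue_row_step set0 = 0%E.
Proof. exact: measure0. Qed.

Let step_ge0 A : (0 <= lebesgue_row_step A)%E.
Proof. exact: measure_ge0. Qed.

Let step_sigma_additive : semi_sigma_additive lebesgue_row_step.
Proof. exact: measure_semi_sigma_additive. Qed.

HB.instance Definition _ := isMeasure.Build _ _ _ lebesgue_row_step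
  step0 step_ge0 step_sigma_additive.

Let step_sigma_finite : sigma_finite setT lebesgue_row_step.
Proof.
have [F UF mF] : sigma_finite setT (lebesgue_measure \x m)%E.
  exact: sigma_finite_product_measure.
exists (fun i => @row_uncons n @^-1` F i).
  by rewrite -preimage_bigcup -UF preimage_setT.
move=> i; split.
  rewrite -[X in measurable X]setTI; apply: measurable_row_uncons => //.
  exact: (mF i).1.
rewrite /lebesgue_row_step /pushforward -comp_preimage.
rewrite (_ : _ \o _ = id); last by apply/funext => p /=; exact: row_consK.
exact: (mF i).2.
Qed.

HB.instance Definition _ := Measure_isSigmaFinite.Build _ _ _
  lebesgue_row_step step_sigma_finite.

End step.

Fixpoint lebesgue_row n : {sigma_finite_measure set 'rV[R]_n -> \bar R} :=
  match n with
  | 0 => \d_(0 : 'rV[R]_0)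
  | n'.+1 => lebesgue_row_step (lebesgue_row n')
  end.

End lebesgue_row.

Section sphere.
Context {R : realType} {n : nat}.
Implicit Types x y : 'rV[R]_n.

Definition dotp x y : R := \sum_(i < n) x 0 i * y 0 i.

(* The library norm `|x| on 'rV[R]_n is the sup norm. *)
Definition enorm x : R := Num.sqrt (dotp x x).

Definition sphere : set 'rV[R]_n := [set x | enorm x = 1].

Definition sph_dist x y : R := acos (dotp x y).

Definition normalize x : 'rV[R]_n := (enorm x)^-1 *: x.

Lemma measurable_enorm : measurable_fun [set: 'rV[R]_n] enorm.
Proof.
have mdot : measurable_fun [set: 'rV[R]_n] (fun x => dotp x x).
  apply: measurable_sum => i.
  by apply: measurable_funM; exact: (measurable_row_coord i).
rewrite (_ : enorm = (@powR R ^~ 2^-1) \o (fun x => dotp x x)).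
  by apply: measurableT_comp => //; exact: measurable_powR.
apply/funext => x /=; rewrite powR12_sqrt//.
by apply: sumr_ge0 => i _; rewrite -expr2 sqr_ge0.
Qed.

Lemma measurable_normalize : measurable_fun [set: 'rV[R]_n] normalize.
Proof.
apply: measurable_fun_rowP => i.
rewrite (_ : (fun _ => _) =
    (fun x => ((@powR R ^~ (-1)) \o enorm) x * row_coord i x)).
  apply: measurable_funM; last exact: measurable_row_coord.
  by apply: measurableT_comp; [exact: measurable_powR|exact: measurable_enorm].
by apply/funext => x /=; rewrite mxE powR_inv1// sqrtr_ge0.
Qed.

HB.instance Definition _ := isMeasurableFun.Build _ _ _ _
  normalize measurable_normalize.

Definition punctured_ball : set 'rV[R]_n := [set x | 0 < enorm x <= 1].

Lemma measurable_punctured_ball : measurable punctured_ball.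
Proof.
rewrite (_ : punctured_ball = setT `&` enorm @^-1` `]0, 1]).
  by apply: measurable_enorm => //; exact: measurable_itv.
by apply/seteqP; split=> [x|x []] /=; rewrite in_itv.
Qed.

Definition cone_measure : set 'rV[R]_n -> \bar R :=
  pushforward (mrestr (lebesgue_row n) measurable_punctured_ball) normalize.

Let cone0 : cone_measure set0 = 0%E.
Proof. exact: measure0. Qed.

Let cone_ge0 A : (0 <= cone_measure A)%E.
Proof. exact: measure_ge0. Qed.

Let cone_sigma_additive : semi_sigma_additive cone_measure.
Proof. exact: measure_semi_sigma_additive. Qed.

HB.instance Definition _ := isMeasure.Build _ _ _ cone_measure
  cone0 cone_ge0 cone_sigma_additive.

(* In polar coordinates d(vol) = r^(n-1) dr dsigma, so that
   sigma(A) = n * vol { r x | x in A, 0 < r <= 1 }. *)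
Definition surface_measure : {measure set 'rV[R]_n -> \bar R} :=
  mscale (n%:R)%:nng cone_measure.

Definition partial (i : 'I_n) (F : 'rV[R]_n -> R) (x : 'rV[R]_n) : R :=
  'D_('e_i) F x.

Definition laplacian (F : 'rV[R]_n -> R) (x : 'rV[R]_n) : R :=
  \sum_(i < n) partial i (partial i F) x.

Fixpoint Ck (k : nat) (D : set 'rV[R]_n) (F : 'rV[R]_n -> R) : Prop :=
  (forall x, D x -> {for x, continuous F}) /\
  match k with
  | 0 => True
  | k'.+1 => forall i : 'I_n,
      (forall x, D x -> derivable F x 'e_i) /\ Ck k' D (partial i F)
  end.

(* Functions on the sphere are represented by functions on the whole space of
   which only the values on the sphere matter; calculus on the sphere is done
   through the extension that is homogeneous of degree 0. *)
Definition homext (f : 'rV[R]_n -> R) : 'rV[R]_n -> R := f \o normalize.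

Definition smooth_on_sphere (f : 'rV[R]_n -> R) : Prop :=
  forall k, Ck k [set x | x != 0] (homext f).

Definition laplace_beltrami (f : 'rV[R]_n -> R) : 'rV[R]_n -> R :=
  laplacian (homext f).

Definition LB_eigenspace (lambda : R) : set ('rV[R]_n -> R) :=
  [set f | smooth_on_sphere f /\
           forall x, sphere x -> - laplace_beltrami f x = lambda * f x].

Definition L2dot (f g : 'rV[R]_n -> R) : R :=
  \int[surface_measure]_(x in sphere) (f x * g x).

Definition orthonormal_basis (H : set ('rV[R]_n -> R)) (a : nat)
    (Y : 'I_a -> 'rV[R]_n -> R) : Prop :=
  [/\ forall j, H (Y j),
      forall i j, L2dot (Y i) (Y j) = (i == j)%:R &
      forall f, H f -> exists c : 'I_a -> R,
        forall x, sphere x -> f x = \sum_(j < a) c j * Y j x].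

End sphere.

Section riesz.
Context {R : realType} {N : nat}.

Definition LB_eigenvalue (k : nat) : R := k%:R * (k%:R + N%:R - 1).

Definition spherical_harmonics (k : nat) : set ('rV[R]_N.+1 -> R) :=
  LB_eigenspace (LB_eigenvalue k).

Definition zonal_harmonic (a : nat -> nat)
    (Y : forall k, 'I_(a k) -> 'rV[R]_N.+1 -> R) (k : nat) (x y : 'rV[R]_N.+1)
  : R := \sum_(j < a k) Y k j x * Y k j y.

(* The convention 0^0 = 1 is built into powR. *)
Definition riesz_kernel (a : nat -> nat)
    (Y : forall k, 'I_(a k) -> 'rV[R]_N.+1 -> R)
    (alpha : R) (x y : 'rV[R]_N.+1) (n : nat) : R :=
  \sum_(k < n.+1) (1 - LB_eigenvalue k / LB_eigenvalue n) `^ alpha *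
    zonal_harmonic Y k x y.

End riesz.

(* Main.v *)
Require Import Defs.
From HB Require Import structures.
From mathcomp Require Import all_boot all_order all_algebra.
From mathcomp Require Import all_classical all_reals all_analysis.
From mathcomp Require Import measurable_realfun ring lra zify.

Set Implicit Arguments.
Unset Strict Implicit.
Unset Printing Implicit Defensive.

Import Order.TTheory GRing.Theory Num.Theory.
Import numFieldNormedType.Exports.

Local Open Scope classical_set_scope.
Local Open Scope ring_scope.

(** Write M = N - 1 and P_k for the Gegenbauer polynomial of degree k normalized
    by P_k(1) = 1. Up to the area of the sphere, Z_k(x,y) = d_k P_k(x.y) with d_k
    the dimension of H_k, so the kernel is a one-variable sum
      sum_(k <= n) (1 - l_k/l_n)^alpha d_k P_k(t),  t = x.y = cos gamma.

    The identity for Z_k ([zonal_harmonicE]) comes from the reproducing property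
    of P_k(x.y), proved by integration in the ambient space. Functions on the sphere are extended with degree 0 and integrated over the
    ball. Green's formula with a radial cutoff shows that eigenfunctions for
    distinct eigenvalues are orthogonal ([eigen_orthogonal]). If all moments of
    a continuous function against (1 + x.y)^m vanish, it vanishes at x
    ([zonal_moments_eq0]), as these weights concentrate at x. Applied to a
    combination of f in H_k and the zonal polynomial of degree k, this gives the
    reproducing property, whence also |P_k| <= 1 ([gegen_le1]).

    For the sum, multiplication by 1 - t is a difference operator on the
    multiplier, which is a second-order differential operator in the eigenvalue
    variable up to lower-order terms ([zonal_sum_by_parts],
    [divdiff_zonal_diff]). Let L be of the order of 1/sin(gamma/2). The
    multiplier is split near the spectral edge at the scale of the last L
    indices. The edge part is summed absolutely. The remainder is summed by parts
    K times, with 2K >= alpha + 2; divided differences are estimated by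
    derivatives of explicit powers. Both parts give
      (L/n)^alpha L max_k d_k |P_k(t)|        ([riesz_bound]).

    It remains to bound d_k |P_k|. A monotone energy for the Gegenbauer equation
    gives d_k |P_k(cos gamma)| <= C (k+1)^((N-1)/2) (sin gamma)^(-(N-1)/2)
    ([gegen_decay]), hence the first term of the first estimate.
    The bound d_k |P_k| <= d_k <= C (k+1)^(N-1) gives the third estimate, and
    the second one by summing absolute values. *)

(** * Borel sets and Lebesgue measure of cubes *)

Section row_borel.
Context {R : realType} (n : nat).
Implicit Types (x y : 'rV[R]_n) (r : R).

Lemma row_norm_lt x r : 0 < r -> (forall i, `|x 0 i| < r) -> `|x| < r.
Proof.
move=> r0 xr; rewrite /Num.norm /= mx_normrE.
by apply/bigmax_ltP; split=> //= -[a b] _ /=; rewrite ord1.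
Qed.

Definition cube x r : set 'rV[R]_n := [set y | forall i, `|x 0 i - y 0 i| < r].

Lemma measurable_cube x r : measurable (cube x r).
Proof.
rewrite (_ : cube x r = \big[setI/setT]_(i < n) (row_coord i @^-1` ball (x 0 i) r)).
  apply: bigsetI_measurable => i _; rewrite -[X in measurable X]setTI.
  by apply: measurable_row_coord => //; exact: measurable_ball.
rewrite -bigcap_seq; apply/seteqP; split => y /= H i; first by move=> _; exact: H.
by apply: (H i) => /=; rewrite mem_index_enum.
Qed.

Lemma nbhs_cube x (A : set 'rV[R]_n) :
  nbhs x A -> exists2 r, 0 < r & cube x r `<=` A.
Proof.
move=> /nbhs_ballP[r /= r0 rA]; exists r => // y xy; apply: rA.
by rewrite -ball_normE /=; apply: row_norm_lt => // i; rewrite !mxE.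
Qed.

Lemma open_row_measurable (A : set 'rV[R]_n) : open A -> measurable A.
Proof.
move=> oA.
(* Cubes with rational centre and radius contained in A cover A. *)
pose F (q : 'rV[rat]_n * rat) : set 'rV[R]_n :=
  let B := cube (map_mx ratr q.1) (ratr q.2) in if `[< B `<=` A >] then B else set0.
rewrite (_ : A = \bigcup_q F q).
  apply: countable_bigcupT_measurable; first exact: countableP.
  by move=> q; rewrite /F /=; case: ifP => // _; exact: measurable_cube.
apply/seteqP; split=> [x Ax|x [q _]]; last first.
  by rewrite /F; case: ifPn => // /asboolP; exact.
have [r r0 rA] := nbhs_cube (open_nbhs_nbhs (conj oA Ax)).
have /rat_in_itvoo[e] : 0 < r / 2 by rewrite divr_gt0.
rewrite in_itv /= => /andP[e0 er].
have q_ i : {q : rat | `|ratr q - x 0 i| < ratr e}.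
  apply: cid; have /rat_in_itvoo[q] : x 0 i - ratr e < x 0 i + ratr e by lra.
  by rewrite in_itv /= => ?; exists q; rewrite ltr_distl.
pose q := (\row_i sval (q_ i), e).
exists q => //; rewrite /F asboolT => [i|y yq]; rewrite ?mxE; first exact: (svalP (q_ i)).
apply: rA => i; move: (yq i); rewrite !mxE /= => h.
have := svalP (q_ i) => /=; rewrite distrC => h'.
by rewrite (le_lt_trans (ler_distD (ratr (sval (q_ i))) _ _))//; lra.
Qed.

(** The exceptional point is handled by hand: the preimage of a ray is an open
    set up to the origin, and points are Borel. *)
Lemma measurable_continuous_off0 (f : 'rV[R]_n -> R) :
  (forall x, x != 0 -> {for x, continuous f}) ->
  measurable_fun [set: 'rV[R]_n] f.
Proof.
move=> cf.
have o0 : open [set x : 'rV[R]_n | x != 0].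
  rewrite (_ : mkset _ = ~` [set 0]); last by apply/seteqP; split=> x /= /eqP.
  exact/closed_openC/accessible_closed_set1/hausdorff_accessible/norm_hausdorff.
have m0 : measurable [set 0 : 'rV[R]_n].
  rewrite -[X in measurable X]setCK; apply: measurableC; apply: open_row_measurable.
  rewrite (_ : ~` _ = [set x | x != 0])//.
  by apply/seteqP; split=> x /= /eqP.
apply: (measurability _ (RGenOInfty.measurableE R)) => // _ [_ [a ->] <-].
rewrite setTI.
set P := f @^-1` _.
rewrite (_ : P = (P `&` [set x | x != 0]) `|` (P `&` [set 0])); last first.
  rewrite -setIUr (_ : _ `|` _ = setT) ?setIT//.
  by apply/seteqP; split=> // x _; case: (eqVneq x 0) => [->|]; [right|left].
apply: measurableU.
  apply: open_row_measurable; rewrite openE => x [/= Px x0].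
  apply: filterI; last exact: open_nbhs_nbhs.
  apply: cf => //; apply: open_nbhs_nbhs; split => //; exact: interval_open.
have [P0|P0] := pselect (P 0).
  by rewrite (_ : _ `&` _ = [set 0])//; apply/seteqP; split => [x []//|x ->].
by rewrite (_ : _ `&` _ = set0)//; apply/seteqP; split => [x [] + x0 | //]; rewrite x0.
Qed.

Lemma measurable_continuous_row (f : 'rV[R]_n -> R) :
  continuous f -> measurable_fun [set: 'rV[R]_n] f.
Proof. by move=> cf; apply: measurable_continuous_off0 => x _; exact: cf. Qed.

End row_borel.

Section row_cons.
Context {R : realType} (n : nat).

Lemma row_cons0 (t : R) (x : 'rV[R]_n) : row_cons (t, x) 0 0 = t.
Proof. by have := row_consK (t, x) => -[]. Qed.

Lemma row_consS (t : R) (x : 'rV[R]_n) i : row_cons (t, x) 0 (lift ord0 i) = x 0 i.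
Proof. by rewrite -row_uncons_coord row_consK. Qed.

Lemma row_consP (x y : 'rV[R]_n.+1) :
  x 0 0 = y 0 0 -> (forall i, x 0 (lift ord0 i) = y 0 (lift ord0 i)) -> x = y.
Proof.
by move=> h0 h; apply/rowP => i; case: (unliftP ord0 i) => [j ->|->].
Qed.

Lemma row_consD (t u : R) (x y : 'rV[R]_n) :
  row_cons (t + u, x + y) = row_cons (t, x) + row_cons (u, y) :> 'rV[R]_n.+1.
Proof.
by apply: row_consP => [|i]; rewrite [RHS]mxE ?row_cons0 ?row_consS ?mxE.
Qed.

Lemma row_consZ (c t : R) (x : 'rV[R]_n) :
  row_cons (c * t, c *: x) = c *: row_cons (t, x) :> 'rV[R]_n.+1.
Proof.
by apply: row_consP => [|i]; rewrite [RHS]mxE ?row_cons0 ?row_consS ?mxE.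
Qed.

Lemma row_cons_delta0 : row_cons (1, 0) = 'e_ord0 :> 'rV[R]_n.+1.
Proof.
by apply: row_consP => [|i]; rewrite ?row_cons0 ?row_consS !mxE ?eqxx.
Qed.

Lemma row_cons_deltaS (j : 'I_n) :
  row_cons (0, 'e_j) = 'e_(lift ord0 j) :> 'rV[R]_n.+1.
Proof.
by apply: row_consP => [|i]; rewrite ?row_cons0 ?row_consS !mxE.
Qed.

Lemma row_cons_cube (t r : R) (x : 'rV[R]_n) :
  row_cons (n := n) @^-1` (cube (row_cons (t, x)) r) =
  (ball t r : set (measurableTypeR R)) `*` cube x r.
Proof.
apply/seteqP; split => -[u y] /=.
  move=> h; split; first by have := h 0; rewrite !row_cons0.
  by move=> i; have := h (lift ord0 i); rewrite !row_consS.
by move=> [h0 h] i; case: (unliftP ord0 i) => [j ->|->]; rewrite ?row_cons0 ?row_consS.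
Qed.

End row_cons.

Lemma lebesgue_row_cube {R : realType} n (x : 'rV[R]_n) (r : R) : 0 < r ->
  lebesgue_row n (cube x r) = ((2 * r) ^+ n)%:E.
Proof.
move=> r0; elim: n x => [|n IH] x /=.
  rewrite diracE mem_set// => -[]//.
rewrite /lebesgue_row_step /pushforward -[x]row_unconsK.
case: (row_uncons x) => t y; rewrite row_cons_cube product_measure1E.
- rewrite IH exprS EFinM; congr (_ * _)%E.
  by rewrite [LHS](lebesgue_measure_ball t (ltW r0)); congr (_%:E); lra.
- exact: measurable_ball.
- exact: measurable_cube.
Qed.

Section lebesgue_row_bounded.
Context {R : realType} (n : nat).

Lemma integrable_cube (A : set 'rV[R]_n) (f : 'rV[R]_n -> R) (r M : R) : 0 < r ->
  measurable A -> A `<=` cube 0 r -> measurable_fun A f ->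
  (forall x, A x -> `|f x| <= M) ->
  (lebesgue_row n).-integrable A (EFin \o f).
Proof.
move=> r0 mA Ar mf fM; apply: (@measurable_bounded_integrable _ _ _ (lebesgue_row n)) => //.
  apply: (@le_lt_trans _ _ (lebesgue_row n (cube 0 r))); last first.
    by rewrite lebesgue_row_cube ?ltry.
  by apply: le_measure => //; rewrite inE//; exact: measurable_cube.
by exists M; split; [rewrite num_real|move=> k Mk x Ax /=; exact: le_trans (fM _ Ax) (ltW Mk)].
Qed.

End lebesgue_row_bounded.

Section row_cons_calculus.
Context {R : realType} (n : nat).

Lemma continuous_row_consr (t : R) :
  continuous (fun x : 'rV[R]_n => row_cons (t, x) : 'rV[R]_n.+1).
Proof.
move=> x A /nbhs_cube[r r0 rA]; apply/nbhs_ballP; exists r => //= y [_ xy].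
apply: rA => i; case: (unliftP ord0 i) => [j ->|->].
  by rewrite !row_consS; exact: xy.
by rewrite !row_cons0 subrr normr0.
Qed.

Lemma continuous_row_consl (x : 'rV[R]_n) :
  continuous (fun t : R => row_cons (t : measurableTypeR R, x) : 'rV[R]_n.+1).
Proof.
move=> t A /nbhs_cube[r r0 rA]; apply/nbhs_ballP; exists r => //= u tu.
apply: rA => i; case: (unliftP ord0 i) => [j ->|->].
  by rewrite !row_consS subrr normr0.
by rewrite !row_cons0.
Qed.

Lemma is_derive_row_consr (V : 'rV[R]_n.+1 -> R) (t dV : R) (x : 'rV[R]_n) j :
  is_derive (row_cons (t, x) : 'rV[R]_n.+1) 'e_(lift ord0 j) V dV ->
  is_derive x 'e_j (fun y => V (row_cons (t, y))) dV.
Proof.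
move=> [dV1 dV2].
have E : (fun h => h^-1 *: (((fun y => V (row_cons (t, y))) \o shift x) (h *: 'e_j)
             - V (row_cons (t, x)))) =
         (fun h => h^-1 *: ((V \o shift (row_cons (t, x))) (h *: 'e_(lift ord0 j))
             - V (row_cons (t, x)))).
  apply/funext => h /=; congr (_ *: (V _ - _)).
  by rewrite -row_cons_deltaS -row_consZ -row_consD mulr0 add0r.
by split; rewrite /derivable /derive E.
Qed.

Lemma is_derive_row_consl (V : 'rV[R]_n.+1 -> R) (t dV : R) (x : 'rV[R]_n) :
  is_derive (row_cons (t, x) : 'rV[R]_n.+1) 'e_ord0 V dV ->
  is_derive t 1 (fun u => V (row_cons (u, x))) dV.
Proof.
move=> [dV1 dV2].
have E : (fun h => h^-1 *: (((fun u => V (row_cons (u, x))) \o shift t) (h *: 1)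
             - V (row_cons (t, x)))) =
         (fun h => h^-1 *: ((V \o shift (row_cons (t, x))) (h *: 'e_ord0)
             - V (row_cons (t, x)))).
  apply/funext => h /=; congr (_ *: (V _ - _)).
  by rewrite -row_cons_delta0 -row_consZ -row_consD scaler0 add0r.
by split; rewrite /derivable /derive E.
Qed.

End row_cons_calculus.

(** * Integration by parts in Euclidean space *)

Lemma compact_continuous_bounded {R : realType} n (K : set 'rV[R]_n)
    (f : 'rV[R]_n -> R) : compact K ->
  (forall x, K x -> {for x, continuous f}) ->
  exists M, forall x, K x -> `|f x| <= M.
Proof.
move=> cK cf.
have /compact_bounded : compact (f @` K).
  apply: continuous_compact => //; apply: continuous_in_subspaceT => x.
  by rewrite inE; exact: cf.
move=> [M [_ /(_ (M + 1))]]; rewrite ltrDl ltr01 => /(_ isT) H.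
by exists (M + 1) => x Kx; apply: H; exists x.
Qed.

Lemma compact_closed_cube {R : realType} n (r : R) :
  compact [set x : 'rV[R]_n | forall i, `|x 0 i| <= r].
Proof.
rewrite (_ : mkset _ = [set v : 'rV[R]_n | forall i, v ord0 i \in `[- r, r]]).
  by apply: (@rV_compact _ _ (fun=> `[- r, r]%classic)) => _; exact: segment_compact.
by apply/seteqP; split=> x /= h i; have := h i; rewrite in_itv /= ler_norml.
Qed.

Lemma integral_derive_eq0 {R : realType} (v w : R -> R) (r : R) : 0 < r ->
  continuous w -> (forall t : R, is_derive t (1 : R) v (w t)) ->
  (forall t, r <= `|t| -> v t = 0) -> (forall t, r <= `|t| -> w t = 0) ->
  (\int[lebesgue_measure]_t (w t)%:E = 0)%E.
Proof.
move=> r0 cw dv v0 w0.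
have cv : continuous v.
  by move=> t; apply/differentiable_continuous/derivable1_diffP; exact: ex_derive.
transitivity (\int[lebesgue_measure]_(t in `[(- r)%R, r]) (w t)%:E)%E.
  rewrite [RHS]integral_mkcond; apply: eq_integral => t _.
  rewrite patchE; case: ifPn => //; rewrite notin_setE /= in_itv /= => /negP.
  rewrite -ler_norml -ltNge => /ltW tr; by rewrite w0.
rewrite (@continuous_FTC2 _ w v)//.
- by rewrite !v0 ?subee// ?normrN ger0_norm// ltW.
- by rewrite gtrN.
- exact: continuous_subspaceT.
- split=> [t _|//|//].
  + exact: ex_derive.
  + exact/cvg_at_right_filter/cv.
  + exact/cvg_at_left_filter/cv.
- by move=> t _; rewrite derive1E derive_val.
Qed.

Lemma integrable_continuous_cube {R : realType} n (W : 'rV[R]_n -> R) (r : R) :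
  0 < r -> continuous W -> (forall x, ~ cube 0 r x -> W x = 0) ->
  (lebesgue_row n).-integrable setT (EFin \o W).
Proof.
move=> r0 cW W0.
have [M WM] : exists M, forall x, cube 0 r x -> `|W x| <= M.
  have [M WM] := compact_continuous_bounded (@compact_closed_cube R n r)
    (fun x _ => cW x).
  exists M => x xr; apply: WM => i.
  by have := xr i; rewrite mxE sub0r normrN => /ltW.
rewrite (_ : EFin \o W = (EFin \o W) \_ (cube 0 r)).
  apply: (integrable_mkcond _ (measurable_cube 0 r)).1.
  apply: (@integrable_cube R n (cube 0 r) W r M r0) => //.
  - exact: measurable_cube.
  - by apply: measurable_funTS; exact: measurable_continuous_row.
apply/funext => x; rewrite patchE; case: ifPn => //.
by rewrite notin_setE /= => /W0 ->.
Qed.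

(** Fubini: integrate first in a coordinate other than the first one by
    induction on the dimension, or in the first one by the fundamental theorem
    of calculus. *)
Lemma integral_partial_eq0 {R : realType} (n : nat) (j : 'I_n)
    (V W : 'rV[R]_n -> R) (r : R) : 0 < r ->
  continuous W -> (forall x, is_derive x 'e_j V (W x)) ->
  (forall x, ~ cube 0 r x -> V x = 0) -> (forall x, ~ cube 0 r x -> W x = 0) ->
  (\int[lebesgue_row n]_x (W x)%:E = 0)%E.
Proof.
move=> r0; elim: n j V W => [[]//|n IH] j V W cW dV V0 W0.
have iW := integrable_continuous_cube r0 cW W0.
have mW : measurable_fun setT (EFin \o W).
  by apply/measurable_EFinP; exact: measurable_continuous_row.
have iW' : (lebesgue_measure \x lebesgue_row n)%E.-integrable setT
    ((EFin \o W) \o @row_cons R n).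
  apply/integrableP; split.
    by apply: measurableT_comp => //; exact: measurable_row_cons.
  have /integrableP[_] := iW; apply: le_lt_trans.
  have <- := @ge0_integral_pushforward _ _ _ _ _ _ (@measurable_row_cons R n)
    (lebesgue_measure \x lebesgue_row n)%E setT (abse \o (EFin \o W)) => //=.
  exact: measurableT_comp.
transitivity (\int[lebesgue_measure \x lebesgue_row n]_p ((EFin \o W) \o @row_cons R n) p)%E.
  exact: (@integral_pushforward _ _ _ _ _ _ (@measurable_row_cons R n)
    (lebesgue_measure \x lebesgue_row n)%E setT (EFin \o W)).
case: (unliftP ord0 j) => [i|] jE; rewrite jE in dV.
  rewrite -integral12_prod_meas1//; apply: integral0_eq => t _.
  apply: (IH i (fun x => V (row_cons (t, x))) (fun x => W (row_cons (t, x)))).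
  - by move=> x; apply: continuous_comp; [exact: continuous_row_consr|exact: cW].
  - by move=> x; apply: is_derive_row_consr.
  - move=> x x0; apply: V0 => h; apply: x0 => k.
    by have := h (lift ord0 k); rewrite row_consS !mxE.
  - move=> x x0; apply: W0 => h; apply: x0 => k.
    by have := h (lift ord0 k); rewrite row_consS !mxE.
rewrite -integral21_prod_meas1//; apply: integral0_eq => x _.
apply: (@integral_derive_eq0 _ (fun t => V (row_cons (t, x))) (fun t => W (row_cons (t, x))) r) => //.
- by move=> t; apply: continuous_comp; [exact: continuous_row_consl|exact: cW].
- by move=> t; apply: is_derive_row_consl.
- move=> t tr; apply: V0 => /(_ 0); rewrite row_cons0 mxE sub0r normrN.
  by rewrite ltNge tr.
- move=> t tr; apply: W0 => /(_ 0); rewrite row_cons0 mxE sub0r normrN.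
  by rewrite ltNge tr.
Qed.

(** * Directional derivatives of functions of class C^1 *)

Section directional.
Context {R : realType} (n : nat).
Implicit Types (F : 'rV[R]_n -> R) (x y v : 'rV[R]_n).

Lemma partial_shift F y j (s : R) :
  derivable F (s *: 'e_j + y) 'e_j ->
  is_derive s (1 : R) (fun u : R => F (u *: 'e_j + y)) (partial j F (s *: 'e_j + y)).
Proof.
move=> dF.
have E : (fun h : R => h^-1 *: (((fun u : R => F (u *: 'e_j + y)) \o shift s) (h *: (1 : R))
             - F (s *: 'e_j + y))) =
         (fun h : R => h^-1 *: ((F \o shift (s *: 'e_j + y)) (h *: 'e_j)
             - F (s *: 'e_j + y))).
  apply/funext => h /=; congr (_ *: (F _ - _)).
  by rewrite addrA -scalerDl; congr (_ *: _ + _); rewrite [_ *: 1]mulr1.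
by split; rewrite /derivable /partial /derive E.
Qed.

(** Mean value theorem along a coordinate line, in the form that compares the
    increment with a prescribed slope c. *)
Lemma partial_increment F y j (s c e : R) :
  (forall u : R, `|u| <= `|s| -> derivable F (u *: 'e_j + y) 'e_j /\
     `|partial j F (u *: 'e_j + y) - c| <= e) ->
  `|F (s *: 'e_j + y) - F y - s * c| <= `|s| * e.
Proof.
move=> H; pose g (u : R) := F (u *: 'e_j + y).
have dg (u : R) : `|u| <= `|s| -> is_derive u (1 : R) g (partial j F (u *: 'e_j + y)).
  by move=> us; apply: partial_shift; exact: (H _ us).1.
have g0 : F y = g 0 by rewrite /g scale0r add0r.
rewrite g0 -/(g s).
suff [u us ->] : exists2 u, `|u| <= `|s| & g s - g 0 = partial j F (u *: 'e_j + y) * s.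
  by rewrite mulrC -mulrBr normrM ler_wpM2l//; exact: (H _ us).2.
have [s0|s0] := leP 0 s.
  have [u||u] := @MVT_segment R g (fun u => partial j F (u *: 'e_j + y)) 0 s s0.
  - rewrite in_itv /= => /andP[u0 us]; apply: dg; rewrite !ger0_norm//; exact: ltW.
  - apply: derivable_within_continuous => u; rewrite in_itv /= => /andP[u0 us].
    by apply: ex_derive; apply: dg; rewrite !ger0_norm.
  - rewrite in_itv /= => /andP[u0 us] ->; exists u; rewrite ?subr0//.
    by rewrite !ger0_norm.
have [u||u] := @MVT_segment R g (fun u => partial j F (u *: 'e_j + y)) s 0 (ltW s0).
- rewrite in_itv /= => /andP[us u0].
  by apply: dg; rewrite !ltr0_norm// lerN2 ltW.
- apply: derivable_within_continuous => u; rewrite in_itv /= => /andP[us u0].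
  by apply: ex_derive; apply: dg; rewrite (ltr0_norm s0) ler0_norm// lerN2.
- rewrite in_itv /= => /andP[us u0] E; exists u.
    by rewrite (ltr0_norm s0) ler0_norm// lerN2.
  by rewrite -opprB E sub0r mulrN opprK.
Qed.

(** Go from x to x + h v by changing one coordinate at a time and apply the
    mean value theorem to each increment. *)
Lemma is_derive_partial F x v :
  (\forall y \near x, forall i, derivable F y 'e_i) ->
  (forall i, {for x, continuous (partial i F)}) ->
  is_derive x v F (\sum_i v 0 i * partial i F x).
Proof.
move=> dF cF.
suff H : h^-1 *: ((F \o shift x) (h *: v) - F x) @[h --> (0 : R)^'] -->
    \sum_i v 0 i * partial i F x.
  split; first by apply/cvg_ex; eexists; exact: H.
  exact/cvg_lim.
apply/cvgrPdist_le => e e0.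
pose V := 1 + \sum_i `|v 0 i|.
have S0 : 0 <= \sum_i `|v 0 i| by exact: sumr_ge0.
have V0 : 0 < V by rewrite /V; lra.
have vV i : `|v 0 i| <= V.
  rewrite /V (bigD1 i)//=.
  have : 0 <= \sum_(k < n | k != i) `|v 0 k| by exact: sumr_ge0.
  by lra.
have /nbhs_cube[r r0 rH] : \forall y \near x, forall i, derivable F y 'e_i /\
     `|partial i F y - partial i F x| <= e / V.
  have cFx : \forall y \near x, forall i, `|partial i F y - partial i F x| <= e / V.
    apply: (@filter_forall _ _ (fun i y => `|partial i F y - partial i F x| <= e / V) (nbhs x)) => i.
    have /cvgrPdist_le/(_ (e / V)) := cF i.
    by rewrite divr_gt0// => /(_ isT); apply: filterS => y; rewrite distrC.
  near=> y => i; split; first by move: i; near: y.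
  by move: i; near: y.
near=> h.
have h0 : h != 0 by near: h; exact: nbhs_dnbhs_neq.
have hV : `|h| * V < r.
  rewrite -ltr_pdivlMr//; near: h; apply: dnbhs0_lt; exact: divr_gt0.
(* The path visits x + h (tr k), whose first k coordinates have moved. *)
pose tr (k : nat) : 'rV[R]_n := \row_i (if (i < k)%N then v 0 i else 0).
have tr0 : tr 0%N = 0 by apply/rowP => i; rewrite !mxE.
have trn : tr n = v by apply/rowP => i; rewrite !mxE ltn_ord.
have trS (j : 'I_n) : h *: tr j.+1 + x = (h * v 0 j) *: 'e_j + (h *: tr j + x).
  rewrite addrA; congr (_ + _); apply/rowP => i; rewrite !mxE eqxx /= ltnS.
  have [->|ij] := eqVneq i j; first by rewrite leqnn ltnn mulr0 addr0 mulr1.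
  by rewrite leq_eqVlt (inj_eq val_inj) (negbTE ij) /= mulr0 add0r.
have -> : (F \o shift x) (h *: v) - F x =
    \sum_(j < n) (F (h *: tr j.+1 + x) - F (h *: tr j + x)).
  rewrite -(big_mkord xpredT (fun j => F (h *: tr j.+1 + x) - F (h *: tr j + x))).
  by rewrite telescope_sumr// tr0 trn scaler0 add0r.
rewrite scaler_sumr -sumrB.
apply: (@le_trans _ _ (\sum_(j < n) `|v 0 j| * (e / V))).
  apply: le_trans (ler_norm_sum _ _ _) _; apply: ler_sum => j _.
  rewrite trS.
  have := @partial_increment F (h *: tr j + x) j (h * v 0 j) (partial j F x) (e / V).
  set D := F _ - _ => /(_ _) HD.
  have {}HD : `|D - h * v 0 j * partial j F x| <= `|h * v 0 j| * (e / V).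
    apply: HD => u uh; apply: rH => i; rewrite !mxE eqxx /=.
    have [->|ij] := eqVneq i j.
      rewrite ltnn mulr0 add0r mulr1 opprD addrCA subrr addr0 normrN.
      rewrite (le_lt_trans uh)// normrM (le_lt_trans _ hV)// ler_wpM2l//.
    rewrite mulr0 add0r opprD addrCA subrr addr0 normrN normrM.
    rewrite (le_lt_trans _ hV)// ler_wpM2l//; case: ifP => // _.
    by rewrite normr0 ltW.
  rewrite -[h^-1 *: D]/(h^-1 * D).
  have -> : v 0 j * partial j F x - h^-1 * D = - (h^-1 * (D - h * v 0 j * partial j F x)).
    by field.
  rewrite normrN normrM normfV mulrC ler_pdivrMr ?normr_gt0//.
  by apply: le_trans HD _; rewrite normrM mulrAC mulrC mulrA mulrAC.
rewrite -mulr_suml mulrCA ler_piMr ?ltW// ltr_pdivrMr// mul1r /V; lra.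
Unshelve. all: by end_near.
Qed.

End directional.

(** * Pointwise calculus and Euclidean geometry *)

Lemma continuous_at_sum {R : realType} (V : normedModType R) k
    (f : 'I_k -> V -> R) (x : V) :
  (forall i, {for x, continuous (f i)}) ->
  {for x, continuous (fun y => \sum_i f i y)}.
Proof.
move=> cf; apply: (@cvg_big R _ +%R 0 xpredT) => [|i _]; last exact: cf.
exact: add_continuous.
Qed.

Section pointwise_derivatives.
Context {R : realType} {V : normedModType R}.
Implicit Types (f g : V -> R) (x v : V).

(** Below, [is_derive x v f d] is used with an explicit value d; the following
    rules keep scalar multiplication in the form of a product. *)
Lemma drv_eq f x v (d e : R) : is_derive x v f d -> d = e -> is_derive x v f e.
Proof. by move=> ? <-. Qed.

Lemma drv_cst x v (c : R) : is_derive x v (fun _ : V => c) (0 : R).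
Proof. exact: is_derive_cst. Qed.

Lemma drvD f g x v (df dg : R) : is_derive x v f df -> is_derive x v g dg ->
  is_derive x v (fun y => f y + g y) (df + dg).
Proof. exact: is_deriveD. Qed.

Lemma drvM f g x v (df dg : R) : is_derive x v f df -> is_derive x v g dg ->
  is_derive x v (fun y => f y * g y) (df * g x + f x * dg).
Proof.
move=> hf hg; have := @is_deriveM R V f g x v df dg hf hg.
by move/drv_eq; apply; rewrite addrC -[_ *: dg]/(_ * dg) -[_ *: df]/(_ * df) [g x * _]mulrC.
Qed.

Lemma drvMc f x v (c df : R) : is_derive x v f df ->
  is_derive x v (fun y => c * f y) (c * df).
Proof. by move=> hf; apply: (drv_eq (drvM (drv_cst _ _ c) hf)); rewrite mul0r add0r. Qed.

Lemma drvN f x v (df : R) : is_derive x v f df ->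
  is_derive x v (fun y => - f y) (- df).
Proof. exact: is_deriveN. Qed.

Lemma drvB f g x v (df dg : R) : is_derive x v f df -> is_derive x v g dg ->
  is_derive x v (fun y => f y - g y) (df - dg).
Proof. by move=> hf hg; apply: drvD => //; exact: drvN. Qed.

Lemma drv_sum (I : Type) (r : seq I) (f : I -> V -> R) x v (df : I -> R) :
  (forall i, is_derive x v (f i) (df i)) ->
  is_derive x v (fun y => \sum_(i <- r) f i y) (\sum_(i <- r) df i).
Proof.
move=> H; elim: r => [|i r IH].
  rewrite big_nil (_ : (fun y => _) = (fun=> 0)); first exact: drv_cst.
  by apply/funext => y; rewrite big_nil.
rewrite big_cons (_ : (fun y => _) = (fun y => f i y + \sum_(j <- r) f j y)).
  exact: drvD.
by apply/funext => y; rewrite big_cons.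
Qed.

Lemma continuous_atM f g x : {for x, continuous f} -> {for x, continuous g} ->
  {for x, continuous (fun y => f y * g y)}.
Proof. exact: continuousM. Qed.

Lemma continuous_atD f g x : {for x, continuous f} -> {for x, continuous g} ->
  {for x, continuous (fun y => f y + g y)}.
Proof. exact: continuousD. Qed.

Lemma continuous_atB f g x : {for x, continuous f} -> {for x, continuous g} ->
  {for x, continuous (fun y => f y - g y)}.
Proof. exact: continuousB. Qed.

(** A derivative along v at x is a derivative at 0 of a function of one
    variable, which reduces this to the one-dimensional chain rule. *)
Lemma drv_comp (f : R -> R) g x v (df dg : R) :
  is_derive (g x) (1 : R) f df -> is_derive x v g dg ->
  is_derive x v (fun y => f (g y)) (df * dg).
Proof.
have E (u : V -> R) (du : R) :
    is_derive x v u du <-> is_derive (0 : R) (1 : R) (fun h : R => u (h *: v + x)) du.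
  have E1 : (fun h : R => h^-1 *: ((u \o shift x) (h *: v) - u x)) =
    (fun h : R => h^-1 *: (((fun h : R => u (h *: v + x)) \o shift 0) (h *: (1 : R))
        - u (0 *: v + x))).
    by apply/funext => h /=; rewrite addr0 scale0r add0r [_ *: 1]mulr1.
  have E2 : derivable u x v = derivable (fun h : R => u (h *: v + x)) 0 (1 : R).
    by rewrite /derivable E1.
  have E3 : 'D_v u x = 'D_(1 : R) (fun h : R => u (h *: v + x)) 0 by rewrite /derive E1.
  by split=> -[a b]; split; first [by rewrite -E2|by rewrite E2|by rewrite -E3|by rewrite E3].
move=> Hf /E Hg; apply/E.
have := @is_derive1_comp R f (fun h : R => g (h *: v + x)) 0 df dg.
rewrite scale0r add0r; exact.
Qed.

End pointwise_derivatives.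

Section euclid.
Context {R : realType} {n : nat}.
Implicit Types x y : 'rV[R]_n.

Lemma dotpC x y : dotp x y = dotp y x.
Proof. by apply: eq_bigr => i _; rewrite mulrC. Qed.

Lemma dotpZr (c : R) x y : dotp x (c *: y) = c * dotp x y.
Proof. by rewrite /dotp mulr_sumr; apply: eq_bigr => i _; rewrite mxE mulrCA. Qed.

Lemma dotpZl (c : R) x y : dotp (c *: x) y = c * dotp x y.
Proof. by rewrite dotpC dotpZr dotpC. Qed.

Lemma dotpDr x y z : dotp x (y + z) = dotp x y + dotp x z.
Proof. by rewrite /dotp -big_split; apply: eq_bigr => i _; rewrite mxE mulrDr. Qed.

Lemma dotpDl x y z : dotp (x + y) z = dotp x z + dotp y z.
Proof. by rewrite dotpC dotpDr !(dotpC z). Qed.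

Lemma dotp_ge0 x : 0 <= dotp x x.
Proof. by apply: sumr_ge0 => i _; rewrite -expr2 sqr_ge0. Qed.

Lemma dotp_coord_le x i : x 0 i ^+ 2 <= dotp x x.
Proof.
rewrite /dotp (bigD1 i)//= -expr2 lerDl; apply: sumr_ge0 => j _.
by rewrite -expr2 sqr_ge0.
Qed.

Lemma dotp_eq0 x : (dotp x x == 0) = (x == 0).
Proof.
apply/idP/eqP => [/eqP x0|->]; last by rewrite /dotp big1// => i _; rewrite mxE mul0r.
apply/rowP => i; rewrite mxE; apply/eqP; rewrite -sqrf_eq0; apply/eqP/le_anti.
by rewrite sqr_ge0 andbT -x0 dotp_coord_le.
Qed.

Lemma dotp_gt0 x : x != 0 -> 0 < dotp x x.
Proof. by rewrite lt_def dotp_ge0 andbT dotp_eq0. Qed.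

Lemma enorm_sqr x : enorm x ^+ 2 = dotp x x.
Proof. by rewrite sqr_sqrtr// dotp_ge0. Qed.

Lemma enorm_ge0 x : 0 <= enorm x. Proof. exact: sqrtr_ge0. Qed.

Lemma enorm_gt0 x : (0 < enorm x) = (x != 0).
Proof. by rewrite sqrtr_gt0 lt_def dotp_ge0 andbT dotp_eq0. Qed.

Lemma enormZ (c : R) x : enorm (c *: x) = `|c| * enorm x.
Proof.
by rewrite /enorm dotpZl dotpZr mulrA -expr2 sqrtrM ?sqr_ge0// sqrtr_sqr.
Qed.

Lemma sphere_dotp x : sphere x <-> dotp x x = 1.
Proof.
rewrite /sphere /=; split=> h; first by rewrite -enorm_sqr h expr1n.
by rewrite /enorm h sqrtr1.
Qed.

Lemma sphere_neq0 x : sphere x -> x != 0.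
Proof. by rewrite /sphere /= -enorm_gt0 => ->. Qed.

Lemma enorm_normalize x : x != 0 -> enorm (normalize x) = 1.
Proof.
rewrite -enorm_gt0 => x0; rewrite enormZ ger0_norm ?invr_ge0 ?enorm_ge0//.
by rewrite mulVf// gt_eqF.
Qed.

Lemma normalize_sphere x : sphere x -> normalize x = x.
Proof. by rewrite /sphere /= /normalize => ->; rewrite invr1 scale1r. Qed.

Lemma normalizeZ (c : R) x : 0 < c -> normalize (c *: x) = normalize x.
Proof.
move=> c0; have [->|x0] := eqVneq x 0; first by rewrite scaler0.
rewrite /normalize enormZ ger0_norm ?ltW// scalerA invfM mulrAC mulVf ?gt_eqF//.
by rewrite mul1r.
Qed.

Lemma cauchy_schwarz_sphere x y : sphere x -> sphere y -> -1 <= dotp x y <= 1.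
Proof.
move=> /sphere_dotp x1 /sphere_dotp y1.
have h1 := dotp_ge0 (x + y); have h2 := dotp_ge0 (x + (-1) *: y).
move: h1 h2; rewrite !(dotpDl, dotpDr, dotpZl, dotpZr) x1 y1 (dotpC y x) => h1 h2.
by apply/andP; split; lra.
Qed.

Lemma continuous_dotp x : continuous (dotp x).
Proof.
move=> y; apply: continuous_at_sum => i.
apply: (@continuousM R 'rV[R]_n (fun=> x 0 i) (fun z => z 0 i)).
  exact: cst_continuous.
exact: coord_continuous.
Qed.

Lemma continuous_dotp_sqr : continuous (fun y : 'rV[R]_n => dotp y y).
Proof.
move=> y; apply: continuous_at_sum => i.
by apply: (@continuousM R 'rV[R]_n (fun z => z 0 i) (fun z => z 0 i));
  exact: coord_continuous.
Qed.

Lemma continuous_enorm : continuous (@enorm R n).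
Proof.
move=> x; apply: continuous_comp; first exact: continuous_dotp_sqr.
exact: sqrt_continuous.
Qed.

Lemma compact_sphere : compact (@sphere R n).
Proof.
apply: (@subclosed_compact _ _ [set x : 'rV[R]_n | forall i, `|x 0 i| <= 1]).
- rewrite (_ : sphere = @enorm R n @^-1` [set 1])//.
  exact: (continuous_closedP (@enorm R n)).1 continuous_enorm _ (@closed_eq R 1).
- exact: compact_closed_cube.
- move=> x /sphere_dotp x1 i; rewrite -(@ler_pXn2r _ 2) ?nnegrE// expr1n.
  by rewrite real_normK ?num_real// -x1 dotp_coord_le.
Qed.

Lemma is_derive_coord x v i : is_derive x v (fun y : 'rV[R]_n => y 0 i) (v 0 i).
Proof.
have E : (fun h : R => h^-1 *: (((fun y : 'rV[R]_n => y 0 i) \o shift x) (h *: v) - x 0 i))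
   @ 0^' --> v 0 i.
  apply: cvg_near_cst; near=> h => /=.
  rewrite !mxE addrK -[h^-1 *: _]/(h^-1 * _) mulKf//.
  by near: h; exact: nbhs_dnbhs_neq.
by split; [apply/cvg_ex; eexists; exact: E|exact/cvg_lim].
Unshelve. all: by end_near.
Qed.

Lemma delta_coord (i j : 'I_n) : ('e_j : 'rV[R]_n) 0 i = (i == j)%:R.
Proof. by rewrite mxE eqxx. Qed.

Lemma is_derive_delta_coord x (j i : 'I_n) :
  is_derive x 'e_j (fun y : 'rV[R]_n => y 0 i) ((i == j)%:R : R).
Proof. by rewrite -delta_coord; exact: is_derive_coord. Qed.

Lemma sum_delta (f : 'I_n -> R) j : \sum_i f i * (i == j)%:R = f j.
Proof.
rewrite (bigD1 j)//= eqxx mulr1 big1 ?addr0 => [//|i /negbTE ->].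
by rewrite mulr0.
Qed.

Lemma is_derive_dotp x y j : is_derive y 'e_j (dotp x) (x 0 j).
Proof.
apply: (drv_eq (drv_sum _ (fun i => drvMc (x 0 i) (is_derive_delta_coord y j i)))).
exact: sum_delta.
Qed.

Lemma is_derive_dotp_sqr y j :
  is_derive y 'e_j (fun z : 'rV[R]_n => dotp z z) (2 * y 0 j).
Proof.
apply: (drv_eq (drv_sum _ (fun i => drvM (is_derive_delta_coord y j i)
  (is_derive_delta_coord y j i)))).
rewrite big_split /= sum_delta (eq_bigr (fun i => y 0 i * (i == j)%:R)) ?sum_delta; first by ring.
by move=> i _; rewrite mulrC.
Qed.

End euclid.

(** * Homogeneous extensions: Euler's identity and scaling *)

Section homogeneous.
Context {R : realType} {n : nat}.
Implicit Types (f F G : 'rV[R]_n -> R) (x y : 'rV[R]_n).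

Lemma homextZ f (c : R) y : 0 < c -> homext f (c *: y) = homext f y.
Proof. by move=> c0; rewrite /homext /= normalizeZ. Qed.

Lemma homext_sphere f x : sphere x -> homext f x = f x.
Proof. by move=> sx; rewrite /homext /= normalize_sphere. Qed.

Lemma near_neq0 x : x != 0 -> \forall y \near x, y != 0.
Proof.
move=> x0; apply: (@open_nbhs_nbhs _ x [set y | y != 0]); split=> //.
rewrite (_ : mkset _ = ~` [set 0]); last by apply/seteqP; split=> y /= /eqP.
exact/closed_openC/accessible_closed_set1/hausdorff_accessible/norm_hausdorff.
Qed.

(** Only pure second partials are recorded: these are what the Laplacian
    and an integration by parts in one coordinate produce. *)
Definition C2off0 F := forall y, y != 0 ->
  [/\ {for y, continuous F},
      forall i, derivable F y 'e_i,
      forall i, {for y, continuous (partial i F)},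
      forall i, derivable (partial i F) y 'e_i &
      forall i, {for y, continuous (partial i (partial i F))}].

Lemma smooth_C2off0 f : smooth_on_sphere f -> C2off0 (homext f).
Proof.
move=> /(_ 2%N) /= [c0 s] y y0; split.
- exact: c0.
- by move=> i; apply: (s i).1.
- by move=> i; apply: (s i).2.1.
- by move=> i; apply: ((s i).2.2 i).1.
- by move=> i; apply: ((s i).2.2 i).2.1.
Qed.

(** Euler's identity in degree 0: the function is constant along the ray
    through y, so its derivative in the direction y is 0. *)
Lemma euler_homext f y : C2off0 (homext f) -> y != 0 ->
  \sum_i y 0 i * partial i (homext f) y = 0.
Proof.
move=> s y0; have [_ _ c1 _ _] := s y y0.
have H : is_derive y y (homext f) (\sum_i y 0 i * partial i (homext f) y).
  apply: is_derive_partial => //; near=> z => i.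
  suff /s[] : z != 0 by [].
  by near: z; exact: near_neq0.
rewrite -(derive_val (is_derive := H)); apply: cvg_lim => //.
apply: cvg_near_cst; near=> h => /=.
rewrite (_ : h *: y + y = (h + 1) *: y); last by rewrite scalerDl scale1r.
rewrite homextZ ?subrr ?scaler0//.
have : `|h| < 1 by near: h; exact: dnbhs0_lt.
by rewrite ltr_norml => /andP[]; lra.
Unshelve. all: by end_near.
Qed.

Lemma partial_scale F G i (c d : R) y : 0 < c ->
  (forall z, F (c *: z) = d * G z) ->
  derivable F (c *: y) 'e_i -> derivable G y 'e_i ->
  c * partial i F (c *: y) = d * partial i G y.
Proof.
move=> c0 FG dF dG.
have H1 : is_derive y 'e_i (fun z => d * G z) (d * partial i G y).
  exact/drvMc/derivableP.
have H2 : is_derive y 'e_i (fun z => F (c *: z)) (c * partial i F (c *: y)).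
  have dF1 := partial_shift (s := 0) (y := c *: y) (j := i) (F := F).
  have {}dF1 : is_derive (0 : R) (1 : R) (fun u : R => F (u *: 'e_i + c *: y)) (partial i F (c *: y)).
    by move: dF1; rewrite scale0r add0r; apply.
  have H0 : is_derive (0 : R) (1 : R) (fun u : R => c * u) c.
    by apply: (drv_eq (drvMc c (is_derive_id (0 : R) 1))); rewrite mulr1.
  have := @drv_comp R R (fun u : R => F (u *: 'e_i + c *: y)) (fun u : R => c * u) 0 1
    (partial i F (c *: y)) c.
  rewrite mulr0 => /(_ dF1 H0) [D1 D2].
  have E : (fun h : R => h^-1 *: (((fun z => F (c *: z)) \o shift y) (h *: 'e_i) - F (c *: y))) =
     (fun h : R => h^-1 *: (((fun u : R => F ((c * u) *: 'e_i + c *: y)) \o shift 0) (h *: (1 : R))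
       - F ((c * 0) *: 'e_i + c *: y))).
    apply/funext => h /=; rewrite mulr0 scale0r add0r addr0 [_ *: 1]mulr1.
    by congr (_ *: (F _ - _)); rewrite scalerDr scalerA.
  split; first by rewrite /derivable E.
  by rewrite /derive E [LHS]D2 mulrC.
rewrite -(derive_val (is_derive := H1)) -(derive_val (is_derive := H2)).
by congr (derive _ _ _); apply/funext.
Qed.

Lemma partial_homextZ f i (c : R) y : C2off0 (homext f) -> 0 < c -> y != 0 ->
  partial i (homext f) (c *: y) = c^-1 * partial i (homext f) y.
Proof.
move=> s c0 y0; apply: (mulfI (lt0r_neq0 c0)).
rewrite mulrA divff ?lt0r_neq0//; apply: partial_scale => //.
- by move=> z; rewrite homextZ// mul1r.
- by have [] := s (c *: y); rewrite ?scaler_eq0 ?negb_or ?y0 ?lt0r_neq0.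
- by have [] := s y.
Qed.

(** Two applications of the scaling rule. The first partial is redefined as 0
    at the origin so that its homogeneity holds at every point. *)
Lemma laplacian_homextZ f (c : R) y : C2off0 (homext f) -> 0 < c -> y != 0 ->
  laplacian (homext f) (c *: y) = c^-2 * laplacian (homext f) y.
Proof.
move=> s c0 y0; rewrite /laplacian mulr_sumr; apply: eq_bigr => i _.
have cn0 := lt0r_neq0 c0.
have cy0 : c *: y != 0 by rewrite scaler_eq0 negb_or y0 cn0.
have [_ _ _ d1 _] := s y y0; have [_ _ _ d2 _] := s _ cy0.
suff E : c * partial i (partial i (homext f)) (c *: y) = c^-1 * partial i (partial i (homext f)) y.
  apply: (mulfI cn0); rewrite E; move: (partial i _ y) => Q.
  by clear -cn0; rewrite expr2 invfM -mulrA (mulVKf cn0).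
pose P (z : 'rV[R]_n) : R := if z == 0 then 0 else partial i (homext f) z.
have PE (z : 'rV[R]_n) : z != 0 -> \forall t \near z, P t = partial i (homext f) t.
  by move=> z0; near=> t; rewrite /P ifF//; apply/negbTE; near: t; exact: near_neq0.
have dP (z : 'rV[R]_n) : z != 0 -> derivable P z 'e_i /\ partial i P z = partial i (partial i (homext f)) z.
  move=> z0; have [_ _ _ d _] := s z z0.
  have /derivableP D := d i.
  have [A B] : is_derive z 'e_i P (partial i (partial i (homext f)) z).
    by apply: near_eq_is_derive D; near=> t; apply/esym; near: t; exact: PE.
  by split.
have [dP1 e1] := dP y y0; have [dP2 e2] := dP _ cy0.
rewrite -e1 -e2; apply: partial_scale => // z.
rewrite /P scaler_eq0 (negbTE cn0) /=; case: eqP => [_|/eqP z0]; first by rewrite mulr0.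
exact: partial_homextZ.
Unshelve. all: by end_near.
Qed.

End homogeneous.

(** * Green's formula between two homogeneous functions *)

(** The divergence of k(|y|^2)(F grad G - G grad F): the radial derivative of
    the factor k multiplies y.grad G and y.grad F, which vanish by Euler's
    identity, so no gradient term survives. *)
Lemma green_divergence_sum {R : realType} n (y A B C D : 'I_n -> R) (c1 c2 u v : R) :
  \sum_j y j * A j = 0 -> \sum_j y j * B j = 0 ->
  \sum_j (2 * y j * c1 * (u * A j - v * B j) + c2 * (u * C j - v * D j)) =
  c2 * (u * (\sum_j C j) - v * (\sum_j D j)).
Proof.
move=> yA yB; transitivity (2 * c1 * (u * (\sum_j y j * A j) - v * (\sum_j y j * B j))
  + c2 * (u * (\sum_j C j) - v * (\sum_j D j))); last by rewrite yA yB; ring.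
rewrite !mulr_sumr -!sumrB !mulr_sumr -big_split.
by apply: eq_bigr => j _ /=; ring.
Qed.

Section weighted_selfadjoint.
Context {R : realType} {n : nat}.
Variables (f g : 'rV[R]_n -> R).
Let F := homext f.
Let G := homext g.
Hypotheses (cF : C2off0 F) (cG : C2off0 G).
Variables (k k1 : R -> R) (a r : R).
Hypotheses (a0 : 0 < a) (r0 : 0 < r).
Hypothesis dk : forall t : R, is_derive t (1 : R) k (k1 t).
Hypothesis ck1 : continuous k1.
Hypothesis ka : forall t, t < a -> k t = 0 /\ k1 t = 0.
Hypothesis kr : forall t, r ^+ 2 <= t -> k t = 0 /\ k1 t = 0.

Let rho (y : 'rV[R]_n) : R := dotp y y.
Let V (j : 'I_n) (y : 'rV[R]_n) : R := k (rho y) * (F y * partial j G y - G y * partial j F y).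
Let W (j : 'I_n) (y : 'rV[R]_n) : R := 2 * y 0 j * k1 (rho y) * (F y * partial j G y - G y * partial j F y)
  + k (rho y) * (F y * partial j (partial j G) y - G y * partial j (partial j F) y).

Let near_rho0 : \forall y \near (0 : 'rV[R]_n), rho y < a.
Proof.
have : rho @ (0 : 'rV[R]_n) --> rho 0 by exact: continuous_dotp_sqr.
have -> : rho 0 = 0 by apply/eqP; rewrite dotp_eq0.
by move/cvgr_lt; apply.
Qed.

Let off_cube y : ~ cube 0 r y -> r ^+ 2 <= rho y.
Proof.
move=> yr; have [i yi] : exists i, r <= `|y 0 i|.
  apply: contrapT => H; apply: yr => i; rewrite mxE sub0r normrN ltNge.
  by apply/negP => ri; apply: H; exists i.
apply: le_trans (dotp_coord_le y i); rewrite -[leRHS]real_normK ?num_real//.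
by rewrite ler_pXn2r// ?nnegrE// ltW.
Qed.

Let ck : continuous k.
Proof.
by move=> t; apply/differentiable_continuous/derivable1_diffP; exact: ex_derive.
Qed.

Let cW j : continuous (W j).
Proof.
move=> y; have [->|y0] := eqVneq y 0.
  have W0 : \forall z \near (0 : 'rV[R]_n), W j z = 0.
    near=> z; have [] : k (rho z) = 0 /\ k1 (rho z) = 0.
      by apply: ka; near: z; exact: near_rho0.
    by rewrite /W => -> ->; rewrite mulr0 !mul0r addr0.
  rewrite /continuous_at (nbhs_singleton W0).
  exact: (@cvg_near_cst _ _ 0 (W j) _ _ W0).
have [f0 f1 f2 f3 f4] := cF y0; have [g0 g1 g2 g3 g4] := cG y0.
have crho (h : R -> R) : continuous h -> {for y, continuous (fun z => h (rho z))}.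
  by move=> ch; apply: continuous_comp; [exact: continuous_dotp_sqr|exact: ch].
apply: (@continuous_atD R 'rV[R]_n
  (fun y => 2 * y 0 j * k1 (rho y) * (F y * partial j G y - G y * partial j F y))
  (fun y => k (rho y) * (F y * partial j (partial j G) y - G y * partial j (partial j F) y)));
  apply: continuous_atM.
- apply: continuous_atM; last exact: crho.
  by apply: continuous_atM; [exact: cst_continuous|exact: coord_continuous].
- by apply: continuous_atB; apply: continuous_atM.
- exact: crho.
- by apply: continuous_atB; apply: continuous_atM.
Unshelve. all: by end_near.
Qed.

Let dV j y : is_derive y 'e_j (V j) (W j y).
Proof.
have [->|y0] := eqVneq y 0.
  have z0 : \forall z \near (0 : 'rV[R]_n), k (rho z) = 0 /\ k1 (rho z) = 0.
    by near=> z; apply: ka; near: z; exact: near_rho0.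
  apply: (@near_eq_is_derive _ _ _ (fun _ => 0)).
    near=> z; have [e1 _] : k (rho z) = 0 /\ k1 (rho z) = 0 by near: z; exact: z0.
    by rewrite /V e1 mul0r.
  have [e1 e2] := nbhs_singleton z0.
  by rewrite /W e1 e2 mulr0 !mul0r addr0; exact: drv_cst.
have [f0 f1 f2 f3 f4] := cF y0; have [g0 g1 g2 g3 g4] := cG y0.
have D1 := drv_comp (dk (rho y)) (is_derive_dotp_sqr y j).
have D2 := drvB (drvM (derivableP (f1 j)) (derivableP (g3 j)))
  (drvM (derivableP (g1 j)) (derivableP (f3 j))).
apply: (drv_eq (drvM D1 D2)).
rewrite /W -/(partial j F) -/(partial j G).
have E h z : 'D_('e_j) h z = partial j h z by [].
rewrite !E; move: (partial j (partial j F) y) (partial j (partial j G) y) => d2F d2G.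
move: (partial j F y) (partial j G y) (F y) (G y) (k (rho y)) (k1 (rho y)) (y 0 j) => u1 u2 u3 u4 u5 u6 u7.
by clear; ring.
Unshelve. all: by end_near.
Qed.

Let V0 j y : ~ cube 0 r y -> V j y = 0.
Proof. by move=> /off_cube/kr[e _]; rewrite /V e mul0r. Qed.

Let W0 j y : ~ cube 0 r y -> W j y = 0.
Proof. by move=> /off_cube/kr[e1 e2]; rewrite /W e1 e2 mulr0 !mul0r addr0. Qed.

(** Green's second formula on R^n without boundary terms: the radial weight k
    vanishes near the origin and far away, hence the vector field is of class
    C^1 with bounded support, and its divergence has integral 0. *)
Lemma weighted_selfadjoint :
  (\int[lebesgue_row n]_y
     (k (dotp y y) * (F y * laplacian G y - G y * laplacian F y))%:E = 0)%E.
Proof.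
transitivity (\int[lebesgue_row n]_y (\sum_(j < n) (W j y)%:E))%E.
  apply: eq_integral => y _; rewrite sumEFin; congr (_%:E).
  have [->|y0] := eqVneq y 0.
    have [e1 e2] := ka (nbhs_singleton near_rho0).
    by rewrite -/(rho 0) e1 mul0r big1// => j _; rewrite /W e1 e2 mulr0 !mul0r addr0.
  have E := @green_divergence_sum R n (fun j => y 0 j) (fun j => partial j G y) (fun j => partial j F y)
    (fun j => partial j (partial j G) y) (fun j => partial j (partial j F) y)
    (k1 (rho y)) (k (rho y)) (F y) (G y) (euler_homext cG y0) (euler_homext cF y0).
  exact: (esym E).
rewrite integral_sum//; last first.
  by move=> j; exact: (integrable_continuous_cube r0 (cW (j := j)) (@W0 j)).
rewrite big1// => j _; exact: (integral_partial_eq0 r0 (cW (j:=j)) (dV j) (@V0 j) (@W0 j)).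
Qed.

End weighted_selfadjoint.

(** * Radial cutoffs *)

Section cutoff.
Context {R : realType}.
Implicit Types s t : R.

Lemma ctsM (f g : R -> R) : continuous f -> continuous g ->
  continuous (fun s => f s * g s).
Proof. by move=> cf cg s; apply: continuousM; [exact: cf|exact: cg]. Qed.

Lemma ctsB (f g : R -> R) : continuous f -> continuous g ->
  continuous (fun s => f s - g s).
Proof. by move=> cf cg s; apply: continuousB; [exact: cf|exact: cg]. Qed.

Lemma cts_comp (f g : R -> R) : continuous f -> continuous g ->
  continuous (fun s => f (g s)).
Proof. by move=> cf cg s; apply: continuous_comp; [exact: cg|exact: cf]. Qed.

Lemma cts_cst (c : R) : continuous (fun _ : R => c).
Proof. exact: cst_continuous. Qed.

Lemma cts_id : continuous (fun s : R => s).
Proof. by move=> s; exact: cvg_id. Qed.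

(** The square of the positive part, written as a product whose difference
    quotient at 0 is the positive part itself. *)
Definition pos_sqr s := s * Num.max 0 s.

Lemma continuous_max0 : continuous (fun s => Num.max 0 s : R).
Proof.
by move=> s; apply: (@continuous_max _ _ (fun=> 0) id); [exact: cst_continuous|].
Qed.

Lemma pos_sqr_pos s : 0 <= s -> pos_sqr s = s ^+ 2.
Proof. by move=> s0; rewrite /pos_sqr max_r. Qed.

Lemma pos_sqr_neg s : s <= 0 -> pos_sqr s = 0.
Proof. by move=> s0; rewrite /pos_sqr max_l// mulr0. Qed.

Lemma pos_sqr_ge0 s : 0 <= pos_sqr s.
Proof.
have [s0|/ltW s0] := leP 0 s; first by rewrite pos_sqr_pos// sqr_ge0.
by rewrite pos_sqr_neg.
Qed.

Lemma is_derive_pos_sqr s : is_derive s (1 : R) pos_sqr (2 * Num.max 0 s).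
Proof.
have [s0|s0|<-] := ltgtP 0 s.
- apply: (@near_eq_is_derive _ _ _ (fun t => t * t)).
    near=> t; rewrite /pos_sqr max_r// ltW//; near: t; exact: lt_nbhsr.
  apply: (drv_eq (drvM (is_derive_id s 1) (is_derive_id s 1))).
  by rewrite mulr1 mul1r mulrDl !mul1r.
- apply: (@near_eq_is_derive _ _ _ (fun t => 0)).
    near=> t; rewrite pos_sqr_neg// ltW//; near: t; exact: lt_nbhsl.
  by rewrite mulr0; exact: drv_cst.
- rewrite ?maxxx mulr0.
  have H : (fun h : R => h^-1 *: ((pos_sqr \o shift 0) (h *: (1 : R)) - pos_sqr 0)) @ 0^' --> (0 : R).
    apply: (@cvg_trans _ ((fun h : R => Num.max 0 h) @ 0^')).
      apply: near_eq_cvg; near=> h.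
      rewrite /= addr0 [h *: 1]mulr1 (pos_sqr_neg (lexx 0)) subr0 -[_ *: _]/(_ * _).
      rewrite /pos_sqr mulKf//; near: h; exact: nbhs_dnbhs_neq.
    apply: cvg_within_filter.
    by have := @continuous_max0 0; rewrite /continuous_at maxxx.
  by split; [apply/cvg_ex; exists 0|exact/cvg_lim].
Unshelve. all: by end_near.
Qed.

(** One derivative suffices for a cutoff here, since it is integrated by parts
    once; gluing parabolas gives an explicit step of class C^1. *)
Definition step s := 1 - pos_sqr (1 - pos_sqr s).
Definition step1 s := 2 * Num.max 0 (1 - pos_sqr s) * (2 * Num.max 0 s).

Lemma is_derive_step s : is_derive s (1 : R) step (step1 s).
Proof.
apply: (drv_eq (drvB (drv_cst _ _ 1) (drv_comp (is_derive_pos_sqr _)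
  (drvB (drv_cst s _ 1) (is_derive_pos_sqr s))))).
by rewrite /step1; ring.
Qed.

Lemma continuous_pos_sqr : continuous pos_sqr.
Proof.
move=> s; apply/differentiable_continuous/derivable1_diffP.
by have [] := is_derive_pos_sqr s.
Qed.

Lemma continuous_step : continuous step.
Proof.
move=> s; apply/differentiable_continuous/derivable1_diffP.
by have [] := is_derive_step s.
Qed.

Lemma continuous_step1 : continuous step1.
Proof.
apply: ctsM; first apply: ctsM.
- exact: cts_cst.
- apply: (@cts_comp _ (fun s => 1 - pos_sqr s)); first exact: continuous_max0.
  by apply: ctsB; [exact: cts_cst|exact: continuous_pos_sqr].
- by apply: ctsM; [exact: cts_cst|exact: continuous_max0].
Qed.

Lemma step_neg s : s <= 0 -> step s = 0 /\ step1 s = 0.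
Proof.
move=> s0; rewrite /step /step1 (pos_sqr_neg s0) subr0 pos_sqr_pos// (max_l s0).
by rewrite expr1n subrr !mulr0.
Qed.

Lemma step_ge1 s : 1 <= s -> step s = 1.
Proof.
move=> s1; rewrite /step (pos_sqr_neg (s := 1 - _)) ?subr0//.
rewrite pos_sqr_pos; last by lra.
by rewrite subr_le0 -[leLHS](expr1n _ 2) ler_pXn2r ?nnegrE//; lra.
Qed.

Lemma step_itv s : 0 <= step s <= 1.
Proof.
rewrite /step; have p0 := pos_sqr_ge0 s; have := pos_sqr_ge0 (1 - pos_sqr s).
have [h|/ltW h] := leP 0 (1 - pos_sqr s); last by rewrite (pos_sqr_neg h); lra.
rewrite (pos_sqr_pos h) => _; have : (1 - pos_sqr s) ^+ 2 <= 1 by rewrite expr_le1//; lra.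
by have := sqr_ge0 (1 - pos_sqr s); lra.
Qed.

(** A cutoff in t = |y|^2 vanishing for t < 1/(m+1) and for t >= 2; as m grows
    it tends to the indicator of the punctured unit ball. *)
Definition shell (m : nat) t := step (m.+1%:R * t - 1) * step (m.+1%:R * (1 - t) + 1).
Definition shell1 (m : nat) t :=
  step1 (m.+1%:R * t - 1) * m.+1%:R * step (m.+1%:R * (1 - t) + 1)
  - step (m.+1%:R * t - 1) * (step1 (m.+1%:R * (1 - t) + 1) * m.+1%:R).

Lemma is_derive_shell m t : is_derive t (1 : R) (shell m) (shell1 m t).
Proof.
have h1 : is_derive t (1 : R) (fun t => m.+1%:R * t - 1) m.+1%:R.
  apply: (drv_eq (drvB (drvMc m.+1%:R (is_derive_id t 1)) (drv_cst _ _ 1))).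
  by rewrite subr0 mulr1.
have h2 : is_derive t (1 : R) (fun t => m.+1%:R * (1 - t) + 1) (- m.+1%:R).
  apply: (drv_eq (drvD (drvMc m.+1%:R (drvB (drv_cst _ _ 1) (is_derive_id t 1))) (drv_cst _ _ 1))).
  by rewrite addr0 sub0r mulrN mulr1.
apply: (drv_eq (drvM (drv_comp (is_derive_step _) h1) (drv_comp (is_derive_step _) h2))).
by rewrite /shell1; ring.
Qed.

Lemma continuous_shell m : continuous (shell m).
Proof.
move=> s; apply/differentiable_continuous/derivable1_diffP.
by have [] := is_derive_shell m s.
Qed.

Lemma continuous_shell1 m : continuous (shell1 m).
Proof.
have h1 : continuous (fun t : R => m.+1%:R * t - 1).
  by apply: ctsB; [apply: ctsM; [exact: cts_cst|exact: cts_id]|exact: cts_cst].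
have h2 : continuous (fun t : R => m.+1%:R * (1 - t) - (-1)).
  apply: ctsB; [apply: ctsM; [exact: cts_cst|]|exact: cts_cst].
  by apply: ctsB; [exact: cts_cst|exact: cts_id].
rewrite opprK in h2.
apply: ctsB; apply: ctsM.
- apply: ctsM; last exact: cts_cst.
  exact: (cts_comp continuous_step1 h1).
- exact: (cts_comp continuous_step h2).
- exact: (cts_comp continuous_step h1).
- apply: ctsM; last exact: cts_cst.
  exact: (cts_comp continuous_step1 h2).
Qed.

Lemma shell_inner m t : t < m.+1%:R^-1 -> shell m t = 0 /\ shell1 m t = 0.
Proof.
move=> tm; have [e1 e2] : step (m.+1%:R * t - 1) = 0 /\ step1 (m.+1%:R * t - 1) = 0.
  by apply: step_neg; rewrite subr_le0 mulrC -ler_pdivlMr// mul1r ltW.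
by rewrite /shell /shell1 e1 e2; split; ring.
Qed.

Lemma shell_outer m t : 2 <= t -> shell m t = 0 /\ shell1 m t = 0.
Proof.
move=> t2.
have [e1 e2] : step (m.+1%:R * (1 - t) + 1) = 0 /\ step1 (m.+1%:R * (1 - t) + 1) = 0.
  apply: step_neg; have : 1 <= m.+1%:R :> R by rewrite ler1n.
  nra.
by rewrite /shell /shell1 e1 e2; split; ring.
Qed.

Lemma shell_itv m t : 0 <= shell m t <= 1.
Proof.
rewrite /shell; have /andP[a b] := step_itv (m.+1%:R * t - 1).
have /andP[c d] := step_itv (m.+1%:R * (1 - t) + 1).
by rewrite mulr_ge0//= mulr_ile1.
Qed.

Lemma cvg_shell t : shell m t @[m --> \oo] --> (if 0 < t <= 1 then 1 else 0 : R).
Proof.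
have large (c : R) : \forall m \near \oo, c <= m.+1%:R.
  near=> m; have : c <= m%:R by near: m; exact: nbhs_infty_ger.
  by rewrite -natr1; lra.
apply: cvg_near_cst; case: ifPn => [/andP[t0 t1]|].
  near=> m; have : 2 / t <= m.+1%:R by near: m; exact: large.
  rewrite ler_pdivrMr// => h; rewrite /shell !step_ge1 ?mulr1//.
    by rewrite lerDr mulr_ge0// subr_ge0.
  by lra.
rewrite negb_and -leNgt -ltNge => /orP[t0|t1].
  near=> m; apply: (shell_inner _).1.
  by rewrite (le_lt_trans t0)// invr_gt0 ltr0n.
near=> m; have : (t - 1)^-1 <= m.+1%:R by near: m; exact: large.
rewrite -[_^-1]mul1r ler_pdivrMr ?subr_gt0// => h.
have [e _] : step (m.+1%:R * (1 - t) + 1) = 0 /\ step1 (m.+1%:R * (1 - t) + 1) = 0.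
  by apply: step_neg; move: h; set M := m.+1%:R; lra.
by rewrite /shell e mulr0.
Unshelve. all: by end_near.
Qed.

End cutoff.

(** * Orthogonality of eigenfunctions *)

Section sphere_integral.
Context {R : realType} {n : nat}.
Implicit Types (f g h : 'rV[R]_n -> R).

Definition continuous_off0 (F : 'rV[R]_n -> R) := forall y, y != 0 -> {for y, continuous F}.

(** For a function extended with degree 0, integrating over the sphere amounts
    to integrating over the ball, up to the factor n; this avoids polar
    coordinates throughout. *)
Definition ball_integral h : R :=
  (\int[lebesgue_row n]_(y in punctured_ball) homext h y)%R.

Lemma homext_bounded h : continuous_off0 (homext h) ->
  exists M, 0 <= M /\ forall y, `|homext h y| <= M.
Proof.
move=> ch; have [M HM] := compact_continuous_bounded (@compact_sphere R n)
  (fun x sx => ch x (sphere_neq0 sx)).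
exists (Num.max `|homext h 0| M); split; first by rewrite le_max normr_ge0.
move=> y; rewrite le_max; have [->|y0] := eqVneq y 0; first by rewrite lexx.
apply/orP; right; have := HM (normalize y) (enorm_normalize y0).
rewrite homext_sphere//; exact: enorm_normalize.
Qed.

Lemma punctured_ballE y : @punctured_ball R n y = (0 < dotp y y <= 1 : bool).
Proof.
rewrite /punctured_ball /= -enorm_sqr; congr is_true.
by rewrite expr_le1 ?enorm_ge0//  exprn_even_gt0//= lt_def enorm_ge0 andbT.
Qed.

Lemma punctured_ball_cube : @punctured_ball R n `<=` cube 0 2.
Proof.
move=> y; rewrite punctured_ballE => /andP[_ y1] i; rewrite mxE sub0r normrN.
apply: (@le_lt_trans _ _ 1); last by rewrite ltr1n.
rewrite -(@ler_pXn2r _ 2) ?nnegrE// expr1n real_normK ?num_real//.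
exact: le_trans (dotp_coord_le y i) y1.
Qed.

Lemma integrable_supp (W : 'rV[R]_n -> R) (r M : R) : 0 < r ->
  measurable_fun setT W -> (forall x, `|W x| <= M) ->
  (forall x, ~ cube 0 r x -> W x = 0) ->
  (lebesgue_row n).-integrable setT (EFin \o W).
Proof.
move=> r0 mW WM W0; rewrite (_ : EFin \o W = (EFin \o W) \_ (cube 0 r)).
  apply: (integrable_mkcond _ (measurable_cube 0 r)).1.
  apply: (@integrable_cube R n (cube 0 r) W r M r0) => //.
  - exact: measurable_cube.
  - exact: measurable_funTS.
apply/funext => x; rewrite patchE; case: ifPn => //.
by rewrite notin_setE /= => /W0 ->.
Qed.

Lemma dotp_off_cube (y : 'rV[R]_n) : ~ cube 0 2 y -> 2 <= dotp y y.
Proof.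
move=> yc; rewrite leNgt; apply/negP => y2; apply: yc => i.
rewrite mxE sub0r normrN ltNge; apply/negP => h2.
have := dotp_coord_le y i; rewrite -[y 0 i ^+ 2]real_normK ?num_real//.
have : 2 ^+ 2 <= `|y 0 i| ^+ 2 by rewrite ler_pXn2r ?nnegrE.
lra.
Qed.

Lemma integrable_shell h m : continuous_off0 (homext h) ->
  (lebesgue_row n).-integrable setT
    (EFin \o (fun y => shell m (dotp y y) * homext h y)).
Proof.
move=> ch; have [M [M0 HM]] := homext_bounded ch.
apply: (@integrable_supp _ 2 M) => //.
- apply: measurable_funM; last exact: measurable_continuous_off0.
  apply: measurable_continuous_row => y.
  apply: (@continuous_comp 'rV[R]_n R R (fun y => dotp y y) (shell m)).
    exact: continuous_dotp_sqr.
  exact: continuous_shell.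
- move=> y; rewrite normrM.
  have /andP[s0 s1] := @shell_itv R m (dotp y y).
  by rewrite (ger0_norm s0) -[leRHS]mul1r ler_pM.
- by move=> y /dotp_off_cube y2; rewrite (shell_outer m y2).1 mul0r.
Qed.

Lemma integrable_ball h : continuous_off0 (homext h) ->
  (lebesgue_row n).-integrable punctured_ball (EFin \o homext h).
Proof.
move=> ch; have [M [M0 HM]] := homext_bounded ch.
apply: (@integrable_cube R n punctured_ball (homext h) 2 M) => //.
- exact: measurable_punctured_ball.
- exact: punctured_ball_cube.
- by apply: measurable_funTS; exact: measurable_continuous_off0.
Qed.

Lemma ball_integral_fin h : continuous_off0 (homext h) ->
  (\int[lebesgue_row n]_(y in punctured_ball) (homext h y)%:E)%E = (ball_integral h)%:E.
Proof.
move=> ch; rewrite /ball_integral /Rintegral fineK//.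
by apply: integrable_fin_num; [exact: measurable_punctured_ball|exact: integrable_ball].
Qed.

(** Dominated convergence, with a constant times the indicator of a cube as
    dominating function. *)
Lemma cvg_shell_integral h : continuous_off0 (homext h) ->
  (\int[lebesgue_row n]_y (shell m (dotp y y) * homext h y)%:E)%E @[m --> \oo] -->
  (ball_integral h)%:E.
Proof.
move=> ch; have [M [M0 HM]] := homext_bounded ch.
rewrite -ball_integral_fin// integral_mkcond.
have mh : measurable_fun setT (homext h) by exact: measurable_continuous_off0.
have mB := @measurable_punctured_ball R n.
have mC := @measurable_cube R n 0 2.
pose G := (fun y : 'rV[R]_n => (M * \1_(cube 0 2) y)%:E).
have := @dominated_convergence _ _ R (lebesgue_row n) setT measurableT
  (fun m y => (shell m (dotp y y) * homext h y)%:E)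
  ((EFin \o homext h) \_ punctured_ball) G.
move=> H; have [] := H _ _ _ _ _ => //.
- by move=> m; exact: (measurable_int _ (integrable_shell m ch)).
- apply: (measurable_restrictT _ mB).1.
  have mEh : measurable_fun setT (EFin \o homext h) by apply/measurable_EFinP.
  exact: measurable_funTS mEh.
- apply: aeW => y _.
  have := @cvg_shell R (dotp y y); rewrite patchE.
  have [yB|yB] := boolP (0 < dotp y y <= 1) => cs.
    rewrite mem_set ?punctured_ballE//; apply: cvg_EFin; first by near=> m.
    rewrite -[X in _ --> X](mul1r (homext h y)).
    by apply: cvgM => //; exact: cvg_cst.
  rewrite memNset; last by rewrite punctured_ballE; exact/negP.
  apply: cvg_EFin; first by near=> m.
  rewrite -[X in _ --> X](mul0r (homext h y)).
  by apply: cvgM => //; exact: cvg_cst.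
- apply: (@integrable_supp _ 2 M) => //.
  + by apply: measurable_funM.
  + move=> y; rewrite normrM (ger0_norm M0) ler_piMr// indicE.
    by case: (_ \in _); rewrite ?normr1 ?normr0.
  + by move=> y yc; rewrite indicE memNset// mulr0.
- apply: aeW => y m _; rewrite /= lee_fin normrM.
  have /andP[s0 s1] := @shell_itv R m (dotp y y).
  rewrite (ger0_norm s0) indicE.
  have [yc|yc] := boolP (y \in cube 0 2).
    by rewrite mulr1 -[leRHS]mul1r ler_pM.
  have y2 : 2 <= dotp y y by apply: dotp_off_cube; rewrite notin_setE in yc.
  by rewrite (shell_outer m y2).1 mul0r mulr0.
Unshelve. all: by end_near.
Qed.

(** Off the sphere, the Laplacian is recovered from its homogeneity of
    degree -2. *)
Lemma eigen_laplacian f (l : R) y : C2off0 (homext f) ->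
  (forall x, sphere x -> - laplace_beltrami f x = l * f x) -> y != 0 ->
  laplacian (homext f) y = - l / dotp y y * homext f y.
Proof.
move=> cf ef y0; have e0 : 0 < enorm y by rewrite enorm_gt0.
have yE : y = enorm y *: normalize y.
  by rewrite /normalize scalerA divff ?scale1r// gt_eqF.
have sy : sphere (normalize y) by exact: enorm_normalize.
rewrite {1}yE laplacian_homextZ//; last exact: sphere_neq0.
have := ef _ sy; rewrite /laplace_beltrami => /eqP; rewrite eqr_oppLR => /eqP ->.
by rewrite /homext /= enorm_sqr; field; rewrite dotp_eq0.
Qed.

Lemma continuous_homextM f g : continuous_off0 (homext f) -> continuous_off0 (homext g) ->
  continuous_off0 (homext (fun x => f x * g x)).
Proof.
by move=> cf cg y y0; apply: (@continuousM R 'rV[R]_n (homext f) (homext g)); [exact: cf|exact: cg].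
Qed.

Lemma C2off0_continuous F : C2off0 F -> continuous_off0 F.
Proof. by move=> cF y y0; have [] := cF y y0. Qed.

(** Selfadjointness of the Laplace-Beltrami operator. The weight |y|^2 cancels
    the factor |y|^-2 of the Laplacian, so Green's formula with the weight
    |y|^2 shell(|y|^2) reads (l - l') times the integral of f g shell = 0; then
    let the shell fill the ball. *)
Lemma eigen_orthogonal f g (l l' : R) : C2off0 (homext f) -> C2off0 (homext g) ->
  (forall x, sphere x -> - laplace_beltrami f x = l * f x) ->
  (forall x, sphere x -> - laplace_beltrami g x = l' * g x) ->
  l != l' -> ball_integral (fun x => f x * g x) = 0.
Proof.
move=> cf cg ef eg ll.
have cfg : continuous_off0 (homext (fun x => f x * g x)).
  by apply: continuous_homextM; exact: C2off0_continuous.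
have I0 m : (\int[lebesgue_row n]_y
    (shell m (dotp y y) * homext (fun x => f x * g x) y)%:E = 0)%E.
  have r0 : 0 < 2 :> R by [].
  have a0 : 0 < m.+1%:R^-1 :> R by rewrite invr_gt0 ltr0n.
  have dk (t : R) : is_derive t (1 : R) (fun t => t * shell m t) (shell m t + t * shell1 m t).
    by apply: (drv_eq (drvM (is_derive_id t 1) (is_derive_shell m t))); rewrite mul1r.
  have ck1 : continuous (fun t : R => shell m t + t * shell1 m t).
    move=> t; apply: (@continuousD R R R (shell m) (fun t => t * shell1 m t)).
      exact: continuous_shell.
    by apply: ctsM; [exact: cts_id|exact: continuous_shell1].
  have ka (t : R) : t < m.+1%:R^-1 -> t * shell m t = 0 /\ shell m t + t * shell1 m t = 0.
    by move=> /shell_inner[-> ->]; rewrite !mulr0 addr0.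
  have kr (t : R) : 2 ^+ 2 <= t -> t * shell m t = 0 /\ shell m t + t * shell1 m t = 0.
    move=> t4; have /(shell_outer m)[-> ->] : 2 <= t by lra.
    by rewrite !mulr0 addr0.
  have := weighted_selfadjoint cf cg a0 r0 dk ck1 ka kr.
  have E y : dotp y y * shell m (dotp y y) *
      (homext f y * laplacian (homext g) y - homext g y * laplacian (homext f) y) =
      (l - l') * (shell m (dotp y y) * homext (fun x => f x * g x) y).
    have [->|y0] := eqVneq y 0.
      have -> : dotp (0 : 'rV[R]_n) 0 = 0 by apply/eqP; rewrite dotp_eq0.
      by have [e _] := @shell_inner R m 0 a0; rewrite 2!mul0r e mul0r mulr0.
    rewrite (eigen_laplacian cf ef y0) (eigen_laplacian cg eg y0) /homext /=.
    by field; rewrite dotp_eq0.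
  under eq_integral do rewrite E EFinM.
  rewrite integralZl//; last exact: integrable_shell.
  move/eqP; rewrite mule_eq0 eqe subr_eq0 (negbTE ll) /= => /eqP //.
have := cvg_shell_integral cfg; rewrite (_ : (fun m => _) = (fun=> 0%E)); last first.
  by apply/funext => m; exact: I0.
by move/cvg_unique => /(_ (@ereal_hausdorff R)) /(_ _ (cvg_cst _)) [].
Qed.

End sphere_integral.

(** * Integrals over the sphere *)

Section surface.
Context {R : realType} {n : nat}.
Implicit Types (f g h : 'rV[R]_n -> R).

Lemma normalize_idem (y : 'rV[R]_n) : normalize (normalize y) = normalize y.
Proof.
have [->|y0] := eqVneq y 0; last exact/normalize_sphere/enorm_normalize.
by rewrite /normalize !scaler0.
Qed.

Lemma measurable_sphere : measurable (@sphere R n).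
Proof.
rewrite (_ : sphere = setT `&` @enorm R n @^-1` [set 1]); last by rewrite setTI.
exact: measurable_enorm.
Qed.

(** The surface measure is n times the image of the Lebesgue measure of the
    punctured ball under y -> y/|y|. *)
Lemma ge0_integral_surface (f : 'rV[R]_n -> \bar R) :
  measurable_fun setT f -> (forall x, 0 <= f x)%E ->
  (\int[surface_measure]_(x in sphere) f x =
   n%:R%:E * \int[lebesgue_row n]_(y in punctured_ball) f (normalize y))%E.
Proof.
move=> mf f0; have mS := measurable_sphere; have mB := @measurable_punctured_ball R n.
have mN := @measurable_normalize R n.
rewrite ge0_integral_mscale//; last exact: measurable_funTS.
congr (_ * _)%E.
have := @ge0_integral_pushforward _ _ _ _ R _ mN (mrestr (lebesgue_row n) mB) sphere f mS
  (measurable_funTS mf) (fun x _ => f0 x).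
move=> ->.
have mD : measurable (normalize @^-1` (@sphere R n)).
  by rewrite -[X in measurable X]setTI; exact: mN.
have BD : punctured_ball `<=` normalize @^-1` (@sphere R n).
  by move=> y /andP[y0 _] /=; apply: enorm_normalize; rewrite -enorm_gt0.
rewrite (ge0_negligible_integral (N := ~` punctured_ball))//.
- rewrite setDE setCK setIidr//; apply: eq_measure_integral => A mA AB.
  by rewrite /= /mrestr setIidl.
- exact: measurableC.
- by apply: measurable_funTS; exact: measurableT_comp.
- by move=> y _; exact: f0.
- change (@lebesgue_row R n (~` punctured_ball `&` punctured_ball) = 0)%E.
  by rewrite setICl measure0.
Qed.

Lemma Rintegral_surface h : continuous_off0 (homext h) ->
  \int[surface_measure]_(x in sphere) h x = n%:R * ball_integral h.
Proof.
move=> ch; have mB := @measurable_punctured_ball R n.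
have mh : measurable_fun setT (homext h) by exact: measurable_continuous_off0.
have mE : measurable_fun setT (EFin \o homext h) by apply/measurable_EFinP.
have hom y : homext h (normalize y) = homext h y by rewrite /homext /= normalize_idem.
rewrite /Rintegral (eq_integral (fun x => (homext h x)%:E)); last first.
  by move=> x; rewrite inE => sx; rewrite homext_sphere.
rewrite integralE !ge0_integral_surface//; last 2 first.
- exact: measurable_funeneg mE.
- exact: measurable_funepos mE.
have iB := integrable_ball ch.
rewrite (eq_integral (fun y => (EFin \o homext h)^\+ y)%E); last first.
  by move=> y _; rewrite !funeposE /= hom.
rewrite [X in (_ - _ * X)%E](eq_integral (fun y => (EFin \o homext h)^\- y)%E); last first.
  by move=> y _; rewrite !funenegE /= hom.
have /integrable_funepos-/(_ mB) ip := iB.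
have /integrable_funeneg-/(_ mB) im := iB.
have fp := integrable_fin_num mB ip.
have fm := integrable_fin_num mB im.
rewrite -muleBr//; last exact: fin_num_adde_defr.
by rewrite -integralE fineM// ?integrable_fin_num.
Qed.

Lemma L2dot_ball f g : continuous_off0 (homext f) -> continuous_off0 (homext g) ->
  L2dot f g = n%:R * ball_integral (fun x => f x * g x).
Proof. by move=> cf cg; apply: Rintegral_surface; exact: continuous_homextM. Qed.

Lemma ball_integralD f g : continuous_off0 (homext f) -> continuous_off0 (homext g) ->
  ball_integral (fun x => f x + g x) = ball_integral f + ball_integral g.
Proof.
move=> cf cg; rewrite /ball_integral -RintegralD//.
- exact: measurable_punctured_ball.
- exact: integrable_ball.
- exact: integrable_ball.
Qed.

Lemma ball_integralZ (c : R) f : continuous_off0 (homext f) ->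
  ball_integral (fun x => c * f x) = c * ball_integral f.
Proof.
move=> cf; rewrite /ball_integral -RintegralZl//.
- exact: measurable_punctured_ball.
- exact: integrable_ball.
Qed.

Lemma ball_integral_ge0 f : (forall x, sphere x -> 0 <= f x) -> 0 <= ball_integral f.
Proof.
move=> f0; apply: Rintegral_ge0 => y; rewrite punctured_ballE => /andP[y0 _].
apply: f0; apply: enorm_normalize; apply: contraTneq y0 => ->.
by rewrite lt_def dotp_eq0 eqxx.
Qed.

Lemma eq_ball_integral f g : (forall x, sphere x -> f x = g x) ->
  ball_integral f = ball_integral g.
Proof.
move=> fg; apply: eq_Rintegral => y; rewrite inE punctured_ballE => /andP[y0 _].
apply: fg; apply: enorm_normalize; apply: contraTneq y0 => ->.
by rewrite lt_def dotp_eq0 eqxx.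
Qed.

Lemma continuous_homextZ (c : R) f : continuous_off0 (homext f) ->
  continuous_off0 (homext (fun x => c * f x)).
Proof.
by move=> cf y y0; apply: (@continuousM R 'rV[R]_n (fun=> c) (homext f));
  [exact: cst_continuous|exact: cf].
Qed.

Lemma continuous_homextD f g : continuous_off0 (homext f) -> continuous_off0 (homext g) ->
  continuous_off0 (homext (fun x => f x + g x)).
Proof.
by move=> cf cg y y0; apply: (@continuousD R R 'rV[R]_n (homext f) (homext g)); [exact: cf|exact: cg].
Qed.

Lemma le_ball_integral f g : continuous_off0 (homext f) -> continuous_off0 (homext g) ->
  (forall x, sphere x -> f x <= g x) -> ball_integral f <= ball_integral g.
Proof.
move=> cf cg fg; rewrite -subr_ge0.
have -> : ball_integral g - ball_integral f = ball_integral (fun x => g x + -1 * f x).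
  by rewrite ball_integralD ?ball_integralZ ?mulN1r//; exact: continuous_homextZ.
apply: ball_integral_ge0 => x sx; have := fg x sx; lra.
Qed.

Lemma continuous_homext_cst (c : R) : continuous_off0 (homext (fun _ : 'rV[R]_n => c)).
Proof. by move=> y y0; exact: cst_continuous. Qed.

Lemma continuous_normalize_dotp (x : 'rV[R]_n) : continuous_off0 (homext (dotp x)).
Proof.
move=> y y0.
have -> : homext (dotp x) = (fun z => (enorm z)^-1 * dotp x z).
  by apply/funext => z; rewrite /homext /= /normalize dotpZr.
apply: (@continuousM R 'rV[R]_n (fun z => (enorm z)^-1) (dotp x)); last exact: continuous_dotp.
apply: (@continuousV R 'rV[R]_n (@enorm R n)); last exact: continuous_enorm.
by rewrite gt_eqF// enorm_gt0.
Qed.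

Lemma continuous_homext_comp (p : R -> R) (x : 'rV[R]_n) : continuous p ->
  continuous_off0 (homext (fun y => p (dotp x y))).
Proof.
move=> cp y y0; apply: (@continuous_comp 'rV[R]_n R R (homext (dotp x)) p).
  exact: continuous_normalize_dotp.
exact: cp.
Qed.

End surface.

(** * Vanishing of zonal moments *)

Section approximate_identity.
Context {R : realType} {n : nat}.
Implicit Types (f g h : 'rV[R]_n -> R) (x y : 'rV[R]_n).

(** By continuity h > h(x)/2 on a cube around the point x/2, chosen since it is
    interior to the ball. *)
Lemma ball_integral_gt0 h x : continuous_off0 (homext h) ->
  (forall y, sphere y -> 0 <= h y) -> sphere x -> 0 < h x -> 0 < ball_integral h.
Proof.
move=> ch h0 sx hx; pose z := 2^-1 *: x.
have z0 : z != 0 by rewrite scaler_eq0 negb_or invr_eq0 pnatr_eq0 sphere_neq0.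
have hz : homext h z = h x by rewrite homextZ ?invr_gt0// homext_sphere.
have zz : dotp z z = 4^-1.
  by rewrite dotpZl dotpZr (sphere_dotp x).1//; field.
have [r r0 rA] : exists2 r, 0 < r & cube z r `<=`
    [set y | (h x / 2 < homext h y /\ y != 0) /\ dotp y y < 1].
  suff /nbhs_cube : nbhs z [set y | (h x / 2 < homext h y /\ y != 0) /\ dotp y y < 1] by [].
  have n1 : \forall y \near z, h x / 2 < homext h y.
    by apply: (cvgr_gt _ (ch z z0)); rewrite hz ltr_pdivrMr// ltr_pMr// ltr1n.
  have n2 : \forall y \near z, dotp y y < 1.
    by apply: (cvgr_lt _ (@continuous_dotp_sqr R n z)); rewrite zz; lra.
  have n3 := near_neq0 z0.
  by apply: filterI; first apply: filterI.
have CB : cube z r `<=` punctured_ball.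
  by move=> y /rA[[_ y0] y1]; rewrite punctured_ballE dotp_gt0//= ltW.
have hom0 y : punctured_ball y -> 0 <= homext h y.
  move=> /andP[y0 _]; apply: h0; apply: enorm_normalize; by rewrite -enorm_gt0.
have mB := @measurable_punctured_ball R n.
have mC := measurable_cube z r.
have mh : measurable_fun setT (EFin \o homext h).
  by apply/measurable_EFinP; exact: measurable_continuous_off0.
rewrite -lte_fin -ball_integral_fin//.
apply: (@lt_le_trans _ _ (\int[lebesgue_row n]_(y in cube z r) (h x / 2)%:E)%E).
  rewrite integral_cst// [X in (_ * X)%E](lebesgue_row_cube z r0) -EFinM lte_fin.
  by rewrite mulr_gt0 ?divr_gt0// exprn_gt0// mulr_gt0.
apply: (@le_trans _ _ (\int[lebesgue_row n]_(y in cube z r) (homext h y)%:E)%E).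
  apply: ge0_le_integral => //.
  - by move=> y _; rewrite lee_fin divr_ge0// ltW.
  - exact: measurable_funTS mh.
  - by move=> y /rA[[/ltW + _] _]; rewrite lee_fin.
apply: ge0_subset_integral => //.
exact: measurable_funTS mh.
Unshelve. all: by end_near.
Qed.

Lemma sphere_dist_coord x y i : sphere x -> sphere y ->
  (x 0 i - y 0 i) ^+ 2 <= 2 - 2 * dotp x y.
Proof.
move=> /sphere_dotp x1 /sphere_dotp y1.
have := dotp_coord_le (x + (-1) *: y) i.
rewrite !(dotpDl, dotpDr, dotpZl, dotpZr) x1 y1 (dotpC y x) !mxE mulN1r.
lra.
Qed.

(** Growth of (Q/q)^m by Bernoulli's inequality. *)
Lemma geometric_growth_absurd (q Q A B : R) : 0 < q -> q < Q -> 0 < A ->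
  (forall m, A * Q ^+ m <= B * q ^+ m) -> False.
Proof.
move=> q0 qQ A0 H.
have q1 : 1 < Q / q by rewrite ltr_pdivlMr// mul1r.
have [m Hm] : exists m, B / A < m%:R * (Q / q - 1).
  have [m] := @archi_boundP R `|B / A / (Q / q - 1)| (normr_ge0 _).
  exists (Num.bound `|B / A / (Q / q - 1)|).
  rewrite -ltr_pdivrMr ?subr_gt0//; apply: le_lt_trans (ler_norm _) _.
  exact: archi_boundP.
have bern k : 1 + k%:R * (Q / q - 1) <= (Q / q) ^+ k.
  elim: k => [|k IH]; first by rewrite mul0r addr0 expr0.
  rewrite exprS -natr1; move: IH; set u := Q / q; set v := u ^+ k => IH.
  have k0 : 0 <= k%:R :> R by [].
  have h1 : 1 < u by [].
  have := ler_wpM2l (ltW (lt_trans ltr01 h1)) IH.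
  have : 0 <= k%:R * (u - 1) * (u - 1) by rewrite !mulr_ge0 ?subr_ge0// ltW.
  nra.
have := H m; rewrite leNgt => /negP; apply.
have -> : Q ^+ m = (Q / q) ^+ m * q ^+ m by rewrite -exprMn divfK// gt_eqF.
rewrite mulrA ltr_pM2r ?exprn_gt0//.
rewrite mulrC -ltr_pdivrMr//; apply: lt_le_trans (bern m).
by apply: lt_trans Hm _; rewrite ltrDr.
Qed.

Lemma continuous_pow1 m : continuous (fun t : R => (1 + t) ^+ m).
Proof.
apply: (@cts_comp R (fun t => t ^+ m) (fun t => 1 + t)); first exact: exprn_continuous.
by move=> s; apply: continuousD; [exact: cts_cst|exact: cts_id].
Qed.

(** Laplace's method: the weight (1 + x.y)^m concentrates at y = x. If f(x) > 0
    then f >= f(x)/2 on the cap x.y > 1 - d; the smaller cap x.y > 1 - d/2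
    contributes at least a multiple of (2 - d/2)^m, and the complement of the
    large cap at most a multiple of (2 - d)^m, so the moments cannot all
    vanish. *)
Lemma zonal_moments_le0 f x : continuous_off0 (homext f) -> sphere x ->
  (forall m, ball_integral (fun y => (1 + dotp x y) ^+ m * f y) = 0) -> f x <= 0.
Proof.
move=> cf sx H; rewrite leNgt; apply/negP => fx.
have [M [M0 HM]] := homext_bounded cf.
have x0 := sphere_neq0 sx.
have [r r0 rA] : exists2 r, 0 < r & cube x r `<=` [set y | f x / 2 < homext f y].
  apply: nbhs_cube; apply: (cvgr_gt _ (cf x x0)).
  by rewrite homext_sphere// ltr_pdivrMr// ltr_pMr// ltr1n.
pose d := Num.min 1 (r ^+ 2 / 4).
have d0 : 0 < d by rewrite lt_min ltr01 divr_gt0// exprn_gt0.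
have d1 : d <= 1 by rewrite ge_min lexx.
have d2 : d <= r ^+ 2 / 4 by rewrite ge_min lexx orbT.
have cap y : sphere y -> 1 - d < dotp x y -> f x / 2 <= f y.
  move=> sy xy; rewrite -[leRHS]homext_sphere//; apply/ltW/rA => i.
  rewrite -(@ltr_pXn2r _ 2) ?nnegrE// ?ltW// real_normK ?num_real//.
  by have := sphere_dist_coord i sx sy; lra.
(* A continuous bump supported in the small cap. *)
pose phi (t : R) := Num.max 0 (t - (1 - d / 2)).
have cphi : continuous phi.
  apply: (@cts_comp R (fun t => Num.max 0 t) (fun t => t - (1 - d / 2))).
    exact: continuous_max0.
  by apply: ctsB; [exact: cts_id|exact: cts_cst].
have cp := continuous_homext_comp (x := x) cphi.
pose J := ball_integral (fun y => phi (dotp x y)).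
pose V := ball_integral (fun _ : 'rV[R]_n => 1).
have J0 : 0 < J.
  apply: (@ball_integral_gt0 _ x) => //.
    by move=> y _; rewrite le_max lexx.
  by rewrite (sphere_dotp x).1// lt_max; apply/orP; right; lra.
apply: (@geometric_growth_absurd (2 - d) (2 - d / 2) (f x / 2 * J) (M * V)).
- lra.
- lra.
- by rewrite mulr_gt0// divr_gt0.
move=> m.
have cm : continuous_off0 (homext (fun y => (1 + dotp x y) ^+ m * f y)).
  apply: continuous_homextM => //.
  exact: (@continuous_homext_comp R n (fun t => (1 + t) ^+ m) x (@continuous_pow1 m)).
rewrite -subr_ge0.
have -> : M * V * (2 - d) ^+ m - f x / 2 * J * (2 - d / 2) ^+ m =
  ball_integral (fun y => (1 + dotp x y) ^+ m * f y + ((M * (2 - d) ^+ m) * 1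
     + (- (f x / 2 * (2 - d / 2) ^+ m)) * phi (dotp x y))).
  have c1 := @continuous_homext_cst R n 1.
  rewrite ball_integralD// ?H; last first.
    by apply: continuous_homextD; apply: continuous_homextZ.
  rewrite ball_integralD ?ball_integralZ//; try exact: continuous_homextZ.
  by rewrite -/V -/J; ring.
apply: ball_integral_ge0 => y sy; rewrite mulr1.
have /andP[t0 t1] := cauchy_schwarz_sphere sx sy.
have q0 : 0 <= (2 - d) ^+ m by rewrite exprn_ge0//; lra.
have Q0 : 0 <= (2 - d / 2) ^+ m by rewrite exprn_ge0//; lra.
have fM : `|f y| <= M by rewrite -(homext_sphere _ sy).
have e0 : 0 <= (1 + dotp x y) ^+ m by rewrite exprn_ge0//; lra.
have [h1|h1] := leP (1 - d / 2) (dotp x y).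
  have fy : f x / 2 <= f y by apply: cap => //; lra.
  have : (2 - d / 2) ^+ m <= (1 + dotp x y) ^+ m by rewrite lerXn2r ?nnegrE; lra.
  rewrite /phi max_r; last by lra.
  move=> h2; have : f x / 2 * (2 - d / 2) ^+ m <= f y * (1 + dotp x y) ^+ m.
    by rewrite ler_pM// divr_ge0// ltW.
  have h3 : 0 <= f x / 2 * (2 - d / 2) ^+ m by rewrite mulr_ge0// divr_ge0// ltW.
  have : f x / 2 * (2 - d / 2) ^+ m * (dotp x y - (1 - d / 2)) <= f x / 2 * (2 - d / 2) ^+ m * 1.
    by rewrite ler_wpM2l//; lra.
  have : 0 <= M * (2 - d) ^+ m by rewrite mulr_ge0.
  by rewrite (mulrC (f y)); lra.
rewrite /phi max_l ?mulr0 ?addr0; last by lra.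
have [h2|h2] := leP (dotp x y) (1 - d).
  have : (1 + dotp x y) ^+ m <= (2 - d) ^+ m by rewrite lerXn2r ?nnegrE; lra.
  move=> h3; have : `|(1 + dotp x y) ^+ m * f y| <= (2 - d) ^+ m * M.
    by rewrite normrM ler_pM// ger0_norm.
  by rewrite ler_norml mulrC (mulrC M) => /andP[]; lra.
have fy := cap y sy h2.
rewrite addr_ge0// mulr_ge0//.
by apply: le_trans fy; rewrite divr_ge0// ltW.
Qed.

(** Injectivity of the moments at the pole stands in for the completeness of
    zonal polynomials. *)
Lemma zonal_moments_eq0 f x : continuous_off0 (homext f) -> sphere x ->
  (forall m, ball_integral (fun y => (1 + dotp x y) ^+ m * f y) = 0) -> f x = 0.
Proof.
move=> cf sx H; apply/le_anti; rewrite (zonal_moments_le0 cf sx H) /=.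
rewrite -oppr_le0 -mulN1r.
apply: (@zonal_moments_le0 (fun y => -1 * f y)) => //; first exact: continuous_homextZ.
move=> m; rewrite -[RHS](mulr0 (-1)) -(H m) -ball_integralZ; last first.
  apply: continuous_homextM => //.
  exact: (@continuous_homext_comp R n (fun t => (1 + t) ^+ m) x (@continuous_pow1 m)).
by apply: eq_ball_integral => y _; ring.
Qed.

End approximate_identity.

(** * Gegenbauer polynomials *)

Section gegenbauer.
Context {R : realType} (M : nat).

(** The Gegenbauer polynomials of the sphere of dimension M+1, normalized to
    take the value 1 at 1: Chebyshev for M = 0 and Legendre for M = 1. *)
Fixpoint gegen (k : nat) : {poly R} :=
  match k with
  | 0 => 1
  | k1.+1 => match k1 with
    | 0 => 'X
    | k2.+1 => ((2 * k2 + M + 2)%:R / (k2 + M + 1)%:R) *: ('X * gegen k1)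
               - (k2.+1%:R / (k2 + M + 1)%:R) *: gegen k2
    end
  end.

Local Notation P := gegen.

Lemma natr_poly_neq0 k : (k.+1%:R : {poly R}) != 0.
Proof. by rewrite -polyC_natr polyC_eq0 pnatr_eq0. Qed.

Lemma gegen_rec k :
  (k + M + 1)%:R * P k.+2 = (2 * k + M + 2)%:R * 'X * P k.+1 - k.+1%:R * P k.
Proof.
rewrite /= -/(P k.+1) mulrBr -!mul_polyC !mulrA -!polyC_natr -!polyCM.
have h : (k + M + 1)%:R != 0 :> R by rewrite addn1 pnatr_eq0.
by rewrite !(mulrC (k + M + 1)%:R) !divfK.
Qed.

(** Both derivative formulas are proved together: each follows from the other
    one and the differentiated three-term recurrence. *)
Lemma gegen_deriv k :
  (1 - 'X ^+ 2) * (P k.+1)^`() = k.+1%:R * (P k - 'X * P k.+1) /\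
  (1 - 'X ^+ 2) * (P k)^`() = (k + M)%:R * ('X * P k - P k.+1).
Proof.
elim: k => [|k [H1 H2]].
  rewrite /= derivX -['X^2]/('X * 'X) -{1 2}[1]/(1%:P) derivC.
  by split; ring.
have rc := gegen_rec k.
have h : ((k + M + 1)%:R : {poly R}) != 0 by rewrite addn1 natr_poly_neq0.
have H2' : (1 - 'X ^+ 2) * (P k.+1)^`() = (k.+1 + M)%:R * ('X * P k.+1 - P k.+2).
  rewrite H1; have -> : (k.+1 + M)%:R = (k + M + 1)%:R :> {poly R} by congr _%:R; lia.
  rewrite [RHS]mulrBr rc; ring.
split; last exact: H2'.
have drc : (k + M + 1)%:R * (P k.+2)^`() = (2 * k + M + 2)%:R * (P k.+1 + 'X * (P k.+1)^`())
    - k.+1%:R * (P k)^`().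
  have := congr1 (@deriv R) rc.
  rewrite derivB !derivM derivX -!(polyC_natr R) !derivC !mul0r !add0r mulr1.
  move=> ->; ring.
apply: (mulfI h).
have -> : (k + M + 1)%:R * ((1 - 'X^2) * (P k.+2)^`()) =
   (2 * k + M + 2)%:R * ((1 - 'X^2) * P k.+1 + 'X * ((1 - 'X^2) * (P k.+1)^`()))
    - k.+1%:R * ((1 - 'X^2) * (P k)^`()).
  by rewrite mulrCA drc; ring.
have -> : (k + M + 1)%:R * (k.+2%:R * (P k.+1 - 'X * P k.+2)) =
  k.+2%:R * ((k + M + 1)%:R * P k.+1 - 'X * ((k + M + 1)%:R * P k.+2)) by ring.
rewrite rc H1 H2; ring.
Qed.

Lemma gegen_ode k :
  (1 - 'X ^+ 2) * (P k)^`()^`() - M.+1%:R * 'X * (P k)^`() + (k * (k + M))%:R * P k = 0.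
Proof.
case: k => [|k].
  by rewrite /= -[1 in X in X^`()]/(1%:P) derivC -[0 in X in X^`()]/(0%:P) derivC mul0n; ring.
have [H1 H2] := gegen_deriv k.
have x2 : (1 - 'X ^+ 2 : {poly R}) != 0.
  by rewrite -oppr_eq0 opprB; apply: monic_neq0; rewrite monicE lead_coefXnsubC.
apply: (mulfI x2); rewrite mulr0.
have dH1 : - (2 * 'X) * (P k.+1)^`() + (1 - 'X ^+ 2) * (P k.+1)^`()^`() =
    k.+1%:R * ((P k)^`() - P k.+1 - 'X * (P k.+1)^`()).
  have dX2 : (1 - 'X ^+ 2 : {poly R})^`() = - (2 * 'X).
    by rewrite derivB derivXn -[1 in X in X^`()]/(1%:P) derivC expr1; ring.
  have dc : (k.+1%:R : {poly R})^`() = 0 by rewrite -polyC_natr derivC.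
  have E1 : ((1 - 'X ^+ 2) * (P k.+1)^`())^`() =
      - (2 * 'X) * (P k.+1)^`() + (1 - 'X ^+ 2) * (P k.+1)^`()^`().
    by rewrite derivM; congr (_ * _ + _); exact: dX2.
  rewrite -E1 H1 derivM dc mul0r add0r derivB derivM derivX mul1r.
  ring.
have -> : (1 - 'X^2) * ((1 - 'X^2) * (P k.+1)^`()^`() - M.+1%:R * 'X * (P k.+1)^`()
     + (k.+1 * (k.+1 + M))%:R * P k.+1) =
  (1 - 'X^2) * (- (2 * 'X) * (P k.+1)^`() + (1 - 'X ^+ 2) * (P k.+1)^`()^`()) 
   + (2%:R - M.+1%:R) * 'X * ((1 - 'X^2) * (P k.+1)^`())
   + (k.+1 * (k.+1 + M))%:R * ((1 - 'X^2) * P k.+1) by ring.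
rewrite dH1.
have -> : (1 - 'X^2) * (k.+1%:R * ((P k)^`() - P k.+1 - 'X * (P k.+1)^`())) =
  k.+1%:R * ((1 - 'X^2) * (P k)^`() - (1 - 'X^2) * P k.+1 - 'X * ((1 - 'X^2) * (P k.+1)^`())) by ring.
rewrite H1 H2; ring.
Qed.

Lemma gegen1 k : (P k).[1] = 1.
Proof.
suff : (P k).[1] = 1 /\ (P k.+1).[1] = 1 by case.
elim: k => [|k [IH1 IH2]]; first by rewrite /= hornerX -[1 in X in X.[_]]/(1%:P) hornerC.
split=> //.
have h : (k + M + 1)%:R != 0 :> R by rewrite addn1 pnatr_eq0.
apply: (mulfI h).
have := congr1 (horner^~ 1) (gegen_rec k).
rewrite !(hornerM, hornerD, hornerN, hornerX) -!(polyC_natr R) !hornerC IH1 IH2 => ->.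
ring.
Qed.

Lemma gegen_recE k t :
  (k + M + 1)%:R * (P k.+2).[t] = (2 * k + M + 2)%:R * t * (P k.+1).[t] - k.+1%:R * (P k).[t].
Proof.
have := congr1 (horner^~ t) (gegen_rec k).
by rewrite !(hornerM, hornerD, hornerN, hornerX) -!(polyC_natr R) !hornerC.
Qed.

End gegenbauer.

(** * Zonal polynomials are spherical harmonics *)

Section elementary.
Context {R : realType} {n : nat}.
Implicit Types (F G : 'rV[R]_n -> R) (x y : 'rV[R]_n).

(** The algebra generated by the coordinates and 1/|y|. It is stable under
    partial derivatives off the origin, which gives smoothness of every order
    at once for the zonal polynomials extended by homogeneity. *)
Inductive elementary : ('rV[R]_n -> R) -> Prop :=
| elem_cst c : elementary (fun=> c)
| elem_coord i : elementary (fun y => y 0 i)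
| elem_invnorm : elementary (fun y => (enorm y)^-1)
| elem_add F G : elementary F -> elementary G -> elementary (fun y => F y + G y)
| elem_mul F G : elementary F -> elementary G -> elementary (fun y => F y * G y).

Lemma is_derive_invnorm y j : y != 0 ->
  is_derive y 'e_j (fun z : 'rV[R]_n => (enorm z)^-1) (- (enorm y)^-1 ^+ 3 * y 0 j).
Proof.
move=> y0; have e0 : enorm y != 0 by rewrite gt_eqF// enorm_gt0.
have d1 := @drv_comp R _ Num.sqrt (fun z : 'rV[R]_n => dotp z z) y 'e_j _ _ (is_derive1_sqrt (dotp_gt0 y0)) (is_derive_dotp_sqr y j).
have H : is_derive (enorm y) (1 : R) (fun s : R => s^-1) (- (enorm y) ^- 2).
  have := @is_deriveV R id (enorm y) 1 1 e0 (is_derive_id _ _).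
  by rewrite /= [_ *: 1]mulr1.
apply: (drv_eq (@drv_comp R _ (fun s => s^-1) (@enorm R n) y 'e_j _ _ H d1)).
by rewrite -/(enorm y); field.
Qed.

Lemma elementary_continuous F y : elementary F -> y != 0 -> {for y, continuous F}.
Proof.
move=> eF y0; elim: eF => [c|i||{}F G _ cF _ cG|{}F G _ cF _ cG].
- exact: cst_continuous.
- exact: coord_continuous.
- apply: (@continuousV R 'rV[R]_n (@enorm R n)); last exact: continuous_enorm.
  by rewrite gt_eqF// enorm_gt0.
- exact: (@continuousD R R 'rV[R]_n F G).
- exact: (@continuousM R 'rV[R]_n F G).
Qed.

Lemma elementary_partial F j : elementary F ->
  exists2 G, elementary G & forall y, y != 0 -> is_derive y 'e_j F (G y).
Proof.
elim=> [c|i||{}F G eF [F' eF' dF] eG [G' eG' dG]|{}F G eF [F' eF' dF] eG [G' eG' dG]].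
- by exists (fun=> 0) => [|y _]; [exact: elem_cst|exact: drv_cst].
- exists (fun=> (i == j)%:R) => [|y _]; first exact: elem_cst.
  exact: is_derive_delta_coord.
- exists (fun y => -1 * ((enorm y)^-1 * ((enorm y)^-1 * (enorm y)^-1)) * y 0 j) => [|y y0].
    by do !apply: elem_mul => //; constructor.
  by apply: (drv_eq (is_derive_invnorm j y0)); ring.
- exists (fun y => F' y + G' y) => [|y y0]; first exact: elem_add.
  by apply: drvD; [exact: dF|exact: dG].
- exists (fun y => F' y * G y + F y * G' y) => [|y y0].
    by apply: elem_add; apply: elem_mul.
  by apply: drvM; [exact: dF|exact: dG].
Qed.

Lemma eq_continuous_off0 F G y : (forall z, z != 0 -> G z = F z) -> y != 0 ->
  {for y, continuous F} -> {for y, continuous G}.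
Proof.
move=> GF y0 cF.
have H : F @ y --> G y by rewrite GF.
have E : \forall z \near y, F z = G z.
  by near=> z; apply/esym/GF; near: z; exact: near_neq0.
exact: cvg_trans (near_eq_cvg E) H.
Unshelve. all: by end_near.
Qed.

Lemma elementary_Ck k F G : elementary F -> (forall y, y != 0 -> G y = F y) ->
  Ck k [set y | y != 0] G.
Proof.
have cGF F1 G1 : elementary F1 -> (forall y, y != 0 -> G1 y = F1 y) ->
    forall y, y != 0 -> {for y, continuous G1}.
  move=> eF GF y y0; apply: (eq_continuous_off0 GF y0).
  exact: elementary_continuous.
elim: k F G => [|k IH] F G eF GF /=; split => //; try exact: (cGF F G).
move=> i; have [F' eF' dF] := elementary_partial i eF.
have dG y : y != 0 -> is_derive y 'e_i G (F' y).
  move=> y0; apply: near_eq_is_derive (dF y y0); near=> z.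
  by apply/esym/GF; near: z; exact: near_neq0.
split=> [y y0|]; first by have [] := dG y y0.
by apply: (IH F') => // y y0; have [_] := dG y y0.
Unshelve. all: by end_near.
Qed.

Lemma elementary_dotp x : elementary (dotp x).
Proof.
rewrite /dotp; elim: (index_enum _) => [|i r IH].
  rewrite (_ : (fun y => _) = fun=> 0); first exact: elem_cst.
  by apply/funext => y; rewrite big_nil.
rewrite (_ : (fun y => _) = fun y => x 0 i * y 0 i + \sum_(j <- r) x 0 j * y 0 j).
  by apply: elem_add => //; apply: elem_mul; [exact: elem_cst|exact: elem_coord].
by apply/funext => y; rewrite big_cons.
Qed.

Lemma elementary_horner (p : {poly R}) F : elementary F -> elementary (fun y => p.[F y]).
Proof.
move=> eF; elim/poly_ind: p => [|p c IH].
  rewrite (_ : (fun y => _) = fun=> 0); first exact: elem_cst.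
  by apply/funext => y; rewrite horner0.
rewrite (_ : (fun y => _) = fun y => p.[F y] * F y + c).
  by apply: elem_add; [exact: elem_mul|exact: elem_cst].
by apply/funext => y; rewrite hornerMXaddC.
Qed.

Lemma homext_zonal (p : {poly R}) x :
  homext (fun y => p.[dotp x y]) = (fun y => p.[(enorm y)^-1 * dotp x y]).
Proof. by apply/funext => y; rewrite /homext /= /normalize dotpZr. Qed.

Lemma zonal_smooth (p : {poly R}) x : smooth_on_sphere (fun y => p.[dotp x y]).
Proof.
move=> k; rewrite homext_zonal.
apply: (@elementary_Ck k (fun y => p.[(enorm y)^-1 * dotp x y])) => //.
apply: elementary_horner; apply: elem_mul; first exact: elem_invnorm.
exact: elementary_dotp.
Qed.

Lemma drv_horner (p : {poly R}) F y v (dF : R) : is_derive y v F dF ->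
  is_derive y v (fun z => p.[F z]) (p^`().[F y] * dF).
Proof. by move=> hF; apply: drv_comp => //; exact: is_derive_poly. Qed.

(** The zonal part of the Laplacian, computed from the extension
    p(x.y/|y|) by differentiating twice in each coordinate. *)
Lemma laplace_beltrami_zonal (p : {poly R}) x y : sphere x -> sphere y ->
  let t := dotp x y in
  laplace_beltrami (fun z => p.[dotp x z]) y =
  (1 - t ^+ 2) * p^`()^`().[t] - (n%:R - 1) * t * p^`().[t].
Proof.
move=> /sphere_dotp x1 sy t; have y0 := sphere_neq0 sy.
rewrite /laplace_beltrami homext_zonal.
pose u (z : 'rV[R]_n) := (enorm z)^-1 * dotp x z.
pose uj (j : 'I_n) (z : 'rV[R]_n) := (- (enorm z)^-1 ^+ 3 * z 0 j) * dotp x z + (enorm z)^-1 * x 0 j.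
have du j z : z != 0 -> is_derive z 'e_j u (uj j z).
  by move=> z0; exact: drvM (is_derive_invnorm j z0) (is_derive_dotp x z j).
have duj j : is_derive y 'e_j (uj j)
    ((3 * y 0 j ^+ 2 - 1) * t - 2 * x 0 j * y 0 j).
  have E := is_derive_invnorm j y0.
  have -> : uj j = fun z => (-1 * ((enorm z)^-1 * ((enorm z)^-1 * (enorm z)^-1)) * z 0 j) * dotp x z + (enorm z)^-1 * x 0 j.
    by apply/funext => z; rewrite /uj; congr (_ * _ + _); ring.
  apply: (drv_eq (drvD (drvM (drvM (drvMc (-1) (drvM E (drvM E E)))
    (is_derive_delta_coord y j j)) (is_derive_dotp x y j)) (drvM E (drv_cst y 'e_j (x 0 j))))).
  have -> : enorm y = 1 by exact: sy.
  by rewrite eqxx -/t !invr1 !mulr1n; ring.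
have uy : u y = t by rewrite /u (_ : enorm y = 1) ?invr1 ?mul1r//; exact: sy.
have dF j z : z != 0 -> is_derive z 'e_j (fun z => p.[u z]) (p^`().[u z] * uj j z).
  by move=> z0; apply: drv_horner; exact: du.
have ddF j : is_derive y 'e_j (partial j (fun z => p.[u z]))
   (p^`()^`().[t] * uj j y ^+ 2 + p^`().[t] * ((3 * y 0 j ^+ 2 - 1) * t - 2 * x 0 j * y 0 j)).
  apply: (@near_eq_is_derive _ _ _ (fun z => p^`().[u z] * uj j z)).
    near=> z; have z0 : z != 0 by near: z; exact: near_neq0.
    by have [_ <-] := dF j z z0.
  apply: (drv_eq (drvM (drv_horner p^`() (du j y y0)) (duj j))).
  by rewrite uy; ring.
rewrite /laplacian (eq_bigr (fun j => p^`()^`().[t] * uj j y ^+ 2 +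
  p^`().[t] * ((3 * y 0 j ^+ 2 - 1) * t - 2 * x 0 j * y 0 j))); last first.
  by move=> j _; have [_ <-] := ddF j.
have ujy j : uj j y = x 0 j - y 0 j * t.
  by rewrite /uj (_ : enorm y = 1)// -/t; field.
rewrite (eq_bigr (fun j => p^`()^`().[t] * (x 0 j * x 0 j) - (2 * t * p^`()^`().[t] + 2 * p^`().[t]) * (x 0 j * y 0 j)
   + (p^`()^`().[t] * t ^+ 2 + 3 * p^`().[t] * t) * (y 0 j * y 0 j) - p^`().[t] * t)); last first.
  by move=> j _; rewrite ujy; ring.
rewrite sumrB big_split /= sumrB -!mulr_sumr sumr_const card_ord -mulr_natr.
have /sphere_dotp y1 := sy.
rewrite -/(dotp x x) -/(dotp x y) -/(dotp y y) x1 y1 -/t; ring.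
Unshelve. all: by end_near.
Qed.

End elementary.

Lemma gegen_spherical_harmonic {R : realType} (M k : nat) (x : 'rV[R]_M.+2) : sphere x ->
  spherical_harmonics (N := M.+1) k (fun y => (gegen M k).[dotp x y]).
Proof.
move=> sx; split; first exact: zonal_smooth.
move=> y sy; rewrite laplace_beltrami_zonal//; set t := dotp x y.
have := congr1 (horner^~ t) (@gegen_ode R M k).
rewrite !(hornerM, hornerD, hornerN, hornerX, horner0, hornerXn) -!(polyC_natr R) !hornerC.
rewrite /LB_eigenvalue => E.
apply/eqP; rewrite -subr_eq0 -oppr_eq0 -E; apply/eqP.
by rewrite natrM natrD -!natr1; ring.
Qed.

(** * The zonal harmonic is a multiple of a Gegenbauer polynomial *)

(** The coefficient of r^k in (1 - r)^-(M+1). *)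
Definition simplex_num (M k : nat) : nat := 'C(k + M, k).

(** The coefficient of r^k in (1 + r)/(1 - r)^(M+1), which is the dimension of
    the space of harmonics of degree k. *)
Definition harm_dim (M k : nat) : nat :=
  simplex_num M k + (if k is k'.+1 then simplex_num M k' else 0).

Lemma simplex_numS M k : (k.+1 * simplex_num M k.+1 = (k + M + 1) * simplex_num M k)%N.
Proof. by rewrite /simplex_num -mul_bin_diag addSn addn1. Qed.

Lemma simplex_num_gt0 M k : (0 < simplex_num M k)%N.
Proof. by rewrite /simplex_num bin_gt0 leq_addr. Qed.

Lemma harm_dimS M k : (k.+1 * harm_dim M k.+1 = (2 * k + M + 2) * simplex_num M k)%N.
Proof. by rewrite /harm_dim mulnDr simplex_numS; nia. Qed.

Lemma harm_dim_gt0 M k : (0 < harm_dim M k)%N.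
Proof. by rewrite /harm_dim addn_gt0 simplex_num_gt0. Qed.

Section reproducing.
Context {R : realType} (M : nat).
Implicit Types (x y : 'rV[R]_M.+2) (f : 'rV[R]_M.+2 -> R).
Local Notation P k := (gegen M k).
Let G x k y : R := (P k).[dotp x y].
Local Notation I := (@ball_integral R M.+2).

Lemma LB_eigenvalue_inj k l : @LB_eigenvalue R M.+1 k = @LB_eigenvalue R M.+1 l -> k = l.
Proof.
rewrite /LB_eigenvalue => /eqP; rewrite -subr_eq0.
have -> : k%:R * (k%:R + M.+1%:R - 1) - l%:R * (l%:R + M.+1%:R - 1) =
  (k%:R - l%:R) * (k + l + M)%:R :> R by rewrite !natrD -natr1; ring.
rewrite mulf_eq0 subr_eq0 eqr_nat => /orP[/eqP //|].
by rewrite pnatr_eq0 !addn_eq0 => /andP[/andP[/eqP -> /eqP ->]].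
Qed.

Lemma zonal_continuous (p : {poly R}) x : continuous_off0 (homext (fun y => p.[dotp x y])).
Proof. by apply/C2off0_continuous/smooth_C2off0/zonal_smooth. Qed.

Lemma harmonic_continuous k f : spherical_harmonics (N := M.+1) k f ->
  continuous_off0 (homext f).
Proof. by move=> [sf _]; exact/C2off0_continuous/smooth_C2off0. Qed.

Lemma harmonic_orthogonal k l f g : spherical_harmonics (N := M.+1) k f ->
  spherical_harmonics (N := M.+1) l g -> k != l -> I (fun y => f y * g y) = 0.
Proof.
move=> [sf ef] [sg eg] kl; apply: (eigen_orthogonal _ _ ef eg); try exact: smooth_C2off0.
by apply: contra_neq kl => /LB_eigenvalue_inj.
Qed.

Lemma zonal_rec x k y : (k + M + 1)%:R * G x k.+2 y =
  (2 * k + M + 2)%:R * dotp x y * G x k.+1 y - k.+1%:R * G x k y.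
Proof. exact: gegen_recE. Qed.

Lemma zonal0 x y : G x 0 y = 1.
Proof. by rewrite /G /= -[1 : {poly R}]/(1%:P) hornerC. Qed.

Lemma zonal1 x y : G x 1 y = dotp x y.
Proof. by rewrite /G /= hornerX. Qed.

Let cG x k : continuous_off0 (homext (G x k)). Proof. exact: zonal_continuous. Qed.

Lemma dotp_zonal x k y : dotp x y * G x k.+1 y =
  (k + M + 1)%:R / (2 * k + M + 2)%:R * G x k.+2 y + k.+1%:R / (2 * k + M + 2)%:R * G x k y.
Proof.
have h : (2 * k + M + 2)%:R != 0 :> R by rewrite pnatr_eq0 addn2.
apply: (mulfI h); have := zonal_rec x k y; move/eqP; rewrite eq_sym subr_eq => /eqP.
by rewrite mulrA => ->; field.
Qed.

(** Multiplication by x.y acts on the Gegenbauer polynomials through the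
    three-term recurrence, so orthogonality to all of them propagates to the
    weights (1 + x.y)^m. *)
Lemma zonal_moments_gegen x f : continuous_off0 (homext f) ->
  (forall l, I (fun y => G x l y * f y) = 0) ->
  forall m l, I (fun y => (1 + dotp x y) ^+ m * (G x l y * f y)) = 0.
Proof.
move=> cf H; have cm m l : continuous_off0 (homext (fun y => (1 + dotp x y) ^+ m * (G x l y * f y))).
  apply: continuous_homextM; last exact: continuous_homextM.
  exact: (@continuous_homext_comp R M.+2 (fun t => (1 + t) ^+ m) x (@continuous_pow1 R m)).
elim=> [|m IH] l.
  by rewrite -[RHS](H l); apply: eq_ball_integral => y _; rewrite expr0 mul1r.
case: l => [|l].
  have := IH 0%N; have := IH 1%N => e1 e0.
  transitivity (I (fun y => (1 + dotp x y) ^+ m * (G x 0 y * f y) + (1 + dotp x y) ^+ m * (G x 1 y * f y))).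
    by apply: eq_ball_integral => y _; rewrite zonal0 zonal1 exprS; ring.
  by rewrite ball_integralD// e0 e1 addr0.
set a : R := (l + M + 1)%:R / (2 * l + M + 2)%:R.
set b : R := l.+1%:R / (2 * l + M + 2)%:R.
transitivity (I (fun y => (1 + dotp x y) ^+ m * (G x l.+1 y * f y) +
   (a * ((1 + dotp x y) ^+ m * (G x l.+2 y * f y)) + b * ((1 + dotp x y) ^+ m * (G x l y * f y))))).
  apply: eq_ball_integral => y _.
  transitivity ((1 + dotp x y) ^+ m * (G x l.+1 y * f y)
      + (1 + dotp x y) ^+ m * ((dotp x y * G x l.+1 y) * f y)).
    by rewrite exprS; ring.
  by rewrite dotp_zonal -/a -/b; ring.
rewrite !ball_integralD ?ball_integralZ ?IH ?mulr0 ?addr0//; try exact: continuous_homextZ.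
by apply: continuous_homextD; exact: continuous_homextZ.
Qed.

Let h x k := I (fun y => G x k y * G x k y).

(** The function h f - T G(x,.), with T the pairing of f with G(x,.), is
    orthogonal to every G(x,l): for l = k by the choice of T, for the others
    by orthogonality of eigenspaces. Hence it vanishes at x. *)
Lemma harmonic_value k f x : sphere x -> spherical_harmonics (N := M.+1) k f ->
  h x k * f x = I (fun y => G x k y * f y).
Proof.
move=> sx Hf; have cf := harmonic_continuous Hf; set T := I _.
have HG l : spherical_harmonics (N := M.+1) l (G x l) by exact: gegen_spherical_harmonic.
pose F y := h x k * f y + (- T) * G x k y.
have cF : continuous_off0 (homext F) by apply: continuous_homextD; exact: continuous_homextZ.
have F0 : F x = 0.
  apply: (zonal_moments_eq0 cF sx) => m.
  have := zonal_moments_gegen (x := x) cF _ m 0.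
  rewrite (eq_ball_integral (g := fun y => (1 + dotp x y) ^+ m * F y)); last first.
    by move=> y _; rewrite zonal0 mul1r.
  apply => l.
  transitivity (I (fun y => h x k * (G x l y * f y) + (- T) * (G x l y * G x k y))).
    by apply: eq_ball_integral => y _; rewrite /F; ring.
  rewrite ball_integralD; try by apply: continuous_homextZ; exact: continuous_homextM.
  rewrite !ball_integralZ; try exact: continuous_homextM.
  have [->|lk] := eqVneq l k; first by rewrite -/T -/(h x k); ring.
  by rewrite (harmonic_orthogonal (HG l) Hf lk) (harmonic_orthogonal (HG l) (HG k) lk) !mulr0 addr0.
move: F0; rewrite /F /G (sphere_dotp x).1// gegen1 mulr1 => /eqP.
by rewrite subr_eq0 => /eqP.
Qed.

(** Pair x.y G(k+1) with G(k+2) and expand x.y times either factor by the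
    recurrence. *)
Lemma zonal_norm_rec x k : sphere x ->
  (2 * k + M + 4)%:R * (k + M + 1)%:R * h x k.+2 = (2 * k + M + 2)%:R * k.+2%:R * h x k.+1.
Proof.
move=> sx.
have HG l : spherical_harmonics (N := M.+1) l (G x l) by exact: gegen_spherical_harmonic.
have cGG a b : continuous_off0 (homext (fun y => G x a y * G x b y)) by exact: continuous_homextM.
pose J := I (fun y => dotp x y * G x k.+1 y * G x k.+2 y).
have cd := @continuous_normalize_dotp R M.+2 x.
have J1 : (2 * k + M + 2)%:R * J = (k + M + 1)%:R * h x k.+2.
  have c1 : continuous_off0 (homext (fun y => dotp x y * G x k.+1 y * G x k.+2 y)).
    by apply: continuous_homextM => //; exact: continuous_homextM.
  rewrite /J -ball_integralZ// /h -ball_integralZ//.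
  transitivity (I (fun y => (k + M + 1)%:R * (G x k.+2 y * G x k.+2 y) + k.+1%:R * (G x k y * G x k.+2 y))).
    apply: eq_ball_integral => y _; rewrite !mulrA; have := zonal_rec x k y => /eqP.
    by rewrite eq_sym subr_eq => /eqP ->; ring.
  rewrite ball_integralD; try exact: continuous_homextZ.
  rewrite [X in _ + X]ball_integralZ// (harmonic_orthogonal (HG k) (HG k.+2)) ?mulr0 ?addr0//.
  by apply/eqP; lia.
have J2 : (2 * k + M + 4)%:R * J = k.+2%:R * h x k.+1.
  have c1 : continuous_off0 (homext (fun y => dotp x y * G x k.+1 y * G x k.+2 y)).
    by apply: continuous_homextM => //; exact: continuous_homextM.
  rewrite /J -ball_integralZ// /h -ball_integralZ//.
  transitivity (I (fun y => (k.+1 + M + 1)%:R * (G x k.+3 y * G x k.+1 y) + k.+2%:R * (G x k.+1 y * G x k.+1 y))).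
    apply: eq_ball_integral => y _; have := zonal_rec x k.+1 y => /eqP.
    rewrite eq_sym subr_eq => /eqP E.
    transitivity (((2 * k.+1 + M + 2)%:R * dotp x y * G x k.+2 y) * G x k.+1 y).
      have -> : (2 * k.+1 + M + 2 = 2 * k + M + 4)%N by lia.
      ring.
    by rewrite E; ring.
  rewrite ball_integralD; try exact: continuous_homextZ.
  rewrite [X in X + _]ball_integralZ// (harmonic_orthogonal (HG k.+3) (HG k.+1)) ?mulr0 ?add0r//.
  by apply/eqP; lia.
rewrite -!mulrA -J1 -J2; ring.
Qed.

Lemma zonal_norm1 x : sphere x -> (M + 2)%:R * h x 1 = h x 0.
Proof.
move=> sx.
have HG l : spherical_harmonics (N := M.+1) l (G x l) by exact: gegen_spherical_harmonic.
have cGG a b : continuous_off0 (homext (fun y => G x a y * G x b y)) by exact: continuous_homextM.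
rewrite /h -ball_integralZ//.
transitivity (I (fun y => (0 + M + 1)%:R * (G x 2 y * G x 0 y) + G x 0 y * G x 0 y)).
  apply: eq_ball_integral => y _; have := zonal_rec x 0 y => /eqP.
  rewrite eq_sym subr_eq !zonal0 zonal1 => /eqP E.
  transitivity ((2 * 0 + M + 2)%:R * dotp x y * dotp x y); first by rewrite muln0 add0n; ring.
  by rewrite E; ring.
rewrite ball_integralD//; last exact: continuous_homextZ.
by rewrite ball_integralZ// (harmonic_orthogonal (HG 2%N) (HG 0%N)) ?mulr0 ?add0r.
Qed.

Definition ball_volume : R := I (fun=> 1).

Lemma ball_volume_gt0 x : sphere x -> 0 < ball_volume.
Proof.
move=> sx; apply: (@ball_integral_gt0 _ _ (fun=> 1) x) => //.
exact: continuous_homext_cst.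
Qed.

Lemma zonal_norm_dim x k : sphere x -> (harm_dim M k)%:R * h x k = ball_volume.
Proof.
move=> sx.
have e0 : h x 0 = ball_volume by apply: eq_ball_integral => y _; rewrite !zonal0 mulr1.
case: k => [|k].
  by rewrite e0 /harm_dim /simplex_num bin0 addn0 mul1r.
elim: k => [|k IH].
  by rewrite -e0 -(zonal_norm1 sx) /harm_dim /simplex_num bin0 bin1; congr (_%:R * _); lia.
rewrite -IH; have := zonal_norm_rec k sx => E.
have p1 : (k + M + 1)%:R != 0 :> R by rewrite addn1 pnatr_eq0.
have p2 : (2 * k + M + 4)%:R != 0 :> R by rewrite pnatr_eq0; lia.
have p3 : (k.+2)%:R != 0 :> R by rewrite pnatr_eq0.
have p4 : (k.+1)%:R != 0 :> R by rewrite pnatr_eq0.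
have d1 : k.+1%:R * (harm_dim M k.+1)%:R = (2 * k + M + 2)%:R * (simplex_num M k)%:R :> R.
  by rewrite -!natrM harm_dimS.
have d2 : k.+2%:R * (harm_dim M k.+2)%:R = (2 * k + M + 4)%:R * (simplex_num M k.+1)%:R :> R.
  by rewrite -!natrM harm_dimS; congr (_ * _)%:R; lia.
have d3 : k.+1%:R * (simplex_num M k.+1)%:R = (k + M + 1)%:R * (simplex_num M k)%:R :> R.
  by rewrite -!natrM simplex_numS.
apply: (mulfI p4); apply: (mulfI p3).
transitivity ((k.+1%:R * (simplex_num M k.+1)%:R) * (2 * k + M + 4)%:R * h x k.+2).
  transitivity (k.+1%:R * (k.+2%:R * (harm_dim M k.+2)%:R) * h x k.+2); first by ring.
  by rewrite d2; ring.
rewrite d3.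
transitivity ((simplex_num M k)%:R * ((2 * k + M + 4)%:R * (k + M + 1)%:R * h x k.+2)); first by ring.
rewrite E.
transitivity (k.+2%:R * (k.+1%:R * (harm_dim M k.+1)%:R) * h x k.+1); last by ring.
by rewrite d1; ring.
Qed.

Lemma reproducing k f x : sphere x -> spherical_harmonics (N := M.+1) k f ->
  ball_volume * f x = (harm_dim M k)%:R * I (fun y => G x k y * f y).
Proof. by move=> sx Hf; rewrite -(harmonic_value sx Hf) mulrA zonal_norm_dim. Qed.

(** By the reproducing property the value at x.y is an inner product of two
    functions of equal norm, so this is the Cauchy-Schwarz inequality. *)
Lemma gegen_le1 k x y : sphere x -> sphere y -> `|(P k).[dotp x y]| <= 1.
Proof.
move=> sx sy.
have HG z : sphere z -> spherical_harmonics (N := M.+1) k (G z k) by exact: gegen_spherical_harmonic.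
have V0 := ball_volume_gt0 sx.
have d0 : 0 < (harm_dim M k)%:R :> R by rewrite ltr0n harm_dim_gt0.
have cGG z : continuous_off0 (homext (fun w => 2^-1 * (G z k w * G z k w))).
  by apply: continuous_homextZ; exact: continuous_homextM.
have E : ball_volume * G y k x = (harm_dim M k)%:R * I (fun z => G x k z * G y k z).
  exact: reproducing (HG y sy).
(* The signs s = 1 and s = -1 give the two bounds. *)
have bound (s : R) : s ^+ 2 = 1 -> s * G y k x <= 1.
  move=> s1; rewrite -(ler_pM2l V0) mulr1 mulrCA E mulrCA.
  rewrite -[leRHS](zonal_norm_dim k sx) ler_pM2l//.
  have -> : h x k = I (fun z => 2^-1 * (G x k z * G x k z) + 2^-1 * (G y k z * G y k z)).
    rewrite ball_integralD// !ball_integralZ; try exact: continuous_homextM.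
    have -> : I (fun z => G y k z * G y k z) = h x k.
      by apply: (mulfI (lt0r_neq0 d0)); rewrite (zonal_norm_dim k sx) (zonal_norm_dim k sy).
    by rewrite -/(h x k); field.
  rewrite -ball_integralZ; last exact: continuous_homextM.
  apply: le_ball_integral.
  - by apply: continuous_homextZ; exact: continuous_homextM.
  - exact: continuous_homextD.
  - move=> z _; have := sqr_ge0 (G x k z - s * G y k z).
    have -> : (G x k z - s * G y k z) ^+ 2 = G x k z ^+ 2 - 2 * (s * (G x k z * G y k z)) + s ^+ 2 * G y k z ^+ 2 by ring.
    rewrite s1; lra.
rewrite ler_norml dotpC -/(G y k x); have := bound 1; have := bound (-1).
rewrite sqrrN !expr1n => /(_ erefl) + /(_ erefl); lra.
Qed.

(** Expand the zonal polynomial with pole x in the basis; by the reproducing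
    property its coefficients are multiples of the values of the basis at x. *)
Lemma zonal_harmonicE (a : nat -> nat) (Y : forall k, 'I_(a k) -> 'rV[R]_M.+2 -> R) k x y :
  orthonormal_basis (spherical_harmonics (N := M.+1) k) (Y k) -> sphere x -> sphere y ->
  zonal_harmonic Y k x y =
  (harm_dim M k)%:R / (M.+2%:R * ball_volume) * (P k).[dotp x y].
Proof.
move=> [HY oY sY] sx sy.
have V0 := ball_volume_gt0 sx.
have d0 : 0 < (harm_dim M k)%:R :> R by rewrite ltr0n harm_dim_gt0.
have cY j := harmonic_continuous (HY j).
have [c Hc] := sY (G x k) (gegen_spherical_harmonic k sx).
have cE i : c i = M.+2%:R * I (fun z => G x k z * Y k i z).
  have H (r : seq 'I_(a k)) : continuous_off0 (homext (fun z => \sum_(j <- r) c j * (Y k j z * Y k i z))) /\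
     I (fun z => \sum_(j <- r) c j * (Y k j z * Y k i z)) = \sum_(j <- r) c j * I (fun z => Y k j z * Y k i z).
    elim: r => [|j r [IH1 IH2]].
      rewrite big_nil (_ : (fun z => _) = fun=> 0); last by apply/funext => z; rewrite big_nil.
      split; first exact: continuous_homext_cst.
      transitivity (I (fun=> 0 * 1)); first by apply: eq_ball_integral => z _; rewrite mul0r.
      by rewrite (@ball_integralZ _ _ 0 (fun=> 1)) ?mul0r//; exact: continuous_homext_cst.
    rewrite big_cons (_ : (fun z => _) = fun z => c j * (Y k j z * Y k i z) + \sum_(j <- r) c j * (Y k j z * Y k i z)); last first.
      by apply/funext => z; rewrite big_cons.
    have c1 : continuous_off0 (homext (fun z => Y k j z * Y k i z)) by exact: continuous_homextM.
    have c2 := continuous_homextZ (c := c j) c1.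
    split; first exact: continuous_homextD.
    by rewrite ball_integralD// ball_integralZ// IH2.
  transitivity (M.+2%:R * I (fun z => \sum_j c j * (Y k j z * Y k i z))); last first.
    congr (_ * _); apply: eq_ball_integral => z sz; rewrite [G x k z]Hc// mulr_suml.
    by apply: eq_bigr => j _; rewrite mulrA.
  rewrite (H _).2 mulr_sumr (eq_bigr (fun j => c j * (j == i)%:R)); first by rewrite sum_delta.
  by move=> j _; rewrite mulrCA -L2dot_ball// oY.
have cE2 i : c i = M.+2%:R * ball_volume / (harm_dim M k)%:R * Y k i x.
  rewrite cE; apply: (mulfI (lt0r_neq0 d0)).
  rewrite mulrCA -(reproducing sx (HY i)); field.
  exact: lt0r_neq0.
rewrite [(P k).[_]]Hc// /zonal_harmonic mulr_sumr; apply: eq_bigr => i _.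
rewrite cE2; field; rewrite (lt0r_neq0 V0) (lt0r_neq0 d0) /=.
by rewrite -natrD pnatr_eq0.
Qed.

End reproducing.

Arguments gegen : simpl never.
Arguments harm_dim : simpl never.
Arguments simplex_num : simpl never.

Ltac nonzero := repeat (apply/andP; split); apply: lt0r_neq0; lra.

(** * Summation by parts against zonal harmonics *)

Section difference_operator.
Context {R : realType} (M : nat).
Implicit Types m : nat -> R.

(** The difference operator on multipliers which corresponds to multiplying a
    zonal expansion by 1 - t. *)
Definition zonal_diff m k : R :=
  if k is k'.+1 then
    ((k + M)%:R * (m k - m k.+1) + k%:R * (m k - m k')) / (2 * k + M)%:R
  else m 0%N - m 1%N.

(** Newton's divided differences at the nodes k(k+M): the denominator at
    step j is the difference of the nodes of index k+j and k. *)
Fixpoint divdiff (j : nat) m (k : nat) : R :=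
  if j is j'.+1 then
    (divdiff j' m k.+1 - divdiff j' m k) / (j * (2 * k + j + M))%:R
  else m k.

Lemma divdiffS j m k : divdiff j.+1 m k =
  (divdiff j m k.+1 - divdiff j m k) / (j.+1 * (2 * k + j.+1 + M))%:R.
Proof. by []. Qed.

Lemma divdiff_step j m k : divdiff j m k.+1 =
  divdiff j m k + (j%:R + 1) * (2 * k%:R + j%:R + 1 + M%:R) * divdiff j.+1 m k.
Proof.
rewrite divdiffS !(natrM, natrD) -!natr1; field.
have hk := ler0n R k; have hj := ler0n R j; have hM := ler0n R M; nonzero.
Qed.

(** In terms of the eigenvalue variable the operator is a second-order
    differential operator with a degenerate leading coefficient k(2k+M-1), of
    size k^2; this is what makes i applications gain i derivatives while losing
    at most a factor k^2 for each further one. *)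
Lemma divdiff_zonal_diff j m k : divdiff j (zonal_diff m) k =
  - ((j%:R + 1) * ((j%:R + 2) * k%:R * (2 * k%:R + M%:R - 1) * divdiff j.+2 m k.-1
     + (2 * j%:R + M%:R + 1) * divdiff j.+1 m k)).
Proof.
elim: j k => [|j IH] k.
  have step0 i : m i.+1 = m i + (2 * i%:R + 1 + M%:R) * divdiff 1 m i.
    by have := divdiff_step 0 m i; rewrite add0r mul1r addr0.
  case: k => [|k]; rewrite [LHS]/(zonal_diff _ _) /zonal_diff.
    by rewrite step0; ring.
  have E2 := divdiff_step 1 m k.
  have hk := ler0n R k; have hM := ler0n R M.
  rewrite succnK (step0 k.+1) (step0 k) E2 !natrD !natrM -natr1.
  field; nonzero.
rewrite divdiffS !IH; have E1 := divdiff_step j.+1 m k.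
rewrite [k.+1.-1]/= E1 !natrM !natrD -!natr1.
case: k E1 => [|k] E1.
  rewrite !mulr0n; have hj := ler0n R j; have hM := ler0n R M.
  field; nonzero.
have E2 := divdiff_step j.+2 m k; rewrite [k.+1.-1]/= E2 -!natr1.
have hk := ler0n R k; have hj := ler0n R j; have hM := ler0n R M.
field; nonzero.
Qed.

(** Since k^2 <= T, each extra divided difference l is paid for by T^l. *)
Lemma divdiff_iter_bound i j : exists2 C : R, 0 <= C &
  forall m k (T B : R), (k%:R + 1) ^+ 2 <= T ->
  (forall l k', (l <= i)%N -> (k - i <= k' <= k)%N -> T ^+ l * `|divdiff (j + i + l) m k'| <= B) ->
  `|divdiff j (iter i zonal_diff m) k| <= C * B.
Proof.
elim: i j => [|i IH] j.
  exists 1 => // m k T B _ H; have := H 0%N k (leqnn _).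
  by rewrite subn0 leqnn => /(_ erefl); rewrite !addn0 expr0 !mul1r.
have [C1 C10 H1] := IH j.+1; have [C2 C20 H2] := IH j.+2.
have hj := ler0n R j; have hM := ler0n R M.
exists ((j%:R + 1) * ((j%:R + 2) * (2 + M%:R) * C2 + (2 * j%:R + M%:R + 1) * C1)).
  by rewrite !(mulr_ge0, addr_ge0).
move=> m k T B kT H.
have hk := ler0n R k.
have T0 : 0 < T by apply: lt_le_trans kT; rewrite exprn_gt0//; lra.
rewrite iterS divdiff_zonal_diff normrN normrM (ger0_norm (x := j%:R + 1)); last by lra.
rewrite -[leRHS]mulrA; apply: ler_wpM2l; first by lra.
apply: le_trans (ler_normD _ _) _; rewrite [leRHS]mulrDl; apply: lerD; last first.
  rewrite normrM ger0_norm; last by lra.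
  rewrite -[leRHS]mulrA; apply: ler_wpM2l; first by lra.
  apply: (H1 _ _ T) => // l k' li kk.
  have := H l k'; rewrite addSnnS addnS -addSn; apply; lia.
case: k kT H hk => [|k] kT H hk.
  have B0 : 0 <= B.
    apply: le_trans (H 0%N 0%N (leq0n _) _) => //.
    by rewrite expr0 mul1r.
  by rewrite mulr0 !mul0r normr0 !mulr_ge0//; lra.
have kE : k.+1%:R = k%:R + 1 :> R by rewrite -natr1.
have hk' := ler0n R k.
have H2' : `|divdiff j.+2 (iter i zonal_diff m) k| <= C2 * (B / T).
  apply: (H2 _ _ T).
    apply: le_trans kT; rewrite kE; nra.
  move=> l k' li kk; rewrite ler_pdivlMr// mulrAC -exprSr.
  have := H l.+1 k'; rewrite (_ : (j + i.+1 + l.+1 = j.+2 + i + l)%N); last by lia.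
  apply; lia.
rewrite succnK normrM.
have -> : (j%:R + 2) * (2 + M%:R) * C2 * B = ((j%:R + 2) * ((2 + M%:R) * T)) * (C2 * (B / T)).
  by field; rewrite gt_eqF.
have c0 : 0 <= (j%:R + 2 : R) * k.+1%:R * (2 * k.+1%:R + M%:R - 1).
  by apply: mulr_ge0; first apply: mulr_ge0; rewrite ?kE; lra.
apply: ler_pM => //; rewrite ger0_norm//.
rewrite -[leLHS]mulrA; apply: ler_wpM2l; first by lra.
apply: (@le_trans _ _ ((2 + M%:R) * (k.+1%:R + 1) ^+ 2)); last by apply: ler_wpM2l => //; lra.
rewrite kE expr2; nra.
Qed.

Lemma zonal_diff_bound i m k (B : R) : (forall k', (k - i <= k' <= k + i)%N -> `|m k'| <= B) ->
  `|iter i zonal_diff m k| <= 2 ^+ i * B.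
Proof.
elim: i k => [|i IH] k H; first by rewrite mul1r; apply: H; lia.
have e k' : (k.-1 <= k' <= k.+1)%N -> `|iter i zonal_diff m k'| <= 2 ^+ i * B.
  by move=> kk; apply: IH => k'' kk'; apply: H; lia.
rewrite iterS exprS -mulrA; set g := iter i zonal_diff m in e *.
case: k H e => [|k] H e.
  rewrite /=; apply: le_trans (ler_normB _ _) _; rewrite mulrDl mul1r.
  by apply: lerD; apply: e.
have hM := ler0n R M; have hk := ler0n R k.
have p : 0 < (2 * k.+1 + M)%:R :> R by rewrite ltr0n.
rewrite /= normrM normfV (ger0_norm (ltW p)) ler_pdivrMr//.
have e1 : `|g k.+1 - g k.+2| <= 2 * (2 ^+ i * B).
  apply: le_trans (ler_normB _ _) _; rewrite mulrDl mul1r.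
  by apply: lerD; apply: e; lia.
have e2 : `|g k.+1 - g k| <= 2 * (2 ^+ i * B).
  apply: le_trans (ler_normB _ _) _; rewrite mulrDl mul1r.
  by apply: lerD; apply: e; lia.
have -> : (2 * k.+1 + M)%:R = (k.+1 + M)%:R + k.+1%:R :> R by rewrite -natrD; congr _%:R; lia.
rewrite [leRHS]mulrDr; apply: le_trans (ler_normD _ _) _; rewrite !normrM !normr_nat.
by apply: lerD; rewrite [leLHS]mulrC; apply: ler_wpM2r.
Qed.

Lemma zonal_diff_supp i m K : (forall k, (K <= k)%N -> m k = 0) ->
  forall k, (K + i <= k)%N -> iter i zonal_diff m k = 0.
Proof.
move=> mK; elim: i => [|i IH] k Kk; first by apply: mK; lia.
case: k Kk => [|k] Kk; first by lia.
by rewrite iterS /zonal_diff !IH; try lia; rewrite !subrr !mulr0 addr0 mul0r.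
Qed.

Local Notation A k := (simplex_num M k).
Local Notation d k := (harm_dim M k).
Local Notation P k := (gegen M k).

Lemma simplex_numSr k : k.+1%:R * (A k.+1)%:R = (k%:R + M%:R + 1) * (A k)%:R :> R.
Proof. by rewrite -natrM simplex_numS natrM !natrD. Qed.

Lemma harm_dimSr k : (d k.+1)%:R = (A k.+1)%:R + (A k)%:R :> R.
Proof. by rewrite /harm_dim natrD. Qed.

Arguments zonal_diff : simpl never.

Lemma zonal_diff_dim m k : (d k.+1)%:R * zonal_diff m k.+1 =
  (A k.+1)%:R * (m k.+1 - m k.+2) + (A k)%:R * (m k.+1 - m k).
Proof.
have hM := ler0n R M; have hk := ler0n R k.
have e := simplex_numSr k.
have h : k.+1%:R != 0 :> R by rewrite pnatr_eq0.
have E : (A k.+1)%:R = (k%:R + M%:R + 1) * (A k)%:R / k.+1%:R :> R by rewrite -e [k.+1%:R * _]mulrC mulfK.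
rewrite harm_dimSr /zonal_diff E !natrD !natrM -!natr1; field; nonzero.
Qed.

Lemma gegen_dim k t : (A k.+1)%:R * (P k.+2).[t] =
  (d k.+1)%:R * t * (P k.+1).[t] - (A k)%:R * (P k).[t] :> R.
Proof.
have hM := ler0n R M; have hk := ler0n R k.
have e := simplex_numSr k.
have h : k.+1%:R != 0 :> R by rewrite pnatr_eq0.
have E : (A k.+1)%:R = (k%:R + M%:R + 1) * (A k)%:R / k.+1%:R :> R by rewrite -e [k.+1%:R * _]mulrC mulfK.
have := @gegen_recE R M k t => E2.
rewrite harm_dimSr E.
transitivity ((A k)%:R / k.+1%:R * ((k + M + 1)%:R * (P k.+2).[t])); first by rewrite !natrD; ring.
rewrite E2 !(natrM, natrD) -!natr1; field; nonzero.
Qed.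

(** Abel summation. The three-term recurrence makes the sum telescope, up to a
    boundary term involving m only at n and n+1. *)
Lemma zonal_sum_by_parts m t n :
  (1 - t) * (\sum_(k < n.+1) m k * (d k)%:R * (P k).[t]) -
  \sum_(k < n.+1) zonal_diff m k * (d k)%:R * (P k).[t] =
  (A n)%:R * (m n.+1 * (P n).[t] - m n * (P n.+1).[t]).
Proof.
elim: n => [|n IH].
  rewrite !big_ord1 /= /harm_dim /simplex_num bin0 addn0 !mulr1.
  have -> : (P 0).[t] = 1 by rewrite /gegen -[1 : {poly R}]/(1%:P) hornerC.
  have -> : (P 1).[t] = t by rewrite /gegen hornerX.
  rewrite /zonal_diff; ring.
rewrite !(big_ord_recr n.+1) /= mulrDr opprD addrACA IH.
have E1 := zonal_diff_dim m n; have E2 := gegen_dim n t; have E3 := harm_dimSr n.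
transitivity ((A n)%:R * (m n.+1 * (P n).[t] - m n * (P n.+1).[t])
  + ((1 - t) * (m n.+1 * (d n.+1)%:R * (P n.+1).[t])
     - ((d n.+1)%:R * zonal_diff m n.+1) * (P n.+1).[t])); first by ring.
transitivity ((A n.+1)%:R * m n.+2 * (P n.+1).[t] - m n.+1 * ((A n.+1)%:R * (P n.+2).[t])).
  by rewrite E1 E2 E3; ring.
by ring.
Qed.

(** The length n of the sum exceeds the support by i so that all boundary terms
    vanish. *)
Lemma zonal_sum_iter m t i K n : (forall k, (K <= k)%N -> m k = 0) -> (K + i <= n)%N ->
  (1 - t) ^+ i * (\sum_(k < n.+1) m k * (d k)%:R * (P k).[t]) =
  \sum_(k < n.+1) iter i zonal_diff m k * (d k)%:R * (P k).[t].
Proof.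
move=> mK; elim: i => [|i IH] Kn; first by rewrite mul1r.
rewrite exprS -mulrA IH; last by lia.
have := zonal_sum_by_parts (iter i zonal_diff m) t n.
rewrite !(zonal_diff_supp mK); try by lia.
by rewrite !mul0r subrr mulr0 => /eqP; rewrite subr_eq0 => /eqP.
Qed.

End difference_operator.

(** * Divided differences at the eigenvalues *)

Section divided_differences.
Context {R : realType}.

(** Here D i stands for the i-th derivative of D 0. *)
Lemma iterated_rolle j (D : nat -> R -> R) (x : nat -> R) :
  (forall i, (i < j)%N -> x i < x i.+1) ->
  (forall i t, (i < j)%N -> x 0%N <= t <= x j -> is_derive t (1 : R) (D i) (D i.+1 t)) ->
  (forall i, (i <= j)%N -> D 0%N (x i) = 0) ->
  exists2 xi, x 0%N <= xi <= x j & D j xi = 0.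
Proof.
elim: j D x => [|j IH] D x xx dD D0.
  by exists (x 0%N); rewrite ?lexx//; exact: D0.
have xle i i' : (i <= i')%N -> (i' <= j.+1)%N -> x i <= x i'.
  move=> + i'j; elim: i' i'j => [|i' IHi] i'j; first by rewrite leqn0 => /eqP ->.
  rewrite leq_eqVlt => /predU1P[-> //|]; rewrite ltnS => ii'.
  apply: le_trans (IHi _ ii') _; first by lia.
  by apply/ltW/xx.
have /choice[y Hy] : forall i, exists y, (i <= j)%N -> x i < y < x i.+1 /\ D 1%N y = 0.
  move=> i; have [ij|ij] := leqP i j; last by exists 0.
  have dr t : t \in `[x i, x i.+1] -> is_derive t (1 : R) (D 0%N) (D 1%N t).
    rewrite in_itv /= => /andP[t1 t2]; apply: dD => //.
    by rewrite (le_trans _ t1) ?xle//= ?(le_trans t2) ?xle//; lia.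
  have [||||y] := @Rolle R (D 0%N) (x i) (x i.+1).
  - exact: xx.
  - by move=> t tI; have [] := dr t (subset_itv_oo_cc tI).
  - by apply: derivable_within_continuous => t tI; have [] := dr t tI.
  - by rewrite !D0//; lia.
  - move=> yI [_ <-]; exists y => _; split; first by move: yI; rewrite in_itv.
    by have [_ ->] := dr y (subset_itv_oo_cc yI).
have [|||xi xiI Dxi] := IH (fun i => D i.+1) y.
- move=> i ij; have [/andP[_ a] _] := Hy i (ltnW ij); have [/andP[b _] _] := Hy i.+1 ij.
  exact: lt_trans a b.
- move=> i t ij /andP[h1 h2]; apply: dD; first by lia.
  have [/andP[a _] _] := Hy 0%N (leq0n _); have [/andP[_ b] _] := Hy j (leqnn _).
  by rewrite (le_trans (ltW a))//= (le_trans h2)// ltW.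
- by move=> i ij; exact: (Hy i ij).2.
- exists xi => //; move: xiI => /andP[h1 h2].
  have [/andP[a _] _] := Hy 0%N (leq0n _); have [/andP[_ b] _] := Hy j (leqnn _).
  by rewrite (le_trans (ltW a))//= (le_trans h2)// ltW.
Qed.

Variable M : nat.
Definition node (k : nat) : R := (k * (k + M))%:R.

Lemma node_lt k : node k < node k.+1.
Proof. by rewrite ltr_nat; nia. Qed.

Lemma node_diff k j : node (k + j) - node k = (j * (2 * k + j + M))%:R.
Proof.
apply/eqP; rewrite subr_eq -natrD; apply/eqP; congr _%:R; nia.
Qed.

(** Neville's scheme: combine the interpolants on the first and on the last
    nodes by an affine factor; the divided difference is the leading
    coefficient. *)
Lemma divdiff_interpolation (f : R -> R) j k : exists p : {poly R},
  [/\ (size p <= j.+1)%N, p`_j = divdiff M j (f \o node) k &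
      forall i, (i <= j)%N -> p.[node (k + i)] = f (node (k + i))].
Proof.
elim: j k => [|j IH] k.
  exists (f (node k))%:P; split=> //; first by rewrite size_polyC; case: eqP.
    by rewrite coefC.
  by move=> [|//] _; rewrite addn0 hornerC.
have [p1 [s1 c1 H1]] := IH k; have [p2 [s2 c2 H2]] := IH k.+1.
set w := (j.+1 * (2 * k + j.+1 + M))%:R : R.
have wE : node (k + j.+1) - node k = w by exact: node_diff.
have w0 : w != 0 by rewrite pnatr_eq0; lia.
exists (w^-1 *: (('X - (node k)%:P) * p2 - ('X - (node (k + j.+1))%:P) * p1)); split.
- apply: leq_trans (size_scale_leq _ _) _; apply: leq_trans (size_polyD _ _) _.
  rewrite size_polyN geq_max; apply/andP; split; apply: leq_trans (size_polyMleq _ _) _;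
    by rewrite size_XsubC.
- rewrite coefZ coefB !mulrBl !coefB !coefXM /= !coefCM c1 c2.
  rewrite [p2`_j.+1]nth_default// [p1`_j.+1]nth_default// !mulr0 !subr0.
  by rewrite mulrC.
- move=> i ij; rewrite hornerZ !hornerE.
  case: i ij => [|i] ij.
    rewrite addn0 subrr mul0r sub0r -mulNr opprB wE.
    by have := H1 0%N (leq0n _); rewrite addn0 => ->; rewrite mulrA mulVf// mul1r.
  have E2 : p2.[node (k + i.+1)] = f (node (k + i.+1)).
    by have := H2 i; rewrite addSnnS; apply.
  rewrite E2; have [ij'|ij'] := leqP i.+1 j.
    rewrite (H1 _ ij') -mulrBl opprB addrC addrA subrK wE.
    by rewrite mulrA mulVf// mul1r.
  have -> : i = j by lia.
  by rewrite subrr mul0r subr0 wE mulrA mulVf// mul1r.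
Qed.

(** Subtract the interpolating polynomial and apply Rolle's theorem j times. *)
Lemma divdiff_mean_value (D : nat -> R -> R) j k :
  (forall i t, (i < j)%N -> node k <= t <= node (k + j) ->
     is_derive t (1 : R) (D i) (D i.+1 t)) ->
  exists2 xi, node k <= xi <= node (k + j) &
    D j xi = divdiff M j (D 0%N \o node) k *+ j`!.
Proof.
move=> dD; have [p [sp cp pE]] := divdiff_interpolation (D 0%N) j k.
have [|||xi] := @iterated_rolle j (fun i t => D i t - p^`(i).[t]) (fun i => node (k + i)).
- by move=> i _; rewrite addnS; exact: node_lt.
- move=> i t ij; rewrite addn0 => tI; rewrite derivnS.
  by apply: drvB; exact: dD.
- by move=> i ij; rewrite derivn0 pE// subrr.
- rewrite addn0 => xiI /eqP; rewrite subr_eq0 => /eqP E; exists xi => //.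
  rewrite E.
  have s1 : (size p^`(j) <= 1)%N.
    apply/leq_sizeP => i i1; rewrite coef_derivn nth_default ?mul0rn//.
    by apply: leq_trans sp _; lia.
  by rewrite (size1_polyC s1) hornerC coef_derivn addn0 cp ffactnn.
Qed.

Lemma divdiff_le (D : nat -> R -> R) j k (B : R) :
  (forall i t, (i < j)%N -> node k <= t <= node (k + j) ->
     is_derive t (1 : R) (D i) (D i.+1 t)) ->
  (forall t, node k <= t <= node (k + j) -> `|D j t| <= B) ->
  `|divdiff M j (D 0%N \o node) k| <= B.
Proof.
move=> dD DB; have [xi xiI E] := divdiff_mean_value dD.
have := DB xi xiI; rewrite E normrMn; apply: le_trans.
have := fact_gt0 j; case: (j`!) => // n _.
by rewrite mulrS lerDl mulrn_wge0.
Qed.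

End divided_differences.

(** * Splitting the power at the spectral edge *)

Lemma powRD_gt0 {R : realType} (x r s : R) : 0 < x ->
  x `^ (r + s) = x `^ r * x `^ s.
Proof. by move=> x0; apply: powRD; apply/implyP => _; exact: lt0r_neq0. Qed.

Section cutoff_powers.
Context {R : realType}.
Implicit Types (a b v : R).

(** The j-th derivative of v^a (1+v)^-b, for positive v. *)
Fixpoint frac_pow (j : nat) a b v : R :=
  if j is j'.+1 then a * frac_pow j' (a - 1) b v - b * frac_pow j' a (b + 1) v
  else v `^ a * (1 + v) `^ (- b).

Lemma is_derive_frac_pow j a b v : 0 < v ->
  is_derive v (1 : R) (frac_pow j a b) (frac_pow j.+1 a b v).
Proof.
move=> v0; elim: j a b => [|j IH] a b; last first.
  exact: (drvB (drvMc a (IH (a - 1) b)) (drvMc b (IH a (b + 1)))).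
have h1 : is_derive v (1 : R) (fun v => 1 + v) 1.
  by apply: (drv_eq (drvD (drv_cst v 1 1) (is_derive_id v 1))); rewrite add0r.
have v1 : 0 < 1 + v by lra.
have h2 := @drv_comp R R (fun x => x `^ (- b)) (fun v => 1 + v) v 1 _ _ (is_derive1_powR (- b) v1) h1.
apply: (drv_eq (drvM (is_derive1_powR a v0) h2)).
by rewrite /= opprD; ring.
Qed.

Lemma frac_pow_bound j a b : exists2 C, 0 <= C &
  forall v, 0 < v -> `|frac_pow j a b v| <= C * (v `^ (a - j%:R) * (1 + v) `^ (- b)).
Proof.
elim: j a b => [|j IH] a b.
  exists 1 => // v v0; rewrite mul1r subr0 /= ger0_norm//.
  by rewrite mulr_ge0 ?powR_ge0.
have [C1 C10 H1] := IH (a - 1) b; have [C2 C20 H2] := IH a (b + 1).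
exists (`|a| * C1 + `|b| * C2); first by rewrite addr_ge0 ?mulr_ge0.
move=> v v0 /=; have v1 : 0 < 1 + v by lra.
apply: le_trans (ler_normB _ _) _; rewrite [leRHS]mulrDl !normrM -!mulrA.
apply: lerD; apply: ler_wpM2l => //.
  apply: le_trans (H1 v v0) _.
  by rewrite -natr1 (_ : a - 1 - j%:R = a - (j%:R + 1))//; ring.
apply: le_trans (H2 v v0) _; apply: ler_wpM2l => //.
have -> : v `^ (a - j%:R) = v * v `^ (a - j.+1%:R).
  rewrite -{2}(powRr1 (ltW v0)) -powRD_gt0//.
  by congr (_ `^ _); rewrite -natr1; ring.
have -> : (1 + v) `^ (- b) = (1 + v) * (1 + v) `^ (- (b + 1)).
  rewrite -{2}(powRr1 (ltW v1)) -powRD_gt0//.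
  by congr (_ `^ _); ring.
set X := v `^ _; set Y := (1 + v) `^ _; rewrite -subr_ge0.
have -> : X * ((1 + v) * Y) - v * X * Y = X * Y by ring.
by rewrite mulr_ge0 ?powR_ge0.
Qed.

Variables (al : R) (p q : nat).
Hypotheses (al0 : 0 <= al) (p0 : (0 < p)%N).

Definition cut_poly : {poly R} := 1 - (1 - 'X) ^+ q.

Lemma cut_poly0 : cut_poly`_0 = 0.
Proof.
rewrite -horner_coef0 /cut_poly hornerD hornerN horner_exp !hornerE.
by rewrite subr0 expr1n subrr.
Qed.

Lemma cut_polyE x : cut_poly.[x] = 1 - (1 - x) ^+ q.
Proof. by rewrite /cut_poly hornerD hornerN horner_exp !hornerE. Qed.

(** The j-th derivative of v^al (1 - (1 - (v/(1+v))^p)^q), for positive v;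
    expanding the outer power makes it a sum of the functions [frac_pow]. *)
Definition far_part (j : nat) v : R :=
  \sum_(i < size cut_poly) cut_poly`_i * frac_pow j (al + (p * i)%:R) (p * i)%:R v.

Lemma frac_pow_mul v (x : R) k : 0 < v ->
  v `^ (x + k%:R) * (1 + v) `^ (- k%:R) = v `^ x * (v / (1 + v)) ^+ k.
Proof.
move=> v0; have v1 : 0 < 1 + v by lra.
rewrite powRD_gt0//.
by rewrite powR_mulrn ?(ltW v0)// powR_invn ?(ltW v1)// exprMn exprVn mulrA.
Qed.

Lemma is_derive_far_part j v : 0 < v ->
  is_derive v (1 : R) (far_part j) (far_part j.+1 v).
Proof. by move=> v0; apply: drv_sum => i; apply: drvMc; exact: is_derive_frac_pow. Qed.

Lemma far_part0 v : 0 <= v ->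
  far_part 0 v = v `^ al * (1 - (1 - (v / (1 + v)) ^+ p) ^+ q).
Proof.
rewrite le_eqVlt => /predU1P[<-|v0].
  rewrite mul0r expr0n eqn0Ngt p0 /= subr0 expr1n subrr mulr0.
  rewrite /far_part big1// => -[[|i] ilt] _ /=; first by rewrite cut_poly0 mul0r.
  rewrite powR0 ?mul0r ?mulr0// gt_eqF// ltr_wpDl// ltr0n; lia.
rewrite -cut_polyE horner_coef mulr_sumr; apply: eq_bigr => i _ /=.
by rewrite frac_pow_mul// -exprM mulrCA.
Qed.

(** Every term of the expansion carries at least the factor (v/(1+v))^p, and a
    derivative costs one power of v. *)
Lemma far_part_bound j : exists2 C, 0 <= C &
  forall v, 0 < v -> `|far_part j v| <= C * (v `^ (al - j%:R) * (v / (1 + v)) ^+ p).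
Proof.
have /choice[C HC] : forall i : nat, exists C, 0 <= C /\
    forall v, 0 < v -> `|frac_pow j (al + (p * i)%:R) (p * i)%:R v| <=
      C * (v `^ (al + (p * i)%:R - j%:R) * (1 + v) `^ (- (p * i)%:R)).
  by move=> i; have [C C0 H] := frac_pow_bound j (al + (p * i)%:R) (p * i)%:R; exists C.
exists (\sum_(i < size cut_poly) `|cut_poly`_i| * C i).
  by apply: sumr_ge0 => i _; rewrite mulr_ge0//; exact: (HC i).1.
move=> v v0; rewrite mulr_suml; apply: le_trans (ler_norm_sum _ _ _) _.
apply: ler_sum => -[[|i] ilt] _ /=; first by rewrite cut_poly0 mul0r normr0 !mul0r.
rewrite normrM -mulrA; apply: ler_wpM2l => //.
apply: le_trans ((HC i.+1).2 v v0) _; apply: ler_wpM2l; first exact: (HC i.+1).1.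
rewrite addrAC frac_pow_mul//; apply: ler_wpM2l; first exact: powR_ge0.
have v1 : 0 < 1 + v by lra.
apply: ler_wiXn2l; last by rewrite leq_pmulr.
  by rewrite divr_ge0// ltW.
by rewrite ler_pdivrMr// mul1r; lra.
Qed.

(** The factor (v/(1+v))^p with p >= 2K absorbs the singularity at 0, and the
    condition al + 2 <= 2K makes the result summable at infinity. *)
Lemma cut_decay K v : al + 2 <= (2 * K)%:R -> (2 * K <= p)%N -> 0 < v ->
  v `^ (al - (2 * K)%:R) * (v / (1 + v)) ^+ p <= (1 + v) ^- 2.
Proof.
move=> h1 h2 v0; have v1 : 0 < 1 + v by lra.
have h3 : (2 * K)%:R <= p%:R :> R by rewrite ler_nat.
rewrite -frac_pow_mul// -powR_invn ?(ltW v1)//.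
have h4 : 0 <= al - (2 * K)%:R + p%:R by rewrite -addrA addr_ge0// addrC subr_ge0.
have h5 : al - (2 * K)%:R + p%:R + - p%:R <= - 2%:R by rewrite addrK lerBlDr [leRHS]addrC lerBrDr.
apply: (@le_trans _ _ ((1 + v) `^ (al - (2 * K)%:R + p%:R) * (1 + v) `^ (- p%:R))).
  apply: ler_wpM2r; first exact: powR_ge0.
  by apply: ge0_ler_powR; rewrite ?nnegrE ?h4//; lra.
rewrite -powRD_gt0//; apply: ler_powR => //; lra.
Qed.

(** Since 1 - v/(1+v) = 1/(1+v), the cutoff raised to the power q decays
    like v^-q, which beats v^al by two powers. *)
Lemma near_decay v : al + 2 <= q%:R -> 0 <= v ->
  v `^ al * (1 - (v / (1 + v)) ^+ p) ^+ q <= p%:R ^+ q * (1 + v) ^- 2.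
Proof.
have al0' := al0; move=> h1 v0; have v1 : 0 < 1 + v by lra.
set z := v / (1 + v); have z0 : 0 <= z by rewrite divr_ge0// ltW.
have z1 : z <= 1 by rewrite ler_pdivrMr// mul1r; lra.
have zE : 1 - z = (1 + v)^-1 by rewrite /z; field; rewrite gt_eqF.
have h : 1 - z ^+ p <= p%:R * (1 + v)^-1.
  rewrite -zE; elim: p => [|k IH]; first by rewrite expr0 subrr mul0r.
  rewrite exprS -natr1 mulrDl mul1r.
  have : z ^+ k <= 1 by rewrite exprn_ile1.
  have : 0 <= z ^+ k by rewrite exprn_ge0.
  move: IH; set w := z ^+ k; nra.
have zp : z ^+ p <= 1 by rewrite exprn_ile1.
apply: (@le_trans _ _ ((1 + v) `^ al * (p%:R * (1 + v)^-1) ^+ q)).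
  apply: ler_pM; rewrite ?powR_ge0 ?exprn_ge0//; try lra.
    by apply: ge0_ler_powR; rewrite ?nnegrE; lra.
  by apply: lerXn2r; rewrite ?nnegrE; lra.
rewrite exprMn mulrCA; apply: ler_wpM2l; first by rewrite exprn_ge0.
rewrite exprVn -!powR_invn ?(ltW v1)// -powRD_gt0//.
apply: ler_powR; lra.
Qed.

Lemma far_small v : 0 <= v -> `|far_part 0 v| <= q%:R * v `^ al * v ^+ p.
Proof.
move=> v0; have v1 : 0 < 1 + v by lra.
rewrite far_part0// normrM ger0_norm ?powR_ge0// mulrAC [leRHS]mulrC.
apply: ler_wpM2l; first exact: powR_ge0.
set z := v / (1 + v); have z0 : 0 <= z by rewrite divr_ge0// ltW.
have z1 : z <= 1 by rewrite ler_pdivrMr// mul1r; lra.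
have zv : z <= v by rewrite ler_pdivrMr// mulrDr mulr1 lerDl mulr_ge0.
have zp0 : 0 <= z ^+ p by rewrite exprn_ge0.
have zp1 : z ^+ p <= 1 by rewrite exprn_ile1.
have zp : z ^+ p <= v ^+ p by apply: lerXn2r; rewrite ?nnegrE.
have H : 0 <= 1 - (1 - z ^+ p) ^+ q <= q%:R * z ^+ p.
  elim: q => [|k /andP[IH1 IH2]]; first by rewrite expr0 subrr mul0r lexx.
  have w0 : 0 <= (1 - z ^+ p) ^+ k by rewrite exprn_ge0//; lra.
  have w1 : (1 - z ^+ p) ^+ k <= 1 by rewrite exprn_ile1//; lra.
  rewrite exprS -natr1; move: IH1 IH2 w0 w1.
  move: ((1 - z ^+ p) ^+ k) (z ^+ p) zp0 zp1 => w y y0 y1 IH1 IH2 w0 w1.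
  by apply/andP; split; nra.
rewrite ger0_norm; last by case/andP: H.
by case/andP: H => _ /le_trans; apply; apply: ler_wpM2l.
Qed.

End cutoff_powers.

(** * The bound for Riesz means *)

Lemma eq_ler {R : realType} (x y : R) : x = y -> x <= y.
Proof. by move=> ->. Qed.

(** The quantity [node n - node k] is comparable with n(n-k). It is measured on
    the scale S = n L, where L is the reciprocal of the angular distance: the
    last L indices form the edge of the spectrum. *)
Section gap_decay.
Context {R : realType} (M n : nat).
Local Notation node := (@node R M).
Local Notation gap k := (node n - node k).

Lemma gapE k : (k <= n)%N -> gap k = ((n - k) * (n + k + M))%:R.
Proof.
move=> kn; have := @node_diff R M k (n - k); rewrite subnKC// => ->.
by congr _%:R; congr muln; lia.
Qed.

Lemma gap_ge0 k : (k <= n)%N -> 0 <= gap k.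
Proof. by move=> kn; rewrite gapE. Qed.

Lemma gap_ge k : (k <= n)%N -> n%:R * (n - k)%:R <= gap k.
Proof.
by move=> kn; rewrite gapE// -natrM ler_nat mulnC leq_mul2l; apply/orP; right; lia.
Qed.

Lemma gap_le k : (0 < n)%N -> (k <= n)%N -> gap k <= (M%:R + 2) * n%:R * (n - k)%:R.
Proof.
move=> n0 kn; rewrite gapE// (_ : M%:R + 2 = (M + 2)%:R); last by rewrite natrD.
rewrite -!natrM ler_nat [leqLHS]mulnC leq_mul2r; apply/orP; right; nia.
Qed.

Variable L : R.
Hypothesis L1 : 1 <= L.

(** The weight of the index k in the sums below: it is of order 1 for the
    last L indices, and its sum is of order L. *)
Definition decay (k : nat) : R := (L / ((n - k)%:R + L)) ^+ 2.

Lemma decay_ge0 k : 0 <= decay k. Proof. exact: sqr_ge0. Qed.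

Lemma decay_end k c : (n <= k + c)%N -> 1 <= (c%:R + 1) ^+ 2 * decay k.
Proof.
move=> nk; rewrite /decay -exprMn -[leLHS](expr1n _ 2).
have L0 : 0 < L by apply: lt_le_trans ltr01 _.
have d0 : 0 < (n - k)%:R + L by rewrite ltr_wpDl.
have h : (n - k)%:R <= c%:R :> R by rewrite ler_nat; lia.
apply: lerXn2r; rewrite ?nnegrE//.
  by rewrite mulr_ge0 ?addr_ge0 ?divr_ge0 ?(ltW d0) ?(ltW L0).
have L1' := L1.
rewrite mulrA ler_pdivlMr// mul1r mulrDl mul1r lerD//.
apply: le_trans h _; rewrite ler_peMr//.
Qed.

Lemma sum_decay m : \sum_(k < n.+1 + m) decay k <= (m%:R + 2) * L.
Proof.
have L1' := L1; have L0 : 0 < L by apply: lt_le_trans ltr01 _.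
(* Telescoping, by comparison with 2 L^2 / (r+L). *)
have H j : \sum_(r < j) (L / (r%:R + L)) ^+ 2 <= 2 * L - 2 * L ^+ 2 / (j%:R + L).
  elim: j => [|j IH].
    rewrite big_ord0 add0r; have -> : 2 * L - 2 * L ^+ 2 / L = 0 by field; exact: lt0r_neq0.
    by [].
  rewrite big_ord_recr /=; apply: le_trans (lerD IH (lexx _)) _.
  rewrite -(natr1 j); have := ler0n R j; move: (j%:R : R) => x x0.
  rewrite -subr_ge0; have -> : 2 * L - 2 * L ^+ 2 / (x + 1 + L) -
     (2 * L - 2 * L ^+ 2 / (x + L) + (L / (x + L)) ^+ 2) =
     L ^+ 2 * (x + L - 1) / ((x + L) ^+ 2 * (x + 1 + L)).
    by field; apply/andP; split; apply: lt0r_neq0; lra.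
  apply: divr_ge0; first by rewrite mulr_ge0 ?sqr_ge0//; lra.
  by rewrite mulr_ge0 ?sqr_ge0//; lra.
rewrite big_split_ord /= [leRHS]mulrDl addrC; apply: lerD.
  rewrite (eq_bigr (fun=> 1)) => [|i _]; last first.
    rewrite /decay (_ : (n - (n.+1 + i) = 0)%N) ?add0r; last by lia.
    by rewrite divff ?expr1n// lt0r_neq0.
  by rewrite sumr_const card_ord ler_peMr.
rewrite (reindex_inj rev_ord_inj) /=.
rewrite (eq_bigr (fun r : 'I_n.+1 => (L / (r%:R + L)) ^+ 2)) => [|i _]; last first.
  by rewrite /decay subSS subKn// -ltnS.
apply: le_trans (H n.+1) _; rewrite gerBl.
by apply: divr_ge0; [rewrite mulr_ge0 ?sqr_ge0|rewrite addr_ge0// ltW].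
Qed.

Hypothesis n0 : (0 < n)%N.
Let nr : R := n%:R.
Let S : R := nr * L.
Let nr1 : 1 <= nr. Proof. by rewrite ler1n. Qed.
Let S0 : 0 < S. Proof. by rewrite mulr_gt0//; apply: lt_le_trans ltr01 _. Qed.

Lemma inv_decay (c : R) k (s : R) : 1 <= c -> (k <= n)%N -> nr * (n - k)%:R <= c * s ->
  0 <= s -> (1 + s / S) ^- 2 <= c ^+ 2 * decay k.
Proof.
move=> c1 kn h s0; rewrite /decay -exprMn -exprVn.
have L0 : 0 < L by apply: lt_le_trans ltr01 _.
have nr0 : 0 < nr by apply: lt_le_trans ltr01 _.
have S0' := S0.
have d0 : 0 < (n - k)%:R + L by rewrite ltr_wpDl.
have v0 : 0 <= s / S by rewrite divr_ge0// ltW.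
apply: lerXn2r; rewrite ?nnegrE.
- by rewrite invr_ge0; lra.
- by rewrite mulr_ge0 ?divr_ge0 ?(ltW d0) ?(ltW L0)//; lra.
rewrite -[leLHS]mul1r ler_pdivrMr; last by lra.
have -> : c * (L / ((n - k)%:R + L)) * (1 + s / S) = (L * c + c * s / nr) / ((n - k)%:R + L).
  rewrite /S; field; repeat (apply/andP; split); exact: lt0r_neq0.
rewrite ler_pdivlMr// mul1r.
have h1 : (n - k)%:R <= c * s / nr by rewrite ler_pdivlMr// mulrC.
have h2 : L <= L * c by rewrite ler_peMr// ltW.
lra.
Qed.

End gap_decay.

Section riesz_bound.
Context {R : realType} (M K : nat) (al : R).
Hypotheses (al0 : 0 <= al) (alK : al + 2 <= (2 * K)%:R).

Let K0 : (0 < K)%N.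
Proof.
have al0' := al0; have alK' := alK.
by rewrite lt0n; apply/eqP => K0; move: alK'; rewrite K0 muln0; lra.
Qed.

Let p := (2 * K)%N.
Let p0 : (0 < p)%N. Proof. by rewrite /p; have := K0; lia. Qed.
Local Notation node := (@node R M).

Section fixed_n.
Variables (n : nat) (L : R).
Hypotheses (n0 : (0 < n)%N) (L1 : 1 <= L).
Let nr : R := n%:R.
Let S : R := nr * L.
Let nr1 : 1 <= nr. Proof. by rewrite ler1n. Qed.
Let S0 : 0 < S. Proof. by rewrite mulr_gt0//; apply: lt_le_trans ltr01 _. Qed.
Local Notation gap k := (node n - node k).

(** The multiplier splits into a far part, smooth enough to be summed by parts
    K times, and a near part concentrated on the last L indices. *)
Definition far_seq (k : nat) : R :=
  if (k <= n)%N then (S / node n) `^ al * far_part al p p 0 (gap k / S) else 0.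

Let node_ge : nr ^+ 2 <= node n.
Proof. by rewrite /node /nr -natrX ler_nat expnS expn1; nia. Qed.

Let node_gt0 : 0 < node n.
Proof. by apply: lt_le_trans node_ge; rewrite exprn_gt0//; apply: lt_le_trans nr1. Qed.

Definition scale_fac : R := (S / node n) `^ al.

Lemma scale_fac_ge0 : 0 <= scale_fac. Proof. exact: powR_ge0. Qed.

Lemma scale_fac_le : scale_fac <= (L / nr) `^ al.
Proof.
have nr0 : 0 < nr by apply: lt_le_trans ltr01 _.
have L0 : 0 < L by apply: lt_le_trans ltr01 _.
apply: ge0_ler_powR; rewrite ?nnegrE ?divr_ge0 ?(ltW L0) ?(ltW nr0) ?(ltW S0) ?(ltW node_gt0)//.
rewrite ler_pdivrMr// mulrAC ler_pdivlMr// /S.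
by rewrite mulrAC -mulrA mulrA -expr2 mulrC ler_wpM2l// ltW.
Qed.

Definition near_seq (k : nat) : R :=
  scale_fac * ((gap k / S) `^ al * (1 - (gap k / S / (1 + gap k / S)) ^+ p) ^+ p).

Lemma riesz_split k : (k <= n)%N ->
  (1 - node k / node n) `^ al = near_seq k + far_seq k.
Proof.
move=> kn; have v0 : 0 <= gap k / S by rewrite divr_ge0 ?gap_ge0// ltW.
rewrite /near_seq /far_seq kn far_part0// -/scale_fac -mulrDr -mulrDr.
rewrite addrCA subrr addr0 mulr1 -powRM//; last by rewrite divr_ge0// ltW.
congr (_ `^ _). 
move: (lt0r_neq0 node_gt0) (lt0r_neq0 S0); move: (node n) (node k) S => X Y Z X0 Z0.
by field; rewrite X0 Z0.
Qed.

Lemma near_seq_bound k : (k <= n)%N -> `|near_seq k| <= p%:R ^+ p * scale_fac * decay n L k.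
Proof.
move=> kn; have v0 : 0 <= gap k / S by rewrite divr_ge0 ?gap_ge0// ltW.
have v1 : 0 < 1 + gap k / S by rewrite ltr_wpDr.
rewrite ger0_norm; last first.
  rewrite mulr_ge0 ?scale_fac_ge0// mulr_ge0 ?powR_ge0// exprn_ge0// subr_ge0.
  apply: exprn_ile1; first by apply: divr_ge0 => //; exact: ltW.
  by rewrite ler_pdivrMr// mul1r lerDr.
rewrite [p%:R ^+ p * _]mulrC -mulrA; apply: ler_wpM2l; first exact: scale_fac_ge0.
apply: (le_trans (@near_decay R al p p al0 _ alK v0)); apply: ler_wpM2l; first by rewrite exprn_ge0.
have := @inv_decay R n L L1 n0 1 k (gap k) (lexx _) kn; rewrite expr1n !mul1r; apply.
- exact: gap_ge.
- exact: gap_ge0.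
Qed.

Lemma far_seq_supp k : (n.+1 <= k)%N -> far_seq k = 0.
Proof. by rewrite /far_seq ltnNge => /negbTE ->. Qed.

(** For the last indices no smoothness is available at the edge; the cutoff
    makes the multiplier itself as small as the estimate requires. *)
Lemma far_seq_end k : (n <= k + 3 * K)%N ->
  `|far_seq k| <= p%:R * ((3 * K)%:R * (M%:R + 2)) `^ (al + p%:R) * scale_fac * L ^- p.
Proof.
move=> nk; have L0 : 0 < L by apply: lt_le_trans ltr01 _.
have nr0 : 0 < nr by apply: lt_le_trans ltr01 _.
have al0' := al0.
have ap : al + p%:R != 0 by apply: lt0r_neq0; apply: ltr_wpDl => //; rewrite ltr0n.
set c := (3 * K)%:R * _; have c0 : 0 <= c by rewrite mulr_ge0// addr_ge0.
rewrite /far_seq; case: ifPn => kn; last first.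
  rewrite normr0; apply: mulr_ge0; last by rewrite invr_ge0 exprn_ge0// ltW.
  by apply: mulr_ge0; [rewrite mulr_ge0 ?powR_ge0|exact: scale_fac_ge0].
have v0 : 0 <= gap k / S by rewrite divr_ge0 ?gap_ge0// ltW.
rewrite normrM (ger0_norm scale_fac_ge0) -/scale_fac.
rewrite [_ * scale_fac]mulrC -mulrA; apply: ler_wpM2l; first exact: scale_fac_ge0.
apply: (le_trans (far_small _ al0 p0 v0)).
rewrite -!mulrA; apply: ler_wpM2l => //.
rewrite -powR_mulrn// -[in leLHS]powRD; last first.
  by rewrite (negbTE ap).
have vc : gap k / S <= c / L.
  rewrite ler_pdivrMr//; have -> : c / L * S = nr * c by rewrite /S; field; exact: lt0r_neq0.
  apply: le_trans (gap_le _ n0 kn) _.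
  have -> : nr * c = (M%:R + 2) * nr * (3 * K)%:R by rewrite /c; ring.
  apply: ler_wpM2l; first by rewrite mulr_ge0 ?addr_ge0// ltW.
  by rewrite ler_nat; clear -nk; lia.
apply: (@le_trans _ _ ((c / L) `^ (al + p%:R))).
  have cL0 : 0 <= c / L by apply: divr_ge0 => //; exact: ltW.
  by apply: ge0_ler_powR => //; apply: addr_ge0.
rewrite powRM ?invr_ge0 ?(ltW L0)//; apply: ler_wpM2l; first exact: powR_ge0.
rewrite -powR_inv1 ?(ltW L0)// -powRrM -powR_invn ?(ltW L0)//.
by apply: ler_powR => //; lra.
Qed.

End fixed_n.

End riesz_bound.

Section riesz_bound.
Context {R : realType} (M K : nat) (al : R).
Hypotheses (al0 : 0 <= al) (alK : al + 2 <= (2 * K)%:R).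

Let K0 : (0 < K)%N.
Proof.
have al0' := al0; have alK' := alK.
by rewrite lt0n; apply/eqP => K0; move: alK'; rewrite K0 muln0; lra.
Qed.

Let p := (2 * K)%N.
Let p0 : (0 < p)%N. Proof. by rewrite /p; have := K0; lia. Qed.
Local Notation node := (@node R M).
Local Notation far_seq := (@far_seq R M K al).
Local Notation near_seq := (@near_seq R M K al).
Local Notation scale_fac := (@scale_fac R M al).

Lemma divdiff_ext j m m' k : (forall i, (i <= j)%N -> m (k + i)%N = m' (k + i)%N) ->
  divdiff M j m k = divdiff M j m' k :> R.
Proof.
elim: j k => [|j IH] k H; first by have := H 0%N (leqnn _); rewrite addn0.
have h1 : divdiff M j m k = divdiff M j m' k :> R by apply: IH => i ij; apply: H; exact: leqW.
have h2 : divdiff M j m k.+1 = divdiff M j m' k.+1 :> R.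
  by apply: IH => i ij; rewrite addSnnS; apply: H.
by rewrite !divdiffS h1 h2.
Qed.

(** Away from the edge, the iterated difference is controlled by divided
    differences of order K + l with l <= K, hence by derivatives of order
    K + l. Each one gains S^-1, and the factors n^2 paid for the l extra
    derivatives are balanced by v^(K-l), as v is at most of order n/L. *)
Lemma far_bulk : exists2 C : R, 0 <= C & forall n L k, (0 < n)%N -> 1 <= L ->
  (k + p < n)%N -> `|iter K (zonal_diff M) (far_seq n L) k| <=
     C * (scale_fac n L * L ^- p * decay n L k).
Proof.
have [C1 C10 H1] := @divdiff_iter_bound R M K 0.
have /choice[CF HF] : forall j, exists C, 0 <= C /\ forall v, 0 < v ->
    `|far_part al p p j v| <= C * (v `^ (al - j%:R) * (v / (1 + v)) ^+ p).
  by move=> j; have [C C0 H] := far_part_bound al p p j; exists C.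
pose Cm := \sum_(l < K.+1) CF (K + l)%N.
have Cm0 : 0 <= Cm by apply: sumr_ge0 => l _; exact: (HF _).1.
have CmE l : (l <= K)%N -> CF (K + l)%N <= Cm.
  move=> lK; rewrite /Cm (bigD1 (Ordinal (lK : (l < K.+1)%N)))//= lerDl.
  by apply: sumr_ge0 => i _; exact: (HF _).1.
pose W : R := 4 * (M%:R + 2).
have W0 : 0 <= W by rewrite mulr_ge0// addr_ge0.
pose C2 := Cm * W ^+ K * (p%:R + 1) ^+ 2.
have C20 : 0 <= C2 by rewrite mulr_ge0 ?sqr_ge0// mulr_ge0// exprn_ge0.
exists (C1 * C2); first exact: mulr_ge0.
move=> n L k n0 L1 kn; rewrite -mulrA.
have L0 : 0 < L by apply: lt_le_trans ltr01 _.
have nr1 : 1 <= n%:R :> R by rewrite ler1n.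
have nr0 : 0 < n%:R :> R by apply: lt_le_trans ltr01 _.
pose S : R := n%:R * L; have S0 : 0 < S by exact: mulr_gt0.
(* The weight T = (2n)^2 dominates (k+1)^2. *)
apply: (H1 (far_seq n L) k (4 * n%:R ^+ 2)).
  have -> : 4 * n%:R ^+ 2 = (2 * n%:R) ^+ 2 :> R by ring.
  have : k%:R + 1 <= 2 * n%:R :> R by rewrite natr1 -natrM ler_nat; clear -kn; lia.
  by move=> h; apply: lerXn2r; rewrite ?nnegrE ?mulr_ge0 ?addr_ge0.
move=> l k' lK kk; rewrite add0n; set j := (K + l)%N.
(* The derivatives of the far part in the eigenvalue variable t. *)
pose D i (t : R) : R := (-1) ^+ i * S ^- i * scale_fac n L * far_part al p p i ((node n - t) / S).
have kj : (k' + j < n)%N by rewrite /j; clear -kn kk lK; lia.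
have mono a b : (a <= b)%N -> node a <= node b by move=> ab; rewrite ler_nat; clear -ab; nia.
have pos t : node k' <= t <= node (k' + j) -> 0 < (node n - t) / S.
  move=> /andP[_ t2]; rewrite divr_gt0// subr_gt0; apply: le_lt_trans t2 _.
  by apply: lt_le_trans (node_lt M (k' + j)) _; apply: mono.
rewrite (divdiff_ext (m' := D 0%N \o node)); last first.
  move=> i ij; rewrite /far_seq ifT; last by clear -kj ij; lia.
  by rewrite /D /= expr0 invr1 !mul1r.
have BD : `|divdiff M j (D 0%N \o node) k'| <=
    Cm * W ^+ K * (p%:R + 1) ^+ 2 * (scale_fac n L * L ^- p * decay n L k) / (4 * n%:R ^+ 2) ^+ l.
  apply: divdiff_le => [i t ij tI|t tI].
    have h : is_derive t (1 : R) (fun t => (node n - t) / S) (- S^-1).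
      have h0 := drvMc S^-1 (drvB (drv_cst t 1 (node n)) (is_derive_id t 1)).
      rewrite (_ : (fun t => _) = (fun y => S^-1 * (node n - y))); last by apply/funext => y; rewrite mulrC.
      by apply: (drv_eq h0); rewrite sub0r mulrN mulr1.
    have h1 := @drv_comp R R (far_part al p p i) (fun t => (node n - t) / S) t 1 _ _
      (is_derive_far_part al p p i (pos t tI)) h.
    apply: (drv_eq (drvMc ((-1) ^+ i * S ^- i * scale_fac n L) h1)).
    rewrite /D (exprS (-1) i) (exprS S i) (invfM S); move: (far_part al p p i.+1 _) => X.
    by move: (S^-1) (S ^- i) => Y Z; ring.
  set s := node n - t; set v := s / S; have v0 : 0 < v by exact: pos.
  have v1 : 0 < 1 + v by rewrite ltr_wpDr// ltW.
  have s0 : 0 < s by move: v0; rewrite pmulr_lgt0 ?invr_gt0.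
  have sS : s = S * v by rewrite /v mulrC divfK// lt0r_neq0.
  have sW : s <= (M%:R + 2) * n%:R ^+ 2.
    have : node n <= (M%:R + 2) * n%:R ^+ 2.
      rewrite -natrD -natrX -natrM ler_nat expnS expn1; clear -n0; nia.
    apply: le_trans; rewrite /s gerBl.
    by case/andP: tI => + _; apply: le_trans; rewrite /node.
  have sdec : (1 + v) ^- 2 <= (p%:R + 1) ^+ 2 * decay n L k.
    apply: inv_decay => //; [by rewrite lerDr|by clear -kn; lia| |exact: ltW].
    apply: (@le_trans _ _ ((p%:R + 1) * (n%:R * (n - (k' + j))%:R))).
      rewrite natr1 -!natrM ler_nat.
      have : (n - k <= p.+1 * (n - (k' + j)))%N by rewrite /p /j; clear -kn kk lK; nia.
      by move=> h; rewrite [leqRHS]mulnCA leq_mul2l h orbT.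
    apply: ler_wpM2l; first by rewrite addr_ge0.
    apply: le_trans (@gap_ge R M n (k' + j)%N (ltnW kj)) _.
    by rewrite lerD2l lerN2; case/andP: tI.
  rewrite /D -/s -/v !normrM normrX normrN1 expr1n mul1r.
  rewrite ger0_norm; last by rewrite invr_ge0 exprn_ge0// ltW.
  rewrite (ger0_norm (scale_fac_ge0 M al n L)).
  have fb := (HF j).2 v v0.
  have vE : v `^ (al - j%:R) = v `^ (al - (2 * K)%:R) * v ^+ (K - l).
    rewrite -powR_mulrn ?(ltW v0)// -powRD_gt0//; congr (_ `^ _).
    by rewrite /j natrB// natrD natrM; ring.
  have cd := cut_decay al0 alK (leqnn p) v0.
  have key : S ^- j * v ^+ (K - l) <= W ^+ K * L ^- p / (4 * n%:R ^+ 2) ^+ l.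
    rewrite ler_pdivlMr ?exprn_gt0 ?mulr_gt0 ?exprn_gt0//.
    have -> : S ^- j * v ^+ (K - l) = S ^- p * s ^+ (K - l).
      rewrite sS (exprMn _ S v) mulrA; congr (_ * _).
      have -> : p = (j + (K - l))%N by rewrite /p /j; clear -lK; lia.
      by rewrite exprD invfM -mulrA mulVf ?mulr1// lt0r_neq0// exprn_gt0.
    have -> : W ^+ K * L ^- p = S ^- p * ((n%:R ^+ 2) ^+ K * W ^+ K).
      rewrite -exprM -/p /S (exprMn p n%:R L) (invfM (n%:R ^+ p)).
      have np : n%:R ^+ p != 0 :> R by rewrite lt0r_neq0// exprn_gt0.
      by rewrite mulrACA mulVf// mul1r mulrC.
    rewrite -mulrA; apply: ler_wpM2l; first by rewrite invr_ge0 exprn_ge0// ltW.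
    rewrite -exprMn -[in leRHS](subnK lK) exprD.
    have nn0 : 0 <= n%:R ^+ 2 :> R by exact: sqr_ge0.
    have W4 : 4 <= W by rewrite /W ler_peMr// -natrD ler1n; clear; lia.
    have WM : M%:R + 2 <= W by rewrite /W ler_peMl ?addr_ge0// ler1n.
    apply: ler_pM; rewrite ?exprn_ge0 ?(ltW s0) ?mulr_ge0//.
      apply: lerXn2r; rewrite ?nnegrE ?(ltW s0) ?mulr_ge0//.
      by apply: le_trans sW _; rewrite mulrC; apply: ler_wpM2l.
    apply: lerXn2r; rewrite ?nnegrE ?mulr_ge0//.
    by rewrite mulrC; apply: ler_wpM2l.
  have a1 : 0 <= S ^- j by rewrite invr_ge0 exprn_ge0// ltW.
  have a2 : 0 <= v ^+ (K - l) by rewrite exprn_ge0// ltW.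
  have a3 := scale_fac_ge0 M al n L.
  apply: (@le_trans _ _ (scale_fac n L * (Cm * ((S ^- j * v ^+ (K - l)) * (1 + v) ^- 2)))).
    move: fb; rewrite vE; move: (far_part al p p j v) => F fb.
    have -> : S ^- j * scale_fac n L * `|F| = scale_fac n L * (S ^- j * `|F|) by ring.
    apply: ler_wpM2l => //.
    have -> : Cm * (S ^- j * v ^+ (K - l) * (1 + v) ^- 2) =
      S ^- j * (Cm * (v ^+ (K - l) * (1 + v) ^- 2)) by ring.
    apply: ler_wpM2l => //; apply: le_trans fb _.
    apply: ler_pM; [exact: (HF j).1| |exact: CmE|].
      have z0 : 0 <= v / (1 + v) by apply: divr_ge0; exact: ltW.
      by rewrite mulr_ge0 ?mulr_ge0 ?powR_ge0// exprn_ge0.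
    by rewrite [_ `^ _ * _]mulrC -mulrA; apply: ler_wpM2l.
  apply: (@le_trans _ _ (scale_fac n L * (Cm * ((W ^+ K * L ^- p / (4 * n%:R ^+ 2) ^+ l) *
      ((p%:R + 1) ^+ 2 * decay n L k))))); last by apply: eq_ler; ring.
  apply: ler_wpM2l => //; apply: ler_wpM2l => //.
  by apply: ler_pM => //; [exact: mulr_ge0|rewrite invr_ge0 exprn_ge0// ltW].
rewrite ler_pdivlMr in BD; last by rewrite exprn_gt0// mulr_gt0// exprn_gt0.
by rewrite mulrC.
Qed.

(** The indices k with k + 2K >= n are so few and so close to the edge that the
    trivial bound on iterated differences is enough. *)
Lemma far_bound : exists2 C : R, 0 <= C & forall n L k, (0 < n)%N -> 1 <= L ->
  `|iter K (zonal_diff M) (far_seq n L) k| <= C * (scale_fac n L * L ^- p * decay n L k).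
Proof.
have [C C0 H] := far_bulk.
pose C' : R := 2 ^+ K * (p%:R * ((3 * K)%:R * (M%:R + 2)) `^ (al + p%:R)) * (p%:R + 1) ^+ 2.
have C'0 : 0 <= C' by rewrite !mulr_ge0 ?powR_ge0 ?sqr_ge0 ?exprn_ge0.
exists (C + C') => [|n L k n0 L1]; first exact: addr_ge0.
have L0 : 0 < L by apply: lt_le_trans ltr01 _.
have f0 : 0 <= scale_fac n L * L ^- p.
  by rewrite mulr_ge0 ?scale_fac_ge0// invr_ge0 exprn_ge0// ltW.
have [kn|kn] := ltnP (k + p) n.
  apply: le_trans (H _ _ _ n0 L1 kn) _; apply: ler_wpM2r; last by rewrite lerDl.
  by rewrite mulr_ge0// decay_ge0.
have := @zonal_diff_bound R M K (far_seq n L) k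
  (p%:R * ((3 * K)%:R * (M%:R + 2)) `^ (al + p%:R) * scale_fac n L * L ^- p).
move=> h; apply: le_trans (h _) _.
  by move=> k' kk; apply: far_seq_end => //; rewrite /p in kn; clear -kn kk; lia.
have d1 := decay_end L1 kn.
set X := p%:R * _ `^ _.
have X0 : 0 <= X by rewrite mulr_ge0 ?powR_ge0.
apply: (@le_trans _ _ (2 ^+ K * X * (scale_fac n L * L ^- p) * 1)); first by apply: eq_ler; ring.
apply: (@le_trans _ _ (2 ^+ K * X * (scale_fac n L * L ^- p) * ((p%:R + 1) ^+ 2 * decay n L k))).
  apply: ler_wpM2l d1; apply: mulr_ge0 => //.
  by apply: mulr_ge0 => //; exact: exprn_ge0.
apply: (@le_trans _ _ (C' * (scale_fac n L * L ^- p * decay n L k))).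
  by apply: eq_ler; rewrite /C' -/X; ring.
by apply: ler_wpM2r; [rewrite mulr_ge0 ?decay_ge0|rewrite lerDr].
Qed.

(** The near part is summed absolutely. For the far part, K summations by parts
    gain (1-t)^-K <= L^(2K), which the factor L^-(2K) of the iterated difference
    compensates. Either way the sum of the weights contributes a factor L. *)
Lemma riesz_bound : exists2 C : R, 0 <= C & forall n L t Bd, (0 < n)%N -> 1 <= L ->
  1 <= L ^+ 2 * (1 - t) ->
  (forall k, (k <= n + K + 1)%N -> `|(harm_dim M k)%:R * (gegen M k).[t]| <= Bd) ->
  `|\sum_(k < n.+1) (1 - node k / node n) `^ al * ((harm_dim M k)%:R * (gegen M k).[t])|
    <= C * ((L / n%:R) `^ al * L * Bd).
Proof.
have [C C0 HC] := far_bound.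
pose C1 : R := p%:R ^+ p * 2.
pose C2 : R := C * (K.+1%:R + 2).
have C10 : 0 <= C1 by rewrite mulr_ge0// exprn_ge0.
have C20 : 0 <= C2 by rewrite mulr_ge0// addr_ge0.
exists (C1 + C2) => [|n L t Bd n0 L1 Lt HB]; first exact: addr_ge0.
have L0 : 0 < L by apply: lt_le_trans ltr01 _.
have B0 : 0 <= Bd by apply: le_trans (HB 0%N _).
have sf := scale_fac_le M al0 alK n0 L1; have sf0 := scale_fac_ge0 M al n L.
set g := fun k => (harm_dim M k)%:R * (gegen M k).[t].
rewrite (eq_bigr (fun k : 'I_n.+1 => near_seq n L k * g k + far_seq n L k * g k)); last first.
  by move=> k _; have kn : (k <= n)%N := ltn_ord k; rewrite (riesz_split M al0 alK n0 L1 kn) mulrDl.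
rewrite big_split /= mulrDl; apply: le_trans (ler_normD _ _) _; apply: lerD.
  apply: le_trans (ler_norm_sum _ _ _) _.
  apply: (@le_trans _ _ (\sum_(k < n.+1) p%:R ^+ p * scale_fac n L * Bd * decay n L k)).
    apply: ler_sum => k _; rewrite normrM -mulrA [Bd * _]mulrC mulrA.
    apply: ler_pM => //; first by apply: near_seq_bound => //; exact: ltn_ord k.
    by apply: HB; have := ltn_ord k; clear; lia.
  rewrite -mulr_sumr; have := sum_decay n L1 0; rewrite addn0 add0r => sd.
  apply: le_trans (ler_wpM2l _ sd) _; first by rewrite !mulr_ge0// exprn_ge0.
  apply: (@le_trans _ _ (C1 * (scale_fac n L * L * Bd))); first by apply: eq_ler; rewrite /C1; ring.
  apply: ler_wpM2l => //; apply: ler_wpM2r => //; apply: ler_wpM2r => //; exact: ltW.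
set n' := (n.+1 + K)%N.
have e : \sum_(k < n.+1) far_seq n L k * g k = \sum_(k < n'.+1) far_seq n L k * g k.
  rewrite /n' -addnS big_split_ord /= [X in _ = _ + X]big1 ?addr0// => i _.
  by rewrite far_seq_supp ?mul0r// leq_addr.
rewrite e.
have := @zonal_sum_iter R M (far_seq n L) t K n.+1 n' (@far_seq_supp R M K al n L) (leqnn _).
have gE m : \sum_(k < n'.+1) m k * (harm_dim M k)%:R * (gegen M k).[t] = \sum_(k < n'.+1) m k * g k.
  by apply: eq_bigr => k _; rewrite mulrA.
rewrite !gE => E.
have t0 : 0 < 1 - t by move: (lt_le_trans ltr01 Lt); rewrite pmulr_rgt0// exprn_gt0.
have tK : 0 < (1 - t) ^+ K by rewrite exprn_gt0.
rewrite -(ler_pM2l tK) -[X in X * `|_|](gtr0_norm tK) -normrM E.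
apply: le_trans (ler_norm_sum _ _ _) _.
apply: (@le_trans _ _ (\sum_(k < n'.+1) C * (scale_fac n L * L ^- p) * Bd * decay n L k)).
  apply: ler_sum => k _; rewrite normrM.
  have -> : C * (scale_fac n L * L ^- p) * Bd * decay n L k =
    C * (scale_fac n L * L ^- p * decay n L k) * Bd by ring.
  apply: ler_pM => //; first exact: HC.
  by apply: HB; have := ltn_ord k; rewrite /n'; clear; lia.
rewrite -mulr_sumr; have := sum_decay n L1 K.+1; rewrite addnS -/n' => sd.
have Lp : L ^- p <= (1 - t) ^+ K.
  rewrite /p exprM -exprVn; apply: lerXn2r; rewrite ?nnegrE ?invr_ge0 ?sqr_ge0 ?(ltW t0)//.
  by rewrite -[leLHS]mul1r ler_pdivrMr ?exprn_gt0// mulrC.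
have Lp0 : 0 <= L ^- p by rewrite invr_ge0 exprn_ge0// ltW.
apply: le_trans (ler_wpM2l _ sd) _; first by rewrite !mulr_ge0.
apply: (@le_trans _ _ (L ^- p * (C2 * (scale_fac n L * L * Bd)))).
  by apply: eq_ler; rewrite /C2; ring.
apply: ler_pM => //; first by rewrite !mulr_ge0// ltW.
apply: ler_wpM2l => //; apply: ler_wpM2r => //; apply: ler_wpM2r => //; exact: ltW.
Qed.

End riesz_bound.

(** * Decay of Gegenbauer polynomials *)

Lemma is_derive_nonpos_le {R : realType} (f df : R -> R) (a b : R) : a <= b ->
  (forall t, a <= t <= b -> is_derive t (1 : R) f (df t)) ->
  (forall t, a <= t <= b -> df t <= 0) -> f b <= f a.
Proof.
move=> ab dr d0; have [||c cab E] := @MVT_segment R f df a b ab.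
- by move=> t /subset_itv_oo_cc; rewrite in_itv; exact: dr.
- apply: derivable_within_continuous => t; rewrite in_itv => /dr h.
  by case: h.
rewrite -subr_le0 E mulr_le0_ge0 ?subr_ge0//.
by apply: d0; move: cab; rewrite in_itv.
Qed.

Section energy.
Context {R : realType} (M k : nat).
Local Notation P := (@gegen R M k).
Let la : R := M%:R / 2.
Let nu : R := k%:R + la.
Let y (t : R) : R := P.[t].
Let y1 (t : R) : R := P^`().[t].
Let y2 (t : R) : R := P^`()^`().[t].
Let s (t : R) : R := 1 - t ^+ 2.
Let w t : R := s t * y1 t - la * t * y t.

(** A Sonin-type function of the Gegenbauer equation: with s = 1 - t^2,
    la = M/2 and nu = k + la, it is quadratic in y and in the derivative of
    s^(la/2) y up to normalization, and satisfies
    s B' = 2 (la - 1) t (B - la y^2). *)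
Definition energy (t : R) : R :=
  (nu ^+ 2 * s t + la * (1 - la)) * y t ^+ 2 + w t ^+ 2.

Let ode t : s t * y2 t - (2 * la + 1) * t * y1 t + (nu ^+ 2 - la ^+ 2) * y t = 0.
Proof.
have := congr1 (horner^~ t) (gegen_ode M k : _ = 0 :> {poly R}).
rewrite !(hornerM, hornerD, hornerN, hornerX, horner0, hornerXn) -!(polyC_natr R) !hornerC.
rewrite -[RHS]/(0 : R) => <-; rewrite /s /y /y1 /y2 /nu /la -natr1 !(natrM, natrD).
by field.
Qed.

Let w1 t : R := s t * y2 t - 2 * t * y1 t - la * y t - la * t * y1 t.
Let dB t : R := - (2 * nu ^+ 2 * t) * y t ^+ 2 +
  2 * (nu ^+ 2 * s t + la * (1 - la)) * y t * y1 t + 2 * w t * w1 t.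

Let ds t : is_derive t (1 : R) s (- (2 * t)).
Proof.
apply: (@drv_eq R R s t 1 _ _ (drvB (drv_cst t (1:R) (1 : R)) (drvM (is_derive_id t (1:R)) (is_derive_id t (1:R))))).
by ring.
Qed.

Let dy t : is_derive t (1 : R) y (y1 t). Proof. exact: is_derive_poly. Qed.
Let dy1 t : is_derive t (1 : R) y1 (y2 t). Proof. exact: is_derive_poly. Qed.

Let is_derive_energy t : is_derive t (1 : R) energy (dB t).
Proof.
have dw : is_derive t (1 : R) w (w1 t).
  have h := drvB (drvM (ds t) (dy1 t)) (drvM (drvMc la (is_derive_id t (1:R))) (dy t)).
  apply: (drv_eq h).
  by rewrite /w1; ring.
have h := drvD (drvM (drvD (drvMc (nu ^+ 2) (ds t)) (drv_cst t (1:R) (la * (1 - la))))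
   (drvM (dy t) (dy t))) (drvM dw dw).
apply: (drv_eq h).
by rewrite /dB /=; ring.
Qed.

Let energy_drv t : s t * dB t = (2 * la - 2) * t * (energy t - la * y t ^+ 2).
Proof.
apply/eqP; rewrite -subr_eq0; apply/eqP.
transitivity (2 * w t * s t * (s t * y2 t - (2 * la + 1) * t * y1 t + (nu ^+ 2 - la ^+ 2) * y t)).
  by rewrite /dB /energy /w1 /w /s; ring.
by rewrite ode mulr0.
Qed.

Let s_gt0 t : 0 <= t < 1 -> 0 < s t.
Proof. by rewrite /s => /andP[t0 t1]; nra. Qed.

(** The derivative of s^(la-1) B is -2 la (la-1) t s^(la-2) y^2 <= 0. *)
Lemma energy_mono_ge1 t : (2 <= M)%N -> 0 <= t < 1 ->
  s t `^ (la - 1) * energy t <= energy 0.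
Proof.
move=> M2 /andP[t0 t1].
have la1 : 1 <= la by rewrite /la ler_pdivlMr// mul1r ler_nat.
have h0 : s 0 `^ (la - 1) * energy 0 = energy 0 by rewrite /s expr0n subr0 powR1 mul1r.
rewrite -h0.
apply: (@is_derive_nonpos_le _ (fun t => s t `^ (la - 1) * energy t)
  (fun t => (la - 1) * s t `^ (la - 1 - 1) * (- (2 * t)) * energy t + s t `^ (la - 1) * dB t)) => //.
  move=> u /andP[u0 ut]; have su : 0 < s u by apply: s_gt0; rewrite u0 (le_lt_trans ut).
  apply: drvM; last exact: is_derive_energy.
  exact: (@drv_comp R R (fun x => x `^ (la - 1)) s u 1 _ _ (is_derive1_powR (la - 1) su) (ds u)).
move=> u /andP[u0 ut]; have su : 0 < s u by apply: s_gt0; rewrite u0 (le_lt_trans ut).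
have -> : s u `^ (la - 1) = s u * s u `^ (la - 1 - 1).
  by rewrite -{2}(powRr1 (ltW su)) -powRD_gt0//; congr (_ `^ _); ring.
set e := _ `^ _; have e0 : 0 <= e by exact: powR_ge0.
have -> : (la - 1) * e * (- (2 * u)) * energy u + s u * e * dB u =
  e * (s u * dB u - 2 * (la - 1) * u * energy u) by ring.
rewrite energy_drv; apply: mulr_ge0_le0 => //.
have -> : (2 * la - 2) * u * (energy u - la * y u ^+ 2) - 2 * (la - 1) * u * energy u =
  - (2 * (la - 1) * la * u * y u ^+ 2) by ring.
have la0 : 0 <= la - 1 by rewrite subr_ge0.
rewrite oppr_le0; apply: mulr_ge0; last exact: sqr_ge0.
by apply: mulr_ge0 => //; apply: mulr_ge0; [exact: mulr_ge0|exact: le_trans la1].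
Qed.

(** For la = 1/2 the exponent la - 1 is negative and the previous function is
    not the right one; s^(1/2) B / (nu^2 s + 1/4) decreases instead. *)
Lemma energy_mono_half t : M = 1%N -> 0 <= t < 1 ->
  s t `^ la * y t ^+ 2 * (nu ^+ 2 + la * (1 - la)) <= energy 0.
Proof.
move=> M1 /andP[t0 t1].
have la2 : la = 2^-1 by rewrite /la M1 mul1r.
have nu0 : 0 <= nu by rewrite /nu addr_ge0// la2 invr_ge0.
pose D t := nu ^+ 2 * s t + la * (1 - la).
have D0 u : 0 < s u -> 0 < D u.
  by move=> su; rewrite /D la2; apply: ltr_wpDl; [rewrite mulr_ge0 ?sqr_ge0 ?ltW|lra].
have mono : s t `^ la * energy t * D t `^ (-1) <= s 0 `^ la * energy 0 * D 0 `^ (-1).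
  apply: (@is_derive_nonpos_le _ (fun t => s t `^ la * energy t * D t `^ (-1))
  (fun t => (la * s t `^ (la - 1) * (- (2 * t)) * energy t + s t `^ la * dB t) * D t `^ (-1)
     + s t `^ la * energy t * (-1 * D t `^ (-1 - 1) * (nu ^+ 2 * (- (2 * t)) + 0)))) => //.
    move=> u /andP[u0 ut]; have su : 0 < s u by apply: s_gt0; rewrite u0 (le_lt_trans ut).
    apply: drvM; first apply: drvM; last 2 first.
    - exact: is_derive_energy.
    - apply: (@drv_comp R R (fun x => x `^ (-1)) D u 1 _ _ (is_derive1_powR (-1) (D0 u su))).
      exact: (drvD (drvMc (nu ^+ 2) (ds u)) (drv_cst u (1:R) (la * (1 - la)))).
    exact: (@drv_comp R R (fun x => x `^ la) s u 1 _ _ (is_derive1_powR la su) (ds u)).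
  move=> u /andP[u0 ut]; have su : 0 < s u by apply: s_gt0; rewrite u0 (le_lt_trans ut).
  have Du := D0 u su.
  have -> : s u `^ la = s u * s u `^ (la - 1).
    by rewrite -{2}(powRr1 (ltW su)) -powRD_gt0//; congr (_ `^ _); ring.
  have -> : D u `^ (-1) = D u * D u `^ (-1 - 1).
    by rewrite -{2}(powRr1 (ltW Du)) -powRD_gt0//; congr (_ `^ _); ring.
  set e := s u `^ _; have e0 : 0 <= e by exact: powR_ge0.
  set g := D u `^ _; have g0 : 0 <= g by exact: powR_ge0.
  apply: (@le_trans _ _ (e * g * (- (u / 2) * w u ^+ 2))); last first.
    by rewrite mulr_ge0_le0 ?mulr_ge0// mulr_le0_ge0 ?sqr_ge0// oppr_le0 divr_ge0.
  apply: eq_ler.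
  transitivity (e * g * ((s u * dB u - 2 * la * u * energy u) * D u + 2 * nu ^+ 2 * u * s u * energy u)).
    by ring.
  by rewrite energy_drv /D /energy la2; field.
have st : 0 < s t by apply: s_gt0; rewrite t0.
have Dt := D0 t st.
have s0 : s 0 = 1 by rewrite /s expr0n subr0.
have D00 : D 0 = nu ^+ 2 + la * (1 - la) by rewrite /D s0 mulr1.
have DD : 0 < D 0 by apply: D0; rewrite s0.
move: mono; rewrite s0 powR1 mul1r !powR_inv1 ?(ltW Dt) ?(ltW DD)// ler_pdivlMr// D00.
apply: le_trans; apply: ler_wpM2r; first by rewrite -D00 ltW.
rewrite -[leRHS]mulrA; apply: ler_wpM2l; first exact: powR_ge0.
by rewrite ler_pdivlMr// /energy -/(D t) mulrC lerDl sqr_ge0.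
Qed.

(** The first alternative is the region within distance O(1/nu) of the pole,
    where the bound by 1 is good enough; beyond it, for la >= 1, the negative
    term la (1 - la) y^2 of the energy is at most half of the leading term. *)
Lemma energy_bound t : (0 < M)%N -> 0 <= t < 1 ->
  nu ^+ 2 * s t <= 2 * la ^+ 2 \/ nu ^+ 2 * (s t `^ la * y t ^+ 2) <= 2 * energy 0.
Proof.
move=> M0 tI; have la0 : 0 <= la by rewrite /la divr_ge0.
have st := s_gt0 tI.
have E0 : 0 <= energy 0 -> energy 0 <= 2 * energy 0 by lra.
have [M2|M1] := ltnP 1 M; last first.
  have M1' : M = 1%N by lia.
  right; have := energy_mono_half M1' tI.
  have l0 : 0 <= la * (1 - la) by rewrite /la M1'; lra.
  have z0 : 0 <= s t `^ la * y t ^+ 2 by rewrite mulr_ge0 ?powR_ge0 ?sqr_ge0.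
  have := mulr_ge0 z0 (sqr_ge0 nu); have := mulr_ge0 z0 l0.
  by move: (s t `^ la * y t ^+ 2) (energy 0) (la * (1 - la)) => a b c; nra.
have la1 : 1 <= la by rewrite /la ler_pdivlMr// mul1r ler_nat.
have [h|h] := leP (nu ^+ 2 * s t) (2 * la ^+ 2); [by left|right].
have := energy_mono_ge1 M2 tI.
have -> : s t `^ la = s t `^ (la - 1) * s t.
  by rewrite -{3}(powRr1 (ltW st)) -powRD_gt0//; congr (_ `^ _); ring.
have e0 : 0 <= s t `^ (la - 1) by exact: powR_ge0.
move: e0; move: (s t `^ (la - 1)) => e e0 mono.
have key : nu ^+ 2 * s t * y t ^+ 2 <= 2 * energy t.
  rewrite /energy -subr_ge0.
  have -> : 2 * ((nu ^+ 2 * s t + la * (1 - la)) * y t ^+ 2 + w t ^+ 2) - nu ^+ 2 * s t * y t ^+ 2 =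
    (nu ^+ 2 * s t - 2 * la ^+ 2 + 2 * la) * y t ^+ 2 + 2 * w t ^+ 2 by ring.
  apply: addr_ge0; first by apply: mulr_ge0; [lra|exact: sqr_ge0].
  by apply: mulr_ge0 => //; exact: sqr_ge0.
have -> : nu ^+ 2 * (e * s t * y t ^+ 2) = e * (nu ^+ 2 * s t * y t ^+ 2) by ring.
apply: le_trans (ler_wpM2l e0 key) _; rewrite mulrCA; exact: ler_wpM2l.
Qed.

End energy.

Lemma simplex_num_le M k : (simplex_num M k <= k.+1 ^ M)%N.
Proof.
elim: M => [|M IH]; first by rewrite /simplex_num addn0 binn.
have e : (M.+1 * simplex_num M.+1 k = (k + M).+1 * simplex_num M k)%N.
  have c m : simplex_num m k = 'C(k + m, m).
    by rewrite /simplex_num -(@bin_sub (k + m) k) ?leq_addr// addKn.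
  by rewrite !c addnS -mul_bin_diag.
rewrite -(leq_pmul2l (ltn0Sn M)) e expnS mulnA.
by apply: leq_mul => //; nia.
Qed.

Lemma harm_dim_le M k : (harm_dim M k <= 2 * simplex_num M k)%N.
Proof.
rewrite /harm_dim mul2n -addnn leq_add2l; case: k => [|k]; first exact: leq0n.
have := simplex_numS M k; have := simplex_num_gt0 M k.
by move: (simplex_num M k) (simplex_num M k.+1) => a b; nia.
Qed.

Lemma harm_dim_leS M k : (harm_dim M k.+1 <= (M + 2) * simplex_num M k)%N.
Proof.
rewrite -(leq_pmul2l (ltn0Sn k)) harm_dimS mulnA; apply: leq_mul => //; nia.
Qed.

Arguments simplex_num : simpl never.

Section gegen_decay.
Context {R : realType} (M : nat).
Local Notation P := (@gegen R M).
Local Notation A := (simplex_num M).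
Local Notation d := (harm_dim M).
Let la : R := M%:R / 2.

(** At 0 the recurrence reduces to two terms, and the ratio of consecutive
    terms is (k+1)(k+M+2)/((k+M+1)(k+2)) <= 1. *)
Lemma gegen_at0 k : (P k).[0] ^+ 2 * (A k)%:R <= 1.
Proof.
suff : (P k).[0] ^+ 2 * (A k)%:R <= 1 /\ (P k.+1).[0] ^+ 2 * (A k.+1)%:R <= 1 by case.
elim: k => [|k [IH1 IH2]].
  rewrite /simplex_num bin0 /gegen hornerX -[1 in X in X.[_]]/(1%:P) hornerC.
  by rewrite expr1n mul1r expr0n mul0r.
split=> //.
have := gegen_recE M k (0 : R); rewrite mulr0 mul0r sub0r => e.
have e1 := @simplex_numSr R M k; have e2 := @simplex_numSr R M k.+1.
have k0 := ler0n R k; have M0 := ler0n R M.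
have a0 : 0 <= (A k)%:R :> R by [].
move: e e1 e2 IH1; rewrite addn1 -(natr1 (k + M)%N) -(natr1 k.+1) -(natr1 k) natrD.
move: ((A k)%:R : R) ((A k.+1)%:R : R) ((A k.+2)%:R : R) (P k.+2).[0] (P k).[0] a0 k0 M0.
move: (k%:R : R) (M%:R : R) => x m a0 a1 a2 p2 p0 a00 x0 m0 e e1 e2 h.
have h1 : 0 < x + m + 1 by lra.
have h2 : 0 < x + 1 by lra.
have h3 : 0 < x + 1 + 1 by lra.
have -> : p2 = - ((x + 1) * p0) / (x + m + 1) by apply: (mulfI (lt0r_neq0 h1)); rewrite e; field; exact: lt0r_neq0.
have -> : a2 = (x + m + 2) * ((x + m + 1) * a0 / (x + 1)) / (x + 1 + 1).
  apply: (mulfI (lt0r_neq0 h3)); rewrite e2.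
  have -> : a1 = (x + m + 1) * a0 / (x + 1) by apply: (mulfI (lt0r_neq0 h2)); rewrite e1; field; exact: lt0r_neq0.
  by field; rewrite !lt0r_neq0.
apply: le_trans h.
have -> : (- ((x + 1) * p0) / (x + m + 1)) ^+ 2 * ((x + m + 2) * ((x + m + 1) * a0 / (x + 1)) / (x + 1 + 1))
  = (p0 ^+ 2 * a0) * ((x + 1) * (x + m + 2) / ((x + m + 1) * (x + 1 + 1))).
  by field; rewrite !lt0r_neq0.
apply: ler_piMr; first by rewrite mulr_ge0 ?sqr_ge0.
by rewrite ler_pdivrMr ?mulr_gt0// mul1r; nra.
Qed.

Lemma gegen_deriv_at0 k : (P k.+1)^`().[0] = k.+1%:R * (P k).[0].
Proof.
have := congr1 (horner^~ 0) (gegen_deriv M k : _ /\ _ = _ :> {poly R}).1.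
rewrite !(hornerM, hornerD, hornerN, hornerX, hornerXn) -!(polyC_natr R) !hornerC.
by rewrite !(mul0r, subr0, mul1r).
Qed.

Lemma gegenN k t : (P k).[- t] ^+ 2 = (P k).[t] ^+ 2.
Proof.
have sgn j : (P j).[- t] = (-1) ^+ j * (P j).[t].
  suff : (P j).[- t] = (-1) ^+ j * (P j).[t] /\ (P j.+1).[- t] = (-1) ^+ j.+1 * (P j.+1).[t] by case.
  elim: j => [|j [IH1 IH2]].
    by rewrite /gegen !hornerX -[1 in X in X.[_]]/(1%:P) !hornerC; split; ring.
  split=> //.
  have h : (j + M + 1)%:R != 0 :> R by rewrite addn1 pnatr_eq0.
  apply: (mulfI h); rewrite mulrCA !gegen_recE IH1 IH2 !exprS; ring.
by rewrite sgn exprMn -exprM mulnC exprM sqrrN !expr1n mul1r.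
Qed.

Lemma energy0_bound k : (0 < M)%N ->
  (d k)%:R ^+ 2 * energy M k 0 <= (k%:R + la) ^+ 2 * ((8 + (M%:R + 2) ^+ 2) * k.+1%:R ^+ M) :> R.
Proof.
move=> M0; have la2 : 2^-1 <= la by rewrite /la -[leLHS]mul1r ler_pM2r// ler1n.
have k0 := ler0n R k.
rewrite /energy -/la -/(P k) expr0n subr0 mulr1 mulr0 mul0r subr0 mul1r.
have hA : (A k)%:R <= k.+1%:R ^+ M :> R by rewrite -natrX ler_nat simplex_num_le.
have A0 : 0 < (A k)%:R :> R by rewrite ltr0n simplex_num_gt0.
have T1 : (d k)%:R ^+ 2 * (P k).[0] ^+ 2 <= 4 * k.+1%:R ^+ M.
  have h1 : (d k)%:R ^+ 2 <= (2 * (A k)%:R) ^+ 2 :> R.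
    by apply: lerXn2r; rewrite ?nnegrE ?mulr_ge0// -natrM ler_nat harm_dim_le.
  apply: le_trans (ler_wpM2r (sqr_ge0 _) h1) _.
  have -> : (2 * (A k)%:R) ^+ 2 * (P k).[0] ^+ 2 = 4 * (A k)%:R * ((P k).[0] ^+ 2 * (A k)%:R) by ring.
  apply: (@le_trans _ _ (4 * (A k)%:R * 1)); last by rewrite mulr1 ler_pM2l.
  by apply: ler_wpM2l; [rewrite mulr_ge0|exact: gegen_at0].
have T2 : (d k)%:R ^+ 2 * (P k)^`().[0] ^+ 2 <= (k%:R + la) ^+ 2 * ((M%:R + 2) ^+ 2 * k.+1%:R ^+ M).
  case: k k0 hA A0 T1 => [|j] _ _ _ _.
    rewrite /gegen -[1 in X in X^`()]/(1%:P) derivC horner0 expr0n mulr0.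
    by rewrite mulr_ge0 ?sqr_ge0// mulr_ge0 ?sqr_ge0// exprn_ge0.
  rewrite gegen_deriv_at0.
  have h1 : (d j.+1)%:R ^+ 2 <= ((M%:R + 2) * (A j)%:R) ^+ 2 :> R.
    by apply: lerXn2r; rewrite ?nnegrE ?mulr_ge0 ?addr_ge0// -natrD -natrM ler_nat harm_dim_leS.
  apply: le_trans (ler_wpM2r (sqr_ge0 _) h1) _.
  have -> : ((M%:R + 2) * (A j)%:R) ^+ 2 * (j.+1%:R * (P j).[0]) ^+ 2 =
    j.+1%:R ^+ 2 * ((M%:R + 2) ^+ 2 * ((A j)%:R * ((P j).[0] ^+ 2 * (A j)%:R))) by ring.
  have M20 : 0 <= (M%:R + 2) ^+ 2 :> R by exact: sqr_ge0.
  have hp : 0 <= (P j).[0] ^+ 2 * (A j)%:R by rewrite mulr_ge0 ?sqr_ge0.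
  apply: ler_pM; rewrite ?sqr_ge0//; first by rewrite mulr_ge0// mulr_ge0.
    have l0 : 0 <= la by apply: le_trans la2; rewrite invr_ge0.
    by apply: lerXn2r; rewrite ?nnegrE ?addr_ge0// lerDl.
  apply: ler_wpM2l => //; apply: (@le_trans _ _ ((A j)%:R * 1)).
    by apply: ler_wpM2l => //; exact: gegen_at0.
  rewrite mulr1 -natrX ler_nat; apply: leq_trans (simplex_num_le M j) _.
  by rewrite leq_exp2r.
have T3 : (d k)%:R ^+ 2 * (((k%:R + la) ^+ 2 + la * (1 - la)) * (P k).[0] ^+ 2) <=
   (k%:R + la) ^+ 2 * (8 * k.+1%:R ^+ M).
  apply: (@le_trans _ _ (2 * (k%:R + la) ^+ 2 * ((d k)%:R ^+ 2 * (P k).[0] ^+ 2))).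
    rewrite mulrCA; apply: ler_wpM2r; first by rewrite mulr_ge0 ?sqr_ge0.
    by move: la2 k0; move: la (k%:R : R) => l x; nra.
  apply: le_trans (ler_wpM2l _ T1) _; first by rewrite mulr_ge0 ?sqr_ge0.
  by apply: eq_ler; ring.
rewrite mulrDr [X in _ <= _ * X]mulrDl [leRHS]mulrDr; exact: lerD.
Qed.

(** The squared form of d_k |P_k(cos g)| <= C (k+1)^la (sin g)^-la: away from
    the poles the energy at 0 bounds it, near a pole sin g is so small that
    |P_k| <= 1 suffices. Parity reduces negative t to positive t. *)
Lemma gegen_decay : exists2 C : R, 0 <= C & forall k t, -1 < t < 1 ->
  `|(P k).[t]| <= 1 ->
  (1 - t ^+ 2) `^ la * ((d k)%:R * (P k).[t]) ^+ 2 <= C * k.+1%:R ^+ M.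
Proof.
pose C1 : R := 2 * (8 + (M%:R + 2) ^+ 2).
pose C2 : R := 4 * (2 * M%:R ^+ 2) `^ la.
have C10 : 0 <= C1 by rewrite mulr_ge0// addr_ge0// sqr_ge0.
have C20 : 0 <= C2 by rewrite mulr_ge0// powR_ge0.
exists (C1 + C2) => [|k t]; first exact: addr_ge0.
wlog t0 : t / 0 <= t.
  move=> H tI h; have [t0|t0] := leP 0 t; first exact: H.
  have := H (- t); rewrite sqrrN !exprMn gegenN; apply.
  - by rewrite oppr_ge0 ltW.
  - by case/andP: tI => a b; apply/andP; split; lra.
  - by rewrite -(ler_pXn2r (ltn0Sn 1)) ?nnegrE// real_normK ?num_real// gegenN
      -(real_normK (num_real _)) expr1n expr_le1.
move=> /andP[_ t1] h; rewrite exprMn.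
have st : 0 < 1 - t ^+ 2 by nra.
have y1 : (P k).[t] ^+ 2 <= 1 by rewrite -(real_normK (num_real _)) expr_le1.
have k10 : 0 < k.+1%:R :> R by rewrite ltr0n.
have dk : (d k)%:R ^+ 2 <= 4 * (k.+1%:R ^+ M) ^+ 2 :> R.
  have -> : 4 * (k.+1%:R ^+ M) ^+ 2 = (2 * k.+1%:R ^+ M) ^+ 2 :> R by ring.
  apply: lerXn2r; rewrite ?nnegrE ?mulr_ge0 ?exprn_ge0// -natrX -natrM ler_nat.
  by apply: leq_trans (harm_dim_le M k) _; rewrite leq_mul2l simplex_num_le orbT.
have kM : 0 <= k.+1%:R ^+ M :> R by rewrite exprn_ge0.
have small : (1 - t ^+ 2) `^ la * k.+1%:R ^+ M <= (2 * M%:R ^+ 2) `^ la ->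
    (1 - t ^+ 2) `^ la * ((d k)%:R ^+ 2 * (P k).[t] ^+ 2) <= (C1 + C2) * k.+1%:R ^+ M.
  move=> H; apply: (@le_trans _ _ ((1 - t ^+ 2) `^ la * (4 * (k.+1%:R ^+ M) ^+ 2))).
    apply: ler_wpM2l; first exact: powR_ge0.
    by apply: le_trans dk; rewrite ler_piMr// sqr_ge0.
  apply: (@le_trans _ _ (C2 * k.+1%:R ^+ M)); last by apply: ler_wpM2r => //; rewrite lerDr.
  have -> : (1 - t ^+ 2) `^ la * (4 * (k.+1%:R ^+ M) ^+ 2) =
     4 * ((1 - t ^+ 2) `^ la * k.+1%:R ^+ M) * k.+1%:R ^+ M by ring.
  by apply: ler_wpM2r => //; apply: ler_wpM2l.
have [M0|M0] := posnP M.
  by apply: small; rewrite /la M0 mul0r !powRr0 expr0 mulr1.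
have la2 : 2^-1 <= la by rewrite /la -[leLHS]mul1r ler_pM2r// ler1n.
have kl : 2^-1 * k.+1%:R <= k%:R + la by have := ler0n R k; rewrite -(natr1 k); have l2 := la2; move: l2; move: la => l l2; lra.
have nu0 : 0 < k%:R + la by apply: lt_le_trans kl; rewrite mulr_gt0.
have tI : 0 <= t < 1 by rewrite t0.
have [H|H] := energy_bound k M0 tI.
  apply: small.
  have -> : k.+1%:R ^+ M = (k.+1%:R ^+ 2) `^ la :> R.
    rewrite -powR_mulrn ?(ltW k10)// -[in RHS]powR_mulrn ?(ltW k10)// -powRrM.
    by congr (_ `^ _); rewrite /la; field.
  rewrite -powRM ?sqr_ge0 ?(ltW st)//.
  have l0 : 0 <= la by apply: le_trans la2; rewrite invr_ge0.
  apply: ge0_ler_powR => //; rewrite ?nnegrE.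
  - by apply: mulr_ge0; [exact: ltW|exact: sqr_ge0].
  - by apply: mulr_ge0 => //; exact: sqr_ge0.
  have kl2 : (2^-1 * k.+1%:R) ^+ 2 <= (k%:R + la) ^+ 2.
    by apply: lerXn2r; rewrite ?nnegrE ?(ltW nu0) ?mulr_ge0// invr_ge0.
  have := le_trans (ler_wpM2r (ltW st) kl2) H; rewrite -/la /=.
  have -> : la ^+ 2 = M%:R ^+ 2 / 4 by rewrite /la; field.
  rewrite exprMn; move: (k.+1%:R ^+ 2) (M%:R ^+ 2) => a b; lra.
apply: (@le_trans _ _ (C1 * k.+1%:R ^+ M)); last by apply: ler_wpM2r => //; rewrite lerDl.
have n2 : 0 < (k%:R + la) ^+ 2 by rewrite exprn_gt0.
rewrite -(ler_pM2l n2).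
have := ler_wpM2l (sqr_ge0 (d k)%:R) H; rewrite -/la.
have E := energy0_bound k M0.
have -> : (k%:R + la) ^+ 2 * ((1 - t ^+ 2) `^ la * ((d k)%:R ^+ 2 * (P k).[t] ^+ 2)) =
  (d k)%:R ^+ 2 * ((k%:R + la) ^+ 2 * ((1 - t ^+ 2) `^ la * (P k).[t] ^+ 2)) by ring.
move=> /le_trans; apply; rewrite mulrCA.
apply: (@le_trans _ _ (2 * ((k%:R + la) ^+ 2 * ((8 + (M%:R + 2) ^+ 2) * k.+1%:R ^+ M)))).
  exact: ler_wpM2l.
by apply: eq_ler; rewrite /C1; ring.
Qed.

End gegen_decay.

(** * The three estimates *)

Lemma powR_invl {R : realType} (a z : R) : 0 <= z -> z^-1 `^ a = (z `^ a)^-1.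
Proof. by move=> z0; rewrite -[z^-1]powR_inv1// -powRrM mulN1r powRN. Qed.

Section estimates.
Context {R : realType} (M : nat) (al : R).
Hypothesis al0 : 0 <= al.
Implicit Types (x y : 'rV[R]_M.+2).
Local Notation d := (harm_dim M).
Local Notation P := (@gegen R M).
Local Notation basis Y := (forall k, orthonormal_basis (@spherical_harmonics R M.+1 k) (Y k)).
Let om : R := (M.+2%:R * @ball_volume R M)^-1.
Let la : R := M%:R / 2.

(** The Riesz kernel at points with inner product t, up to the reciprocal of
    the area of the sphere. *)
Definition zonal_sum n t : R :=
  \sum_(k < n.+1) (1 - node M k / node M n) `^ al * ((d k)%:R * (P k).[t]).

Lemma LB_eigenvalueE k : @LB_eigenvalue R M.+1 k = node M k.
Proof. by rewrite /LB_eigenvalue /node natrM natrD -natr1; ring. Qed.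

Lemma riesz_kernelE (a : nat -> nat) (Y : forall k, 'I_(a k) -> 'rV[R]_M.+2 -> R) x y n :
  basis Y -> sphere x -> sphere y -> riesz_kernel Y al x y n = om * zonal_sum n (dotp x y).
Proof.
move=> bY sx sy; rewrite /riesz_kernel /zonal_sum mulr_sumr; apply: eq_bigr => k _.
by rewrite !LB_eigenvalueE (zonal_harmonicE (bY k) sx sy) -/om; ring.
Qed.

Lemma cos_sph_dist x y : sphere x -> sphere y -> cos (sph_dist x y) = dotp x y.
Proof. by move=> sx sy; rewrite acosK// in_itv /= cauchy_schwarz_sphere. Qed.

Lemma harm_dim_power k : (d k)%:R <= 2 * k.+1%:R ^+ M :> R.
Proof.
rewrite -natrX -natrM ler_nat; apply: leq_trans (harm_dim_le M k) _.
by rewrite leq_mul2l simplex_num_le orbT.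
Qed.

Lemma zonal_term_le k x y : sphere x -> sphere y ->
  `|(d k)%:R * (P k).[dotp x y]| <= 2 * k.+1%:R ^+ M.
Proof.
move=> sx sy; rewrite normrM ger0_norm//; apply: le_trans (harm_dim_power k).
by rewrite ler_piMr// gegen_le1.
Qed.

Lemma zonal_sum_trivial n x y : (0 < n)%N -> sphere x -> sphere y ->
  `|zonal_sum n (dotp x y)| <= 2 ^+ M.+2 * n%:R ^+ M.+1.
Proof.
move=> n0 sx sy; apply: le_trans (ler_norm_sum _ _ _) _.
apply: (@le_trans _ _ (\sum_(k < n.+1) 2 * n.+1%:R ^+ M)).
  apply: ler_sum => k _; have kn : (k <= n)%N := ltn_ord k.
  rewrite normrM -[leRHS]mul1r; apply: ler_pM => //.
    have p1 : 1 `^ al = 1 :> R by rewrite powR1.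
    rewrite ger0_norm ?powR_ge0// -[leRHS]p1.
    have nn0 : 0 < node M n :> R by rewrite /node ltr0n; nia.
    apply: ge0_ler_powR; rewrite ?nnegrE// ?subr_ge0 ?ler_pdivrMr ?mul1r//.
      by rewrite /node ler_nat; nia.
    by rewrite gerBl divr_ge0// ltW.
  apply: le_trans (zonal_term_le _ sx sy) _; apply: ler_wpM2l => //.
  by apply: lerXn2r; rewrite ?nnegrE// ler_nat.
rewrite sumr_const card_ord -(mulr_natr (2 * n.+1%:R ^+ M)).
have h : n.+1%:R <= 2 * n%:R :> R by rewrite -natrM ler_nat; lia.
have h2 : n.+1%:R ^+ M.+1 <= (2 * n%:R) ^+ M.+1 :> R.
  by apply: lerXn2r; rewrite ?nnegrE ?mulr_ge0.
rewrite -mulrA -exprSr.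
by rewrite [2 ^+ _]exprS -mulrA -exprMn; apply: ler_wpM2l.
Qed.

(** Any K with al + 2 <= 2K serves; (K+3) n exceeds n + K + 1. *)
Lemma zonal_sum_bound : exists K : nat, exists2 C : R, 0 <= C & forall n L t Bd,
  (0 < n)%N -> 1 <= L -> 1 <= L ^+ 2 * (1 - t) ->
  (forall k, (k < (K + 3) * n)%N -> `|(d k)%:R * (P k).[t]| <= Bd) ->
  `|zonal_sum n t| <= C * ((L / n%:R) `^ al * L * Bd).
Proof.
have al20 : 0 <= al + 2 by rewrite addr_ge0.
pose K := Num.bound (al + 2).
have alK : al + 2 <= (2 * K)%:R.
  by apply: le_trans (ltW (archi_boundP al20)) _; rewrite ler_nat /K; lia.
have [C C0 H] := riesz_bound M al0 alK.
exists K, C => // n L t Bd n0 L1 Lt HB; apply: H => // k kn; apply: HB.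
by move: (K) n0 kn => K' n0 kn; nia.
Qed.

(** The general bound with L the reciprocal of sin (g/2), and the decay of the
    Gegenbauer polynomials for the individual terms. *)
Lemma zonal_sum_generic : exists2 C : R, 0 <= C & forall n x y, (0 < n)%N -> sphere x -> sphere y ->
  0 < sph_dist x y < pi ->
  `|zonal_sum n (dotp x y)| <= C * (n%:R `^ (la - al) /
     (sin (sph_dist x y) `^ la * sin (sph_dist x y / 2) `^ (1 + al))).
Proof.
have [K [C C0 H]] := zonal_sum_bound.
have [D D0 HD] := @gegen_decay R M.
pose E : R := (D * (K + 3)%:R ^+ M) `^ 2^-1.
have E0 : 0 <= E by exact: powR_ge0.
have E2 : E ^+ 2 = D * (K + 3)%:R ^+ M.
  rewrite -powR_mulrn// -powRrM mulVf// powRr1//.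
  by apply: mulr_ge0 => //; exact: exprn_ge0.
exists (C * E) => [|n x y n0 sx sy]; first exact: mulr_ge0.
have := cos_sph_dist sx sy; have := gegen_le1 _ sx sy.
move: (dotp x y) (sph_dist x y) => t g P1 cg /andP[g0 gpi].
have nr0 : 0 < n%:R :> R by rewrite ltr0n.
have sg : 0 < sin g by apply: sin_gt0_pi; rewrite g0.
have sg2 : 0 < sin (g / 2) by apply: sin_gt0_pihalf; rewrite divr_gt0//= ltr_pM2r.
have s1 : sin (g / 2) <= 1 by rewrite sin_le1.
have ct : 1 - t = 2 * sin (g / 2) ^+ 2.
  rewrite -cg {1}(splitr g) -mulr2n cos_mulr2n.
  by rewrite cos2sin2; ring.
have st : 1 - t ^+ 2 = sin g ^+ 2 by rewrite -cg cos2sin2; ring.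
have tI : -1 < t < 1.
  have : 0 < 1 - t ^+ 2 by rewrite st exprn_gt0.
  by move=> h; apply/andP; split; nra.
pose L := (sin (g / 2))^-1.
have L1 : 1 <= L by rewrite -invr1 lef_pV2 ?posrE.
have Lt : 1 <= L ^+ 2 * (1 - t).
  rewrite ct /L mulrCA exprVn mulVf ?mulr1 ?lt0r_neq0 ?exprn_gt0//.
  by rewrite ler1n.
have sla : 0 < sin g `^ la by rewrite powR_gt0.
have nla : 0 < n%:R `^ la :> R by rewrite powR_gt0.
have sq (z : R) : 0 <= z -> (z `^ la) ^+ 2 = z ^+ M.
  move=> z0; rewrite -powR_mulrn ?powR_ge0// -powRrM -powR_mulrn//.
  by congr (_ `^ _); rewrite /la; field.
have HB k : (k < (K + 3) * n)%N ->
    `|(d k)%:R * (P k).[t]| <= E * (n%:R `^ la / sin g `^ la).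
  move=> kK; have hk := HD k t tI (P1 k).
  rewrite mulrA ler_pdivlMr// -(ler_pXn2r (ltn0Sn 1)) ?nnegrE; last 2 first.
  - by apply: mulr_ge0 => //; exact: ltW.
  - by apply: mulr_ge0 => //; exact: ltW.
  rewrite exprMn real_normK ?num_real//.
  have -> : (sin g `^ la) ^+ 2 = (1 - t ^+ 2) `^ la.
    by rewrite st (expr2 (sin g)) powRM ?(ltW sg)// expr2.
  rewrite [leLHS]mulrC; apply: le_trans hk _.
  rewrite [leRHS]exprMn sq// E2 -mulrA -exprMn -natrM; apply: ler_wpM2l => //.
  by apply: lerXn2r; rewrite ?nnegrE// ler_nat.
apply: le_trans (H n L t _ n0 L1 Lt HB) _; rewrite -[leRHS]mulrA; apply: ler_wpM2l => //.
apply: eq_ler.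
have -> : (L / n%:R) `^ al = (sin (g / 2) `^ al)^-1 * (n%:R `^ al)^-1.
  rewrite powRM ?invr_ge0 ?(ltW sg2) ?(ltW nr0)//.
  by rewrite (powR_invl _ (ltW sg2)) (powR_invl _ (ltW nr0)).
have -> : n%:R `^ (la - al) = n%:R `^ la / n%:R `^ al :> R by rewrite powRD_gt0// powRN.
have -> : sin (g / 2) `^ (1 + al) = sin (g / 2) * sin (g / 2) `^ al.
  by rewrite powRD_gt0// powRr1 ?ltW.
by rewrite /L !invfM; ring.
Qed.

(** The general bound with a fixed L depending on the smallest angle only, and
    |P_k| <= 1 for the individual terms: this covers the antipodal point, where
    the Gegenbauer polynomials do not decay. *)
Lemma zonal_sum_away g0 : 0 < g0 -> exists2 C : R, 0 <= C & forall n x y, (0 < n)%N ->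
  sphere x -> sphere y -> g0 <= sph_dist x y <= pi ->
  `|zonal_sum n (dotp x y)| <= C * n%:R `^ (M%:R - al).
Proof.
move=> g00; have [gpi|gpi] := leP g0 pi; last first.
  by exists 0 => // n x y _ _ _ /andP[/le_trans h /h]; rewrite leNgt gpi.
have [K [C C0 H]] := zonal_sum_bound.
have c0 : cos g0 < 1.
  by rewrite -(@cos0 R) ltr_cos ?in_itv //= ?lexx ?pi_ge0 ?(ltW g00).
have d0 : 0 < 1 - cos g0 by rewrite subr_gt0.
(* Any L >= 1 with L (1 - cos g0) >= 1 would do. *)
pose L := 1 + (1 - cos g0)^-1.
have L1 : 1 <= L by rewrite lerDl invr_ge0 ltW.
have L0 : 0 <= L by apply: le_trans L1.
exists (C * (L `^ al * L * (2 * (K + 3)%:R ^+ M))) => [|n x y n0 sx sy /andP[h1 h2]].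
  by apply: mulr_ge0 => //; rewrite !mulr_ge0 ?powR_ge0 ?exprn_ge0.
have nr0 : 0 < n%:R :> R by rewrite ltr0n.
have tc : dotp x y <= cos g0.
  by rewrite -(cos_sph_dist sx sy) leNgt ltr_cos ?in_itv//= -?leNgt ?h2 ?(le_trans (ltW g00))// ltW.
have Lt : 1 <= L ^+ 2 * (1 - dotp x y).
  apply: (@le_trans _ _ (L * (1 - cos g0))).
    by rewrite /L mulrDl mul1r mulVf ?lt0r_neq0// lerDr ltW.
  have LL : L <= L ^+ 2 by rewrite expr2 ler_peMl.
  by apply: (ler_pM L0 (ltW d0) LL); rewrite lerD2l lerN2.
have HB k : (k < (K + 3) * n)%N ->
    `|(d k)%:R * (P k).[dotp x y]| <= 2 * (K + 3)%:R ^+ M * n%:R ^+ M.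
  move=> kK; apply: le_trans (zonal_term_le _ sx sy) _; rewrite -mulrA -exprMn -natrM; apply: ler_wpM2l => //.
  by apply: lerXn2r; rewrite ?nnegrE// ler_nat.
apply: le_trans (H n L (dotp x y) _ n0 L1 Lt HB) _; rewrite -[leRHS]mulrA; apply: ler_wpM2l => //; apply: eq_ler.
rewrite powRM ?invr_ge0 ?(ltW nr0)// powRD_gt0// powR_mulrn ?(ltW nr0)//.
rewrite powRN (powR_invl _ (ltW nr0)).
by ring.
Qed.

End estimates.

Theorem theorem1p1 (R : realType) (N : nat) (hN : (1 <= N)%N)
    (alpha : R) (halpha : 0 <= alpha) :
  [/\
    exists C : R,
      forall (a : nat -> nat) (Y : forall k, 'I_(a k) -> 'rV[R]_N.+1 -> R),
      (forall k, orthonormal_basis (spherical_harmonics k) (Y k)) ->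
      forall (n : nat) (x y : 'rV[R]_N.+1),
      (1 <= n)%N -> sphere x -> sphere y ->
      let g := sph_dist x y in
      `|pi / 2 - g| < n%:R / (n%:R + 1) * (pi / 2) ->
      `|riesz_kernel Y alpha x y n| <=
        C * (n%:R `^ ((N%:R - 1) / 2 - alpha) /
               (sin g `^ ((N%:R - 1) / 2) * sin (g / 2) `^ (1 + alpha))
             + n%:R `^ ((N%:R - 3) / 2 - alpha) /
               (sin g `^ ((N%:R + 1) / 2) * sin (g / 2) `^ (1 + alpha))
             + n%:R^-1 / (sin g / 2) ^+ (1 + N)),
    exists C : R,
      forall (a : nat -> nat) (Y : forall k, 'I_(a k) -> 'rV[R]_N.+1 -> R),
      (forall k, orthonormal_basis (spherical_harmonics k) (Y k)) ->
      forall (n : nat) (x y : 'rV[R]_N.+1),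
      (1 <= n)%N -> sphere x -> sphere y ->
      0 <= sph_dist x y <= pi ->
      `|riesz_kernel Y alpha x y n| <= C * n%:R ^+ N &
    forall gamma0 : R, 0 < gamma0 ->
    exists C : R,
      forall (a : nat -> nat) (Y : forall k, 'I_(a k) -> 'rV[R]_N.+1 -> R),
      (forall k, orthonormal_basis (spherical_harmonics k) (Y k)) ->
      forall (n : nat) (x y : 'rV[R]_N.+1),
      (1 <= n)%N -> sphere x -> sphere y ->
      gamma0 <= sph_dist x y <= pi ->
      `|riesz_kernel Y alpha x y n| <= C * n%:R `^ (N%:R - alpha)].
Proof.
case: N hN => [//|M] _; pose om : R := `|(M.+2%:R * @ball_volume R M)^-1|.
have om0 : 0 <= om by exact: normr_ge0.
split.
- have [C C0 H] := zonal_sum_generic M halpha.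
  exists (om * C) => a Y bY n x y n0 sx sy g hg.
  rewrite (@riesz_kernelE R M alpha a Y x y n bY sx sy) normrM -mulrA -/om; apply: ler_wpM2l => //.
  have hN : (M.+1%:R - 1) / 2 = M%:R / 2 :> R by rewrite -natr1 addrK.
  have gI : 0 < g < pi.
    have p0 := pi_gt0 R; have p2 : 0 < pi / 2 :> R by rewrite divr_gt0.
    have : `|pi / 2 - g| < pi / 2.
      apply: lt_le_trans hg _; rewrite -[leRHS]mul1r ler_pM2r//.
      by rewrite ler_pdivrMr ?ltr_wpDl// mul1r lerDl.
    by rewrite ltr_norml => /andP[h1 h2]; apply/andP; split; lra.
  apply: le_trans (H n x y n0 sx sy gI) _; rewrite hN; apply: ler_wpM2l => //.
  rewrite -addrA lerDl; have sg : 0 < sin g by apply: sin_gt0_pi.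
  apply: addr_ge0; apply: divr_ge0.
  - exact: powR_ge0.
  - by apply: mulr_ge0; exact: powR_ge0.
  - by rewrite invr_ge0.
  - by apply: exprn_ge0; apply: divr_ge0 => //; exact: ltW.
- exists (om * 2 ^+ M.+2) => a Y bY n x y n0 sx sy _.
  rewrite (@riesz_kernelE R M alpha a Y x y n bY sx sy) normrM -mulrA -/om; apply: ler_wpM2l => //.
  exact: zonal_sum_trivial.
move=> g0 g00; have [C C0 H] := zonal_sum_away M halpha g00.
exists (om * C) => a Y bY n x y n0 sx sy gI.
rewrite (@riesz_kernelE R M alpha a Y x y n bY sx sy) normrM -mulrA -/om; apply: ler_wpM2l => //.
apply: le_trans (H n x y n0 sx sy gI) _; apply: ler_wpM2l => //.
by apply: ler_powR; rewrite ?ler1n// lerD2r ler_nat.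
Qed.
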